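(* Let $\alpha>-1$ be real. For any $N\in\mathbb{N}$, any $f\in C_\infty(W_{\ge}^N)$ and any $t\ge0$, $$T_{\alpha,t}^{N+1}\,\Lambda_N^{N+1}f=\Lambda_N^{N+1}\,T_{\alpha+1,t}^{N}f .$$
   Context: $W_{\ge}^N=\{\mathbf{x}\in[0,\infty)^N: x_1\le\dots\le x_N\}$, $\mathring{W}_{\ge}^N=\{\mathbf{x}\in W_{\ge}^N: 0<x_1<\dots<x_N\}$. $C_\infty(W_{\ge}^N)$ is the set of continuous real functions on $W_{\ge}^N$ vanishing at infinity. $\Delta_N(\mathbf{y})=\prod_{1\le i<j\le N}(y_j-y_i)$. Kernels act on functions by $(\Lambda f)(x)=\int\Lambda(x,dy)f(y)$. Laguerre semigroup: for $\alpha>-1$, let $p_{\alpha,t}(x,y)$ be the transition density (with respect to Lebesgue measure) of the diffusion on $[0,\infty)$ with generator $L_\alpha=x\frac{d^2}{dx^2}+(-x+1+\alpha)\frac{d}{dx}$, where $\infty$ is a natural boundary and the origin is an entrance boundary if $\alpha\ge 0$ and a regular boundary with reflecting boundary condition if $-1<\alpha<0$. For $t>0$, $\mathbf{x}\in\mathring{W}_{\ge}^N$, $\mathbf{y}\in W_{\ge}^N$ put $$\mathbf{p}_{\alpha,t}^N(\mathbf{x},\mathbf{y})=e^{-\lambda^N t}\frac{\Delta_N(\mathbf{y})}{\Delta_N(\mathbf{x})}\det_{i,j=1}^N[p_{\alpha,t}(x_i,y_j)],\qquad \lambda^N=-\tfrac{N(N-1)}{2}.$$ $\{T_{\alpha,t}^N\}_{t\ge0}$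 is the Markov semigroup on $W_{\ge}^N$ with transition density $\mathbf{p}_{\alpha,t}^N$ ($T_{\alpha,0}^N$ is the identity); it is known to be Feller–Dynkin on $W_{\ge}^N$, its values at starting points in $W_{\ge}^N\setminus\mathring{W}_{\ge}^N$ being determined by continuity. Kernel: let $W^N=\{\mathbf{x}\in\mathbb{R}^N: x_1\le\dots\le x_N\}$ and, for $\mathbf{x}\in W^{N+1}$, $W^{N,N+1}(\mathbf{x})=\{\mathbf{y}\in W^N: x_1\le y_1\le x_2\le\dots\le y_N\le x_{N+1}\}$. For $\mathbf{x}\in W^{N+1}$ with $x_1<\dots<x_{N+1}$, $$\Lambda_N^{N+1}(\mathbf{x},d\mathbf{y})=N!\,\frac{\Delta_N(\mathbf{y})}{\Delta_{N+1}(\mathbf{x})}\mathbf{1}_{W^{N,N+1}(\mathbf{x})}(\mathbf{y})\,d\mathbf{y},$$ a probability measure; for other $\mathbf{x}\in W^{N+1}$, $\Lambda_N^{N+1}(\mathbf{x},\cdot)$ is the weak limit along any sequence of points with strictly increasing coordinates converging to $\mathbf{x}$ (the limit exists and is independent of the sequence). If $\mathbf{x}\in W_{\ge}^{N+1}$ then $\Lambda_N^{N+1}(\mathbf{x},\cdot)$ is supported on $W_{\ge}^N$, so $\Lambda_N^{N+1}$ is regarded as a Markov kernel from $W_{\ge}^{N+1}$ to $W_{\ge}^N$. *)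

(* Defs.v *)
From HB Require Import structures.
From mathcomp Require Import all_boot all_order all_algebra.
From mathcomp Require Import all_classical all_reals all_analysis.

Set Implicit Arguments.
Unset Strict Implicit.
Unset Printing Implicit Defensive.

Import Order.TTheory GRing.Theory Num.Theory.
Import numFieldNormedType.Exports.

Local Open Scope classical_set_scope.
Local Open Scope ring_scope.

(* R^n is 'rV[R]_n, with the library's product topology, the product
   sigma-algebra (defined as the library does for n-tuples) and Lebesgue
   measure. *)

Definition rV_coord (R : realType) (n : nat) (i : 'I_n) (x : 'rV[R]_n)
  : measurableTypeR R := x ord0 i.

Section measurable_rV.
Variables (R : realType) (n : nat).

Let rV_set0 : g_sigma_preimage (@rV_coord R n) set0.
Proof. exact: sigma_algebra0. Qed.

Let rV_setC A : g_sigma_preimage (@rV_coord R n) A ->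
  g_sigma_preimage (@rV_coord R n) (~` A).
Proof. exact: sigma_algebraC. Qed.

Let rV_bigcup (F : (set 'rV[R]_n)^nat) :
  (forall i, g_sigma_preimage (@rV_coord R n) (F i)) ->
  g_sigma_preimage (@rV_coord R n) (\bigcup_i (F i)).
Proof. exact: sigma_algebra_bigcup. Qed.

HB.instance Definition _ := @isMeasurable.Build default_measure_display
  'rV[R]_n (g_sigma_preimage (@rV_coord R n)) rV_set0 rV_setC rV_bigcup.

End measurable_rV.

Lemma measurable_rV_coord (R : realType) (n : nat) (i : 'I_n) :
  measurable_fun [set: 'rV[R]_n] (@rV_coord R n i).
Proof.
move=> _ Y mY; rewrite setTI; apply: sub_sigma_algebra => /=.
rewrite -bigcup_seq/=; exists i => /=; first by rewrite mem_index_enum.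
by exists Y => //; rewrite setTI.
Qed.

Lemma measurable_fun_rV (d : measure_display) (T : measurableType d)
    (R : realType) (n : nat) (f : T -> 'rV[R]_n) :
  (forall i, measurable_fun [set: T] (@rV_coord R n i \o f)) ->
  measurable_fun [set: T] f.
Proof.
move=> mf.
suff H : g_sigma_preimage (fun i => @rV_coord R n i \o f) `<=` measurable.
  by move=> _ A mA; apply: H; rewrite g_sigma_preimage_comp; exists A.
apply: smallest_sub; first exact: sigma_algebra_measurable.
case: n => [|n] in f mf *; first by rewrite big_ord0.
rewrite -bigcup_mkord_ord; apply: bigcup_sub => i Ii.
by move=> A [B mB <-]; exact: mf.
Qed.

Definition rV_cons (R : realType) (n : nat)
  (u : measurableTypeR R * 'rV[R]_n) : 'rV[R]_n.+1 :=
  \row_i (if unlift ord0 i is Some j then u.2 ord0 j else u.1).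

Lemma measurable_rV_cons (R : realType) (n : nat) :
  measurable_fun [set: measurableTypeR R * 'rV[R]_n] (@rV_cons R n).
Proof.
apply: measurable_fun_rV => i; rewrite /comp /rV_coord.
under eq_fun do rewrite mxE.
case: unliftP => [j _|_]; last exact: measurable_fst.
exact: (measurableT_comp (measurable_rV_coord j) measurable_snd).
Qed.

(* The canonical measure on a pushforward is named explicitly because its
   measurability argument cannot be inferred. *)
Definition rV_cons_measure (R : realType) (n : nat)
    (mu : {measure set 'rV[R]_n -> \bar R})
    : {measure set 'rV[R]_n.+1 -> \bar R} :=
  measure_function_pushforward__canonical__measure_function_Measure
    ((@lebesgue_measure R) \x^ mu)%E (@measurable_rV_cons R n).

Fixpoint lebesgue_rV (R : realType) (n : nat)
    : {measure set 'rV[R]_n -> \bar R} :=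
  if n is m.+1 return {measure set 'rV[R]_n -> \bar R} then
    rV_cons_measure (lebesgue_rV R m)
  else \d_(0 : 'rV[R]_0).

(* In the definitions below a function on a set E is a total function of which
   only the values on E matter. *)

Definition C_infty (R : realType) (X : topologicalType) (E : set X)
    (f : X -> R) : Prop :=
  {within E, continuous f} /\
  forall e : R, 0 < e -> exists K : set X,
    [/\ compact K, K `<=` E & forall x, E x -> ~ K x -> `|f x| < e].

Record Feller_Dynkin (R : realType) (X : topologicalType) (E : set X)
    (P : R -> (X -> R) -> X -> R) : Prop := {
  FD_C_infty : forall t f, 0 <= t -> C_infty E f -> C_infty E (P t f);
  FD_linear : forall t (a b : R) f g x, 0 <= t ->
    C_infty E f -> C_infty E g -> E x ->
    P t (fun y => a * f y + b * g y) x = a * P t f x + b * P t g x;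
  FD_contraction : forall t f, 0 <= t -> C_infty E f ->
    (forall x, E x -> 0 <= f x <= 1) -> forall x, E x -> 0 <= P t f x <= 1;
  FD_id : forall f x, C_infty E f -> E x -> P 0 f x = f x;
  FD_semigroup : forall s t f x, 0 <= s -> 0 <= t -> C_infty E f -> E x ->
    P (s + t) f x = P s (P t f) x;
  FD_continuous : forall f (e : R), C_infty E f -> 0 < e ->
    \forall t \near (0 : R)^'+, forall x, E x -> `|P t f x - f x| <= e
}.

(* f is in the domain of the infinitesimal generator, which maps f to g. *)
Definition infinitesimal_generator (R : realType) (X : topologicalType)
    (E : set X) (P : R -> (X -> R) -> X -> R) (f g : X -> R) : Prop :=
  [/\ C_infty E f, C_infty E g &
   forall e : R, 0 < e -> \forall t \near (0 : R)^'+,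
     forall x, E x -> `|t^-1 * (P t f x - f x) - g x| <= e].

Definition half_line (R : realType) : set R := [set x | 0 <= x].

(* Density s' of the scale function of L_alpha: with m(x) = x^alpha e^(-x),
   L_alpha f = (f' / s')' / m. *)
Definition laguerre_scale (R : realType) (alpha x : R) : R :=
  x `^ (- (alpha + 1)) * expR x.

(* g = L_alpha f with f in Feller's domain: L_alpha f belongs to
   C_infty [0, oo), and the reflecting condition f'(x) / s'(x) -> 0 is imposed
   at the origin when it is a regular boundary (alpha < 0). No condition is
   imposed at an entrance boundary (alpha >= 0) nor at the natural boundary
   at infinity. *)
Definition laguerre_generator (R : realType) (alpha : R) (f g : R -> R)
    : Prop :=
  [/\ C_infty (@half_line R) f,
      C_infty (@half_line R) g,
      forall x : R, 0 < x ->
        [/\ derivable f x 1, derivable (derive1 f) x 1,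
            {for x, continuous (derive1n 2 f)} &
            g x = x * derive1n 2 f x + (- x + 1 + alpha) * derive1 f x] &
      alpha < 0 ->
        derive1 f x / laguerre_scale alpha x @[x --> 0^'+] --> (0 : R)].

Definition density_op (R : realType) (p : R -> R -> R -> R) (t : R)
    (f : R -> R) (x : R) : R :=
  if t == 0 then f x
  else \int[@lebesgue_measure R]_(y in @half_line R) (p t x y * f y).

(* p is the transition density of the diffusion on [0, oo) with generator
   L_alpha, i.e. of the conservative Feller-Dynkin semigroup on [0, oo) whose
   infinitesimal generator is L_alpha on the domain above. For each t and x
   this determines p t x up to a Lebesgue-null set. *)
Record laguerre_density (R : realType) (alpha : R) (p : R -> R -> R -> R)
    : Prop := {
  ld_ge0 : forall t x y, 0 < t -> 0 <= x -> 0 <= y -> 0 <= p t x y;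
  ld_measurable : forall t x, 0 < t -> 0 <= x ->
    measurable_fun (@half_line R : set (measurableTypeR R))
      (p t x : measurableTypeR R -> measurableTypeR R);
  ld_mass : forall t x, 0 < t -> 0 <= x ->
    (\int[@lebesgue_measure R]_(y in @half_line R) (p t x y)%:E = 1)%E;
  ld_Feller_Dynkin : Feller_Dynkin (@half_line R) (density_op p);
  ld_generator : forall f g,
    infinitesimal_generator (@half_line R) (density_op p) f g <->
    laguerre_generator alpha f g
}.

Definition weyl (R : realType) (N : nat) : set 'rV[R]_N :=
  [set x | forall i j : 'I_N, (i <= j)%N -> x ord0 i <= x ord0 j].

Definition weyl_strict (R : realType) (N : nat) : set 'rV[R]_N :=
  [set x | forall i j : 'I_N, (i < j)%N -> x ord0 i < x ord0 j].

Definition weyl_ge (R : realType) (N : nat) : set 'rV[R]_N :=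
  [set x | weyl x /\ forall i : 'I_N, 0 <= x ord0 i].

Definition weyl_ge_interior (R : realType) (N : nat) : set 'rV[R]_N :=
  [set x | weyl_strict x /\ forall i : 'I_N, 0 < x ord0 i].

Definition interlace (R : realType) (N : nat) (x : 'rV[R]_N.+1)
    : set 'rV[R]_N :=
  [set y | weyl y /\ forall i : 'I_N,
     x ord0 (widen_ord (leqnSn N) i) <= y ord0 i <= x ord0 (lift ord0 i)].

Definition vandermonde (R : realType) (N : nat) (y : 'rV[R]_N) : R :=
  \prod_(i < N) \prod_(j < N | (i < j)%N) (y ord0 j - y ord0 i).

Definition kernel_op (R : realType) (m n : nat)
    (K : R.-pker 'rV[R]_m ~> 'rV[R]_n) (E : set 'rV[R]_n) (f : 'rV[R]_n -> R)
    (x : 'rV[R]_m) : R :=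
  \int[K x]_(y in E) f y.

Definition laguerre_density_N (R : realType) (N : nat) (p : R -> R -> R -> R)
    (t : R) (x y : 'rV[R]_N) : R :=
  let lambda : R := - ((N%:R * (N%:R - 1)) / 2) in
  expR (- lambda * t) * (vandermonde y / vandermonde x) *
  \det (\matrix_(i < N, j < N) p t (x ord0 i) (y ord0 j)).

(* T is the Feller-Dynkin Markov semigroup on weyl_ge with transition density
   laguerre_density_N p. The Feller property determines T t x at the points x
   of weyl_ge that are not interior. The measures T t x with t < 0 or x outside
   weyl_ge are irrelevant. *)
Record laguerre_semigroup (R : realType) (N : nat) (p : R -> R -> R -> R)
    (T : R -> R.-pker 'rV[R]_N ~> 'rV[R]_N) : Prop := {
  ls_support : forall t x, 0 <= t -> weyl_ge x ->
    (T t x (@weyl_ge R N) = 1)%E;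
  ls_Feller_Dynkin :
    Feller_Dynkin (@weyl_ge R N) (fun t f => kernel_op (T t) (@weyl_ge R N) f);
  ls_density : forall t x (A : set 'rV[R]_N), 0 < t -> weyl_ge_interior x ->
    measurable A ->
    (T t x A = \int[lebesgue_rV R N]_(y in A `&` @weyl_ge R N)
                 (laguerre_density_N p t x y)%:E)%E
}.

Definition weak_cvg (R : realType) (n : nat)
    (mu : nat -> {measure set 'rV[R]_n -> \bar R})
    (nu : {measure set 'rV[R]_n -> \bar R}) : Prop :=
  forall f : 'rV[R]_n -> R, continuous f ->
    (exists M : R, forall y, `|f y| <= M) ->
    (\int[mu k]_y f y) @[k --> \oo] --> (\int[nu]_y f y : R).

Record interlacing_kernel (R : realType) (N : nat)
    (L : R.-pker 'rV[R]_N.+1 ~> 'rV[R]_N) : Prop := {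
  ik_density : forall x (A : set 'rV[R]_N), weyl_strict x -> measurable A ->
    (L x A = \int[lebesgue_rV R N]_(y in A `&` interlace x)
               (N`!%:R * (vandermonde y / vandermonde x))%:E)%E;
  ik_weak_limit : forall (x : 'rV[R]_N.+1) (z : nat -> 'rV[R]_N.+1),
    weyl x -> ~ weyl_strict x -> (forall k, weyl_strict (z k)) ->
    z k @[k --> \oo] --> x -> weak_cvg (fun k => L (z k)) (L x)
}.

(* Main.v *)
Require Import Defs.
From HB Require Import structures.
From mathcomp Require Import all_boot all_order all_algebra.
From mathcomp Require Import all_classical all_reals all_analysis.
From mathcomp Require Import perm measurable_realfun ring lra.

(** Both sides are continuous in x on the chamber and the case t = 0 is trivial,
    so let t > 0 and let x be an interior point, where all kernels have
    densities.

    The heart of the matter is the case of one particle: if P and Q are the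
    Laguerre semigroups with parameters alpha and alpha + 1, the derivative in x
    of P_t(x, [y, oo)) is e^{-t} q_t(x, y). Tested against a function g and
    integrated over [x1, x2], this reads
      int_{x1}^{x2} Q_t g(w) dw
        = e^t int g(y) (P_t(x2, [y, oo)) - P_t(x1, [y, oo))) dy.
    For g = e^{-cy} it is a computation with the Laplace transform
      P_t e^{-c .}(x) = A^{-(alpha+1)} exp(- c e^{-t} x / A),
      A = 1 + c (1 - e^{-t}),
    which follows from the generator alone ([laguerre_laplace]): the right-hand
    side solves the Cauchy problem for L_alpha, whose solution is unique
    ([Feller_Dynkin_Cauchy]). Polynomials in e^{-y} then lead to
    g = 1_[a,b)(y) e^{-y} ([intertwined_itv]).

    For N particles, take f to be a product of such functions g_j over ordered
    disjoint intervals, divided by the Vandermonde product. The Vandermonde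
    factors of the two kernels cancel against it, and both sides become integrals
    of determinants. On the right, det [Q_t g_j(w_i)] is integrated over
    w_i in [x_i, x_{i+1}], which gives det [int_{x_i}^{x_{i+1}} Q_t g_j]. On the
    left, the Karlin-McGregor determinant of size N + 1 is integrated over all z
    interlacing with y, which gives a determinant of differences of tails in y;
    row and column operations ([det_interlace]) turn it into
    det [P_t(x_{i+1}, [y_j, oo)) - P_t(x_i, [y_j, oo))]. The one-particle identity
    equates the two, the factors e^t accounting for the difference between the
    normalizing exponentials ([box_identity]).

    Linear combinations of these products approximate every bounded continuous f
    boundedly and off the coincidence set, which the measures at interior points
    do not charge; dominated convergence gives the identity for f at x
    ([intertwining_interior]). Continuity up to the boundary comes from the Feller
    property for the semigroups, and from the weak limits defining the kernel for
    the interlacing kernel ([kernel_op_interlacing_continuous],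
    [laguerre_semigroup_continuous]). *)

Set Implicit Arguments.
Unset Strict Implicit.
Unset Printing Implicit Defensive.

Import Order.TTheory GRing.Theory Num.Theory.
Import numFieldNormedType.Exports.

Local Open Scope classical_set_scope.
Local Open Scope ring_scope.

(** * Feller-Dynkin semigroups and their Cauchy problem *)

Section C_infty_theory.
Context {R : realType} {X : topologicalType} {E : set X}.
Implicit Types f g : X -> R.

Lemma C_infty_lin a b f g : C_infty E f -> C_infty E g ->
  C_infty E (fun x => a * f x + b * g x).
Proof.
move=> [fc f0] [gc g0]; split.
  move=> x; apply: cvgD; apply: cvgM; first exact: cvg_cst.
  - exact: fc.
  - exact: cvg_cst.
  - exact: gc.
move=> e e0; pose m := 2 * (`|a| + `|b| + 1).
have m0 : 0 < m by rewrite mulr_gt0// ltr_wpDl.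
have [K [cK KE Kf]] := f0 _ (divr_gt0 e0 m0).
have [L [cL LE Lg]] := g0 _ (divr_gt0 e0 m0).
exists (K `|` L); split; first exact: compactU.
  by rewrite subUset.
move=> x Ex /not_orP[Kx Lx].
have {}Kf := Kf _ Ex Kx; have {}Lg := Lg _ Ex Lx.
apply: (le_lt_trans (ler_normD _ _)); rewrite !normrM.
have ha : `|a| * `|f x| <= `|a| * (e / m) by rewrite ler_wpM2l// ltW.
have hb : `|b| * `|g x| <= `|b| * (e / m) by rewrite ler_wpM2l// ltW.
apply: (le_lt_trans (lerD ha hb)); rewrite -mulrDl mulrA ltr_pdivrMr// mulrC.
rewrite ltr_pM2l// /m.
by have := normr_ge0 a; have := normr_ge0 b; lra.
Qed.

Lemma C_infty_max0 f : C_infty E f -> C_infty E (fun x => Num.max (f x) 0).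
Proof.
move=> [fc f0]; split.
  move=> x; apply: continuous_max; first exact: fc.
  exact: cvg_cst.
move=> e e0; have [K [cK KE Kf]] := f0 _ e0.
exists K; split => // x Ex Kx; apply: le_lt_trans (Kf _ Ex Kx).
by rewrite /Num.max; case: ltP => // _; rewrite normr0.
Qed.

Lemma C_inftyZ a f : C_infty E f -> C_infty E (fun x => a * f x).
Proof.
move=> Cf; have := C_infty_lin a 0 Cf Cf.
by under eq_fun do rewrite mul0r addr0.
Qed.

Lemma C_inftyB f g : C_infty E f -> C_infty E g ->
  C_infty E (fun x => f x - g x).
Proof.
move=> Cf Cg; have := C_infty_lin 1 (-1) Cf Cg.
by under eq_fun do rewrite mul1r mulN1r.
Qed.

End C_infty_theory.

Section Feller_Dynkin_theory.
Context {R : realType} {X : topologicalType} {E : set X}.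
Context {P : R -> (X -> R) -> X -> R} (FD : Feller_Dynkin E P).
Implicit Types f g : X -> R.

Lemma Feller_DynkinZ t a f x : 0 <= t -> C_infty E f -> E x ->
  P t (fun y => a * f y) x = a * P t f x.
Proof.
move=> t0 Cf Ex; have := FD_linear FD a 0 t0 Cf Cf Ex.
by under [X in P t X]eq_fun do rewrite mul0r addr0; rewrite mul0r addr0.
Qed.

Lemma Feller_DynkinB t f g x : 0 <= t -> C_infty E f -> C_infty E g -> E x ->
  P t (fun y => f y - g y) x = P t f x - P t g x.
Proof.
move=> t0 Cf Cg Ex; have := FD_linear FD 1 (-1) t0 Cf Cg Ex.
by under [X in P t X]eq_fun do rewrite mul1r mulN1r; rewrite mul1r mulN1r.
Qed.

Let FD_ge0 t f M : 0 <= t -> 0 < M -> C_infty E f ->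
  (forall x, E x -> 0 <= f x <= M) -> forall x, E x -> 0 <= P t f x <= M.
Proof.
move=> t0 M0 Cf fM x Ex.
have h y : E y -> 0 <= M^-1 * f y <= 1.
  move=> Ey; have /andP[f0 f1] := fM y Ey.
  by rewrite mulr_ge0 ?invr_ge0 ?(ltW M0)//= mulrC ler_pdivrMr// mul1r.
have := FD_contraction FD t0 (C_inftyZ M^-1 Cf) h Ex.
rewrite Feller_DynkinZ// => /andP[].
by rewrite pmulr_rge0 ?invr_gt0// => ->/=; rewrite mulrC ler_pdivrMr// mul1r.
Qed.

(** Positive and negative part are treated separately because contractivity is
    only assumed for functions with values between 0 and 1; the slack [e] in the
    proof allows a rescaling by a positive constant when [M = 0]. *)
Lemma Feller_Dynkin_norm_le t f M : 0 <= t -> C_infty E f ->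
  (forall x, E x -> `|f x| <= M) -> forall x, E x -> `|P t f x| <= M.
Proof.
move=> t0 Cf fM x Ex; apply/ler_addgt0Pl => e e0.
have M0 : 0 <= M := le_trans (normr_ge0 _) (fM x Ex).
have M1 : 0 < e + M by rewrite ltr_pwDl.
pose f1 x := Num.max (f x) 0; pose f2 x := Num.max (- f x) 0.
have C1 : C_infty E f1 by exact: C_infty_max0.
have C2 : C_infty E f2.
  apply: C_infty_max0; have := C_inftyZ (-1) Cf.
  by under eq_fun do rewrite mulN1r.
have -> : P t f x = P t f1 x - P t f2 x.
  rewrite -Feller_DynkinB//; congr P; apply/funext => y; rewrite /f1 /f2.
  by rewrite /Num.max; case: ltP => ?; case: ltP => ?; lra.
have /andP[p0 p1] : 0 <= P t f1 x <= e + M.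
  apply: FD_ge0 => // y /fM; rewrite ler_norml /f1 => /andP[? ?].
  by rewrite le_max lexx orbT ge_max (ltW M1) andbT; lra.
have /andP[q0 q1] : 0 <= P t f2 x <= e + M.
  apply: FD_ge0 => // y /fM; rewrite ler_norml /f2 => /andP[? ?].
  by rewrite le_max lexx orbT ge_max (ltW M1) andbT; lra.
by rewrite ler_norml; lra.
Qed.

End Feller_Dynkin_theory.

(** Composing [phi] with the projection of the line onto the interval from 0 to
    [t], which is 1-Lipschitz, gives a function with derivative 0 everywhere. *)
Lemma cst_of_flat {R : realType} (phi : R -> R) (t : R) : 0 <= t ->
  (forall s, 0 <= s <= t -> forall e, 0 < e -> exists2 d, 0 < d &
     forall r, 0 <= r <= t -> `|r - s| < d ->
       `|phi r - phi s| <= e * `|r - s|) ->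
  phi 0 = phi t.
Proof.
move=> t0 H.
pose c s := Num.max 0 (Num.min s t).
have c01 s : 0 <= c s <= t.
  by rewrite /c le_max lexx/= ge_max t0 ge_min lexx orbT.
have clip r s : `|c r - c s| <= `|r - s|.
  rewrite /c /Num.max /Num.min; case: (ltP r t) => rt; case: (ltP s t) => st;
  do ?[case: (ltP 0 r) => r0]; do ?[case: (ltP 0 s) => s0];
  do ?[case: (ltP 0 t) => tt]; rewrite ?subrr ?normr0 ?normr_ge0//;
  rewrite ler_norml; have := ler_norm (r - s); have := ler_norm (s - r);
  rewrite (distrC s); lra.
pose psi s := phi (c s).
have dpsi s : is_derive s (1 : R) psi 0.
  have : (fun h : R => h^-1 *: (psi (h *: 1 + s) - psi s)) @ 0^' --> (0 : R).
    apply/cvgrPdist_le => e e0.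
    have [d d0 hd] := H _ (c01 s) _ e0.
    near=> h; rewrite sub0r normrN.
    have h0 : h != 0 by near: h; exact: nbhs_dnbhs_neq.
    have ch : `|c (h *: 1 + s) - c s| <= `|h|.
      by apply: le_trans (clip _ _) _; rewrite addrK scaler1.
    have hd' : `|h| < d.
      by near: h; apply: dnbhs0_lt.
    have {}hd := hd _ (c01 _) (le_lt_trans ch hd').
    rewrite /GRing.scale/= normrM normfV mulrC ler_pdivrMr ?normr_gt0//.
    by apply: le_trans hd _; rewrite ler_pM2l.
  move=> h; have dv : derivable psi s 1 by apply/cvg_ex; exists 0.
  by apply: DeriveDef => //; rewrite /derive; apply/cvg_lim.
have := is_derive_0_is_cst 0 t dpsi.
rewrite /psi /c; rewrite minxx (max_idPr t0) (min_idPl t0) maxxx//.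
Unshelve. all: by end_near. Qed.

Lemma near_right0 {R : realType} (Q : R -> Prop) :
  (\forall y \near (0 : R)^'+, Q y) ->
  exists2 d : R, 0 < d & forall y, 0 < y -> y < d -> Q y.
Proof.
rewrite near_withinE => /nbhs_ballP[d /= d0 hd]; exists d => // y y0 yd.
by apply: hd => //; rewrite /ball/= sub0r normrN gtr0_norm.
Qed.

(** Uniqueness for the abstract Cauchy problem u' = A u, the derivative being
    taken uniformly on [E]: the function s |-> P_{t-s} u_s has derivative zero
    on [0, t], so that its values P_t u_0 at 0 and u_t at t agree. This is how a
    semigroup known only through its generator is computed explicitly. *)
Lemma Feller_Dynkin_Cauchy {R : realType} {X : topologicalType} {E : set X}
    {P : R -> (X -> R) -> X -> R} (FD : Feller_Dynkin E P)
    (u v : R -> X -> R) (t : R) (x : X) :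
  0 <= t -> E x ->
  (forall s, 0 <= s -> infinitesimal_generator E P (u s) (v s)) ->
  (forall s e, 0 <= s -> 0 < e -> exists2 d, 0 < d &
     forall r, 0 <= r -> `|r - s| < d -> forall y, E y ->
       `|u r y - u s y - (r - s) * v s y| <= e * `|r - s|) ->
  P t (u 0) x = u t x.
Proof.
move=> t0 Ex gen du.
have Cu s : 0 <= s -> C_infty E (u s) by move=> /gen[].
have Cv s : 0 <= s -> C_infty E (v s) by move=> /gen[].
pose phi s := P (t - s) (u s) x.
suff : phi 0 = phi t by rewrite /phi subr0 subrr (FD_id FD)//; exact: Cu.
apply: cst_of_flat => // s /andP[s0 st] e e0.
have e2 : 0 < e / 2 by rewrite divr_gt0.
have e4 : 0 < e / 4 by rewrite divr_gt0.
have [d1 d10 hd1] := du _ _ s0 e4.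
have [_ _ /(_ _ e4)] := gen _ s0.
move=> /near_right0[d2 d20 hd2].
have /near_right0[d3 d30 hd3] := FD_continuous FD (Cv _ s0) e4.
have gen_h h y : 0 <= h -> h < d2 -> E y ->
    `|P h (u s) y - u s y - h * v s y| <= e / 4 * h.
  rewrite le_eqVlt => /predU1P[<-|h0] hd Ey.
    by rewrite (FD_id FD)//; [rewrite subrr mul0r subr0 normr0 mulr0|exact: Cu].
  have := hd2 h h0 hd y Ey.
  move=> {}hd2; rewrite (_ : _ - _ =
    (h^-1 * (P h (u s) y - u s y) - v s y) * h); last by field; rewrite gt_eqF.
  by rewrite normrM (gtr0_norm h0) ler_wpM2r// ltW.
(* [r] and [s] differ by [h]: the semigroup law leaves the common operator
   P_{t - max r s}, a contraction, applied to the error that the generator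
   and the derivative of [u] control. *)
have main r h : 0 <= r -> 0 <= h -> r <= t -> s <= t -> h < d1 -> h < d2 -> h < d3 ->
  r = s + h \/ s = r + h -> `|phi r - phi s| <= e * h.
  move=> r0 h0 rt _ h1 h2 h3 [rs|sr].
  - have -> : phi s = P (t - r) (P h (u s)) x.
      rewrite /phi -(FD_semigroup FD) ?subr_ge0//; last exact: Cu.
      by congr P; rewrite rs; ring.
    rewrite /phi -(Feller_DynkinB FD) ?subr_ge0//; [|exact: Cu|]; last first.
      by apply: (FD_C_infty FD) => //; exact: Cu.
    apply: (Feller_Dynkin_norm_le FD) => //; rewrite ?subr_ge0//.
      by apply: C_inftyB; [exact: Cu|apply: (FD_C_infty FD) => //; exact: Cu].
    move=> y Ey; have := gen_h h y h0 h2 Ey.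
    have := hd1 r r0; rewrite (_ : r - s = h); last by rewrite rs; ring.
    rewrite (ger0_norm h0) => /(_ h1 y Ey).
    rewrite !ler_norml; lra.
  - have Cw : C_infty E (fun y => u r y - u s y - (- h) * v s y).
      by apply: C_inftyB; [apply: C_inftyB; exact: Cu|apply: C_inftyZ; exact: Cv].
    have -> : phi r = P (t - s) (P h (u r)) x.
      rewrite /phi -(FD_semigroup FD) ?subr_ge0//; last exact: Cu.
      by congr P; rewrite sr; ring.
    rewrite /phi -(Feller_DynkinB FD) ?subr_ge0//; [| |exact: Cu]; last first.
      by apply: (FD_C_infty FD) => //; exact: Cu.
    apply: (Feller_Dynkin_norm_le FD) => //; rewrite ?subr_ge0//.
      by apply: C_inftyB; [apply: (FD_C_infty FD) => //|]; exact: Cu.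
    move=> y Ey; have := gen_h h y h0 h2 Ey.
    have g3 : `|P h (v s) y - v s y| <= e / 4.
      move: h0; rewrite le_eqVlt => /predU1P[<-|h0].
        by rewrite (FD_id FD)//; [rewrite subrr normr0 ltW|exact: Cv].
      by have := hd3 h h0 h3 y Ey.
    have {}g3 : `|h * (P h (v s) y - v s y)| <= e / 4 * h.
      by rewrite normrM (ger0_norm h0) mulrC ler_wpM2r.
    have : `|P h (fun y => u r y - u s y - (- h) * v s y) y| <= e / 4 * h.
      apply: (Feller_Dynkin_norm_le FD) => // z Ez.
      have := hd1 r r0; rewrite (_ : r - s = - h); last by rewrite sr; ring.
      by rewrite normrN (ger0_norm h0) => /(_ h1 z Ez).
    rewrite !(Feller_DynkinB FD)//; [|exact: Cu|exact: Cu| |]; last 2 first.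
    + by apply: C_inftyB; exact: Cu.
    + by apply: C_inftyZ; exact: Cv.
    rewrite (Feller_DynkinZ FD)//; last exact: Cv.
    move: g3; rewrite !ler_norml; lra.
exists (Num.min d1 (Num.min d2 d3)); first by rewrite !lt_min d10 d20 d30.
move=> r /andP[r0 rt]; rewrite !lt_min => /and3P[h1 h2 h3].
apply: main => //; have [rs|sr] := leP r s; [right|left].
- by rewrite ler0_norm ?subr_le0//; ring.
- by rewrite gtr0_norm ?subr_gt0//; ring.
Qed.

(** * The Laplace transform of the Laguerre semigroup *)

Section exponentials.
Context {R : realType}.
Implicit Types a k x z : R.

Lemma is_derive_exp_lin a k x :
  is_derive x (1 : R) (fun y => a * expR (- (k * y))) (- (k * a) * expR (- (k * x))).
Proof.
have h : is_derive x (1 : R) (fun y => - (k * y)) (- k).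
  by apply: is_derive_eq; rewrite /GRing.scale/= mulr1.
have h2 := @is_derive1_comp _ expR (fun y => - (k * y)) x _ _ (is_derive_expR _) h.
have h3 := is_deriveZ a h2.
by apply: is_derive_eq h3 _; rewrite /GRing.scale/=; ring.
Qed.

Lemma derive1_exp_lin a k :
  derive1 (fun y => a * expR (- (k * y))) = (fun x => - (k * a) * expR (- (k * x))).
Proof.
apply/funext => x; rewrite derive1E; have := is_derive_exp_lin a k x.
by move=> h; rewrite derive_val.
Qed.

Lemma expR_lin_bound k x : 0 < k -> 0 <= x -> x * expR (- (k * x)) <= k^-1.
Proof.
move=> k0 x0; rewrite expRN ler_pdivrMr ?expR_gt0//.
rewrite -(ler_pM2l k0) mulrA divff ?gt_eqF// mul1r.
by have := expR_ge1Dx (k * x); lra.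
Qed.

Lemma expR_sqr_bound k x : 0 < k -> 0 <= x ->
  x ^+ 2 * expR (- (k * x)) <= 4 / k ^+ 2.
Proof.
move=> k0 x0; rewrite expRN ler_pdivrMr ?expR_gt0//.
rewrite mulrAC ler_pdivlMr ?exprn_gt0//.
have -> : expR (k * x) = expR (k * x / 2) ^+ 2.
  by rewrite expr2 -expRD; congr expR; field.
have h := expR_ge1Dx (k * x / 2).
have h0 : 0 <= k * x by rewrite mulr_ge0// ltW.
rewrite -exprMn mulrC (_ : 4 = 2 ^+ 2) ?expr2; last by ring.
by rewrite -!expr2 -exprMn lerXn2r// ?nnegrE ?mulr_ge0 ?expR_ge0//; lra.
Qed.

Lemma expR_taylor2 z : 0 <= expR (- z) - 1 + z <= z ^+ 2 * expR `|z|.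
Proof.
have h1 := expR_ge1Dx (- z); have h2 := expR_ge1Dx z.
apply/andP; split; first by lra.
have h3 : expR (- z) * (1 + z) <= 1.
  by rewrite -ler_pdivlMl ?expR_gt0// -expRN opprK mulr1.
have h4 : expR (- z) - 1 + z <= z * (1 - expR (- z)) by lra.
apply: le_trans h4 _; rewrite expr2 -mulrA.
have [z0|z0] := leP 0 z.
  rewrite ler_wpM2l// ger0_norm//.
  have : 1 <= expR z by rewrite -expR0 ler_expR.
  by move=> h5; rewrite (le_trans (_ : _ <= z))//; [lra|rewrite ler_peMr].
rewrite ltr0_norm//; rewrite ler_wnM2l ?(ltW z0)//.
have := expR_gt0 (- z) => e0.
have -> : 1 - expR (- z) = (expR z - 1) * expR (- z).
  by rewrite mulrBl -expRD subrr expR0 mul1r.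
by rewrite ler_wpM2r ?(ltW e0)//; lra.
Qed.

End exponentials.

Section C_infty_half_line.
Context {R : realType}.

Lemma C_infty_half_line (f : R -> R) : continuous f ->
  (forall e, 0 < e -> exists M, forall x, 0 <= x -> M < x -> `|f x| < e) ->
  C_infty (@half_line R) f.
Proof.
move=> cf f0; split; first exact: continuous_subspaceT.
move=> e /f0[M hM]; exists `[0, M]%classic; split; first exact: segment_compact.
  by move=> x /=; rewrite in_itv/= => /andP[].
move=> x x0 /=; rewrite in_itv/= => /negP; rewrite [0 <= x]x0/= -ltNge.
exact: hM.
Qed.

Lemma C_infty_lin_exp (a b k : R) : 0 < k ->
  C_infty (@half_line R) (fun x => (a * x + b) * expR (- (k * x))).
Proof.
move=> k0; apply: C_infty_half_line.
  move=> x; apply: cvgM.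
    by apply: cvgD; [apply: cvgM; [exact: cvg_cst|exact: cvg_id]|exact: cvg_cst].
  apply: continuous_comp; last exact: continuous_expR.
  by apply: cvgN; apply: cvgM; [exact: cvg_cst|exact: cvg_id].
move=> e e0; pose B := `|a| * (4 / k ^+ 2) + `|b| * k^-1.
exists (B / e) => x x0 Mx.
have x1 : 0 < x.
  apply: le_lt_trans Mx; rewrite divr_ge0 ?(ltW e0)// addr_ge0// mulr_ge0//.
    by rewrite divr_ge0// sqr_ge0.
  by rewrite invr_ge0 ltW.
rewrite -(ltr_pM2l x1); apply: (@le_lt_trans _ _ B); last first.
  by rewrite -ltr_pdivrMr.
rewrite normrM (ger0_norm (expR_ge0 _)).
have h : `|a * x + b| <= `|a| * x + `|b|.
  by rewrite (le_trans (ler_normD _ _))// normrM (ger0_norm x0).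
have {}h := ler_wpM2r (expR_ge0 (- (k * x))) h.
have {}h := ler_wpM2l x0 h; apply: le_trans h _.
rewrite (_ : x * _ = `|a| * (x ^+ 2 * expR (- (k * x))) +
   `|b| * (x * expR (- (k * x)))); last by ring.
by rewrite lerD// ler_wpM2l//; [exact: expR_sqr_bound|exact: expR_lin_bound].
Qed.

(** Exponentials are in the domain: L_alpha e^{-kx} = ((k^2+k) x - (1+alpha) k)
    e^{-kx}, and at the origin f'/s' behaves like x^{alpha+1}, which tends to 0
    because alpha > -1. *)
Lemma laguerre_generator_exp (alpha a k : R) : -1 < alpha -> 0 < k ->
  laguerre_generator alpha (fun x => a * expR (- (k * x)))
    (fun x => (a * (k ^+ 2 + k) * x + - (a * (1 + alpha) * k)) * expR (- (k * x))).
Proof.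
move=> al k0; split.
- have := C_infty_lin_exp 0 a k0.
  by under eq_fun do rewrite mul0r add0r.
- exact: C_infty_lin_exp.
- move=> x x0; rewrite derive1_exp_lin /= derive1_exp_lin; split.
  + by have [] := is_derive_exp_lin a k x.
  + rewrite ?derive1_exp_lin; by have [] := is_derive_exp_lin (- (k * a)) k x.
  + rewrite ?derive1_exp_lin; apply: cvgM; first exact: cvg_cst.
    apply: continuous_comp; last exact: continuous_expR.
    by apply: cvgN; apply: cvgM; [exact: cvg_cst|exact: cvg_id].
  + by rewrite ?derive1_exp_lin; ring.
- move=> _; rewrite derive1_exp_lin.
  have b0 : 0 < alpha + 1 by lra.
  have h : (fun x => - (k * a) * expR (- ((k + 1) * x)) * x `^ (alpha + 1))
     @ 0^'+ --> (0 : R).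
    rewrite -[X in _ --> X](mulr0 (- (k * a) * expR (- ((k + 1) * 0)))).
    apply: cvgM; last exact: powR_cvg0.
    apply: cvg_at_right_filter.
    apply: cvgM; first exact: cvg_cst.
    apply: continuous_comp; last exact: continuous_expR.
    by apply: cvgN; apply: cvgM; [exact: cvg_cst|exact: cvg_id].
  apply: cvg_trans h; apply: near_eq_cvg; near=> x.
  have x0 : 0 < x by near: x; exact: nbhs_right_gt.
  rewrite /laguerre_scale invfM -powRN opprK -expRN.
  rewrite (_ : - ((k + 1) * x) = - (k * x) + - x) ?expRD; last by ring.
  by ring.
Unshelve. all: by end_near. Qed.

End C_infty_half_line.

Lemma is_derive_eps {R : realType} (f : R -> R) (s l e : R) :
  is_derive s (1 : R) f l -> 0 < e -> exists2 d, 0 < d &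
  forall r, `|r - s| < d -> `|f r - f s - (r - s) * l| <= e * `|r - s|.
Proof.
move=> [df dl] e0.
have : (fun h : R => h^-1 *: (f (h *: 1 + s) - f s)) @ 0^' --> l.
  by rewrite -dl; exact: df.
move=> /cvgrPdist_le/(_ _ e0); rewrite near_withinE => /nbhs_ballP[d /= d0 hd].
exists d => // r rd; have [->|rs] := eqVneq r s.
  by rewrite !subrr mul0r subrr normr0 mulr0.
have rs0 : r - s != 0 by rewrite subr_eq0.
have := hd (r - s); rewrite /ball/= sub0r normrN => /(_ rd rs0).
rewrite /GRing.scale/= mulr1 subrK distrC.
rewrite (_ : f r - f s - _ = ((r - s)^-1 * (f r - f s) - l) * (r - s)); last first.
  by field.
by move=> h; rewrite normrM ler_wpM2r.
Qed.

(** The derivative in [s] of a_s e^{-k_s x} is uniform in [x >= 0] as long as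
    [k s] stays away from 0, since x e^{-kx} and x^2 e^{-kx} are then bounded.
    This uniformity is what the domain of the generator requires. *)
Lemma is_derive_exp_unif {R : realType} (a k : R -> R) (s a' k' e : R) :
  is_derive s (1 : R) a a' -> is_derive s (1 : R) k k' -> 0 < k s -> 0 < e ->
  exists2 d, 0 < d & forall r, `|r - s| < d -> forall x, 0 <= x ->
   `|a r * expR (- (k r * x)) - a s * expR (- (k s * x)) -
     (r - s) * ((a' - a s * k' * x) * expR (- (k s * x)))| <= e * `|r - s|.
Proof.
move=> da dk k0 e0.
pose B1 := (k s)^-1; pose B2 := 4 / (k s / 2) ^+ 2.
have B10 : 0 < B1 by rewrite invr_gt0.
have B20 : 0 < B2 by rewrite divr_gt0// exprn_gt0// divr_gt0.
have den1 : 0 < 2 * (1 + `|a s| * B1).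
  by rewrite mulr_gt0// ltr_pwDl// mulr_ge0// ltW.
(* [B1] and [B2] bound x e^{-kx} and x^2 e^{-kx/2}; [eta] and [eta'] are the
   precisions on the increments of [a] and [k] for which the four error terms
   [b1] to [b4] below add up to at most e |r - s|. *)
pose eta := e / (2 * (1 + `|a s| * B1)).
have eta0 : 0 < eta by exact: divr_gt0.
pose L := `|k'| + eta.
have L0 : 0 < L by rewrite ltr_wpDl.
have den2 : 0 < 4 * (1 + `|a'| * (B1 + B2) + `|a s| * B2 * L).
  have h1 : 0 <= `|a'| * (B1 + B2) by rewrite mulr_ge0// ltW// addr_gt0.
  have h2 : 0 <= `|a s| * B2 * L by exact: mulr_ge0 (mulr_ge0 (normr_ge0 _) (ltW B20)) (ltW L0).
  lra.
pose eta' := Num.min 1 (Num.min (k s / 2)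
  (e / (4 * (1 + `|a'| * (B1 + B2) + `|a s| * B2 * L)))).
have eta'0 : 0 < eta'.
  rewrite /eta' !lt_min ltr01/= (divr_gt0 k0)//=; exact: divr_gt0.
have eta'1 : eta' <= 1 by rewrite ge_min lexx.
have eta'k : eta' <= k s / 2 by rewrite /eta' !ge_min lexx orbT.
have eta'e : eta' * (4 * (1 + `|a'| * (B1 + B2) + `|a s| * B2 * L)) <= e.
  by rewrite -ler_pdivlMr// /eta' !ge_min lexx !orbT.
have etae : eta * (2 * (1 + `|a s| * B1)) = e by rewrite /eta divfK// gt_eqF.
have [d1 d10 hd1] := is_derive_eps da eta0.
have [d2 d20 hd2] := is_derive_eps dk eta0.
exists (Num.min d1 (Num.min d2 (eta' / L))).
  by rewrite !lt_min d10 d20 divr_gt0.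
move=> r; rewrite !lt_min => /and3P[r1 r2 r3] x x0.
have {}hd1 := hd1 _ r1; have {}hd2 := hd2 _ r2.
set h := r - s in r1 r2 r3 hd1 hd2 *.
pose dl := k r - k s.
have dlL : `|dl| <= L * `|h|.
  rewrite (_ : dl = (k r - k s - h * k') + h * k'); last by rewrite /dl; ring.
  have -> : L * `|h| = eta * `|h| + `|k'| * `|h| by rewrite /L; ring.
  rewrite (le_trans (ler_normD _ _))// lerD//.
  by rewrite normrM mulrC.
have dle : `|dl| <= eta'.
  by rewrite (le_trans dlL)// mulrC -ler_pdivlMr// ltW.
set E := expR (- (k s * x)).
have E0 : 0 < E by exact: expR_gt0.
have Er : expR (- (k r * x)) = expR (- (dl * x)) * E.
  by rewrite /E -expRD; congr expR; rewrite /dl; ring.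
have Er1 : 0 <= expR (- (k r * x)) <= 1.
  rewrite expR_ge0/= -expR0 ler_expR oppr_le0 mulr_ge0//.
  have := le_trans dle eta'k; rewrite ler_norml /dl; lra.
have /andP[T1 T2] := expR_taylor2 (dl * x).
have T3 : `|expR (- (dl * x)) - 1 + dl * x| * E <= dl ^+ 2 * B2.
  rewrite (ger0_norm T1); apply: (le_trans (ler_wpM2r (ltW E0) T2)).
  rewrite (_ : _ * E = dl ^+ 2 * (x ^+ 2 * (expR `|dl * x| * E))); last by ring.
  rewrite ler_wpM2l ?sqr_ge0// /E -expRD.
  have h2 := @expR_sqr_bound _ (k s / 2) x (divr_gt0 k0 (ltr0n _ 2)) x0.
  apply: le_trans h2; rewrite ler_wpM2l ?sqr_ge0// ler_expR.
  rewrite normrM (ger0_norm x0).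
  have : `|dl| * x <= k s / 2 * x by rewrite ler_wpM2r// (le_trans dle).
  lra.
have xE : x * E <= B1 by exact: expR_lin_bound.
have xE0 : 0 <= x * E by rewrite mulr_ge0// ltW.
have T4 : `|(expR (- (dl * x)) - 1) * E| <= `|dl| * B1 + dl ^+ 2 * B2.
  rewrite (_ : _ * E = - dl * (x * E) + (expR (- (dl * x)) - 1 + dl * x) * E);
    last by ring.
  rewrite (le_trans (ler_normD _ _))// lerD//.
    by rewrite normrM normrN (ger0_norm xE0) ler_wpM2l.
  by rewrite normrM (gtr0_norm E0).
have dl2 : dl ^+ 2 = `|dl| ^+ 2 by rewrite real_normK ?num_real.
set oa := a r - a s - h * a'; set ok := k r - k s - h * k'.
rewrite (_ : _ - _ = oa * expR (- (k r * x)) +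
   h * (a' * ((expR (- (dl * x)) - 1) * E)) +
   a s * ((expR (- (dl * x)) - 1 + dl * x) * E) - a s * (ok * (x * E))); last first.
  by rewrite Er /oa /ok /dl; ring.
have b1 : `|oa * expR (- (k r * x))| <= eta * `|h|.
  rewrite normrM (ger0_norm (expR_ge0 _)); case/andP: Er1 => _ Er1.
  by rewrite (le_trans _ hd1)// ler_piMr.
have b2 : `|h * (a' * ((expR (- (dl * x)) - 1) * E))| <=
    `|h| * (`|a'| * (eta' * (B1 + B2))).
  rewrite !normrM ler_wpM2l// ler_wpM2l// -normrM (le_trans T4)// dl2.
  rewrite mulrDr lerD// ler_wpM2r ?(ltW B10) ?(ltW B20)//.
  by rewrite expr2 -[leRHS]mulr1 ler_pM// (le_trans dle).
have b3 : `|a s * ((expR (- (dl * x)) - 1 + dl * x) * E)| <=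
    `|a s| * (eta' * (L * `|h|) * B2).
  rewrite normrM ler_wpM2l// normrM (gtr0_norm E0) (le_trans T3)// dl2.
  by rewrite ler_wpM2r ?(ltW B20)// expr2 ler_pM.
have b4 : `|a s * (ok * (x * E))| <= `|a s| * (eta * `|h| * B1).
  by rewrite normrM ler_wpM2l// normrM (ger0_norm xE0) ler_pM.
apply: (le_trans (ler_normB _ _)).
apply: (le_trans (lerD (ler_normD _ _) (lexx _))).
apply: (le_trans (lerD (lerD (ler_normD _ _) (lexx _)) (lexx _))).
apply: (le_trans (lerD (lerD (lerD b1 b2) b3) b4)).
have hh := normr_ge0 h.
rewrite (_ : _ + _ = `|h| * (eta * (2 * (1 + `|a s| * B1)) / 2 +
   (eta' * (4 * (1 + `|a'| * (B1 + B2) + `|a s| * B2 * L)) - 4 * eta') / 4)); last first.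
  by field.
rewrite etae mulrC ler_wpM2r//; lra.
Qed.

Section laplace.
Context {R : realType}.
Variables (c : R) (c0 : 0 < c).

(** With these three functions of [s], lag_amp * exp(- lag_rate * x) solves
    u' = L_alpha u: the rate satisfies the Riccati equation
    k' = - (k^2 + k), and the amplitude a' = - (alpha + 1) k a. The initial value
    is exp(- c x). *)
Definition lag_A (s : R) : R := 1 + c * (1 - expR (- s)).
Definition lag_rate (s : R) : R := c * expR (- s) / lag_A s.
Definition lag_amp (b s : R) : R := expR (- (b * ln (lag_A s))).

Lemma lag_A_gt0 (s : R) : 0 <= s -> 0 < lag_A s.
Proof.
move=> s0; rewrite /lag_A ltr_pwDl// mulr_ge0 ?(ltW c0)// subr_ge0.
by rewrite -expR0 ler_expR oppr_le0.
Qed.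

Lemma lag_rate_gt0 (s : R) : 0 <= s -> 0 < lag_rate s.
Proof. by move=> s0; rewrite divr_gt0 ?lag_A_gt0// mulr_gt0// expR_gt0. Qed.

Let is_derive_expN (s : R) : is_derive s (1 : R) (fun y => expR (- y)) (- expR (- s)).
Proof.
have h := @is_derive_exp_lin R 1 1 s.
have -> : (fun y : R => expR (- y)) = (fun y => 1 * expR (- (1 * y))).
  by apply: funext => y; rewrite !mul1r.
by apply: is_derive_eq h _; rewrite !mul1r mulN1r.
Qed.

Let is_derive_lag_A (s : R) : is_derive s (1 : R) lag_A (c * expR (- s)).
Proof.
have h := is_derive_expN s.
rewrite /lag_A; apply: is_derive_eq; rewrite /GRing.scale/=; ring.
Qed.

Lemma is_derive_lag_rate (s : R) : 0 <= s ->
  is_derive s (1 : R) lag_rate (- (lag_rate s ^+ 2 + lag_rate s)).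
Proof.
move=> s0; have h := is_derive_expN s; have h2 := is_derive_lag_A s.
have A0 : lag_A s != 0 by rewrite gt_eqF// lag_A_gt0.
have h3 := is_deriveV A0 (v := 1) (t := c * expR (- s)).
rewrite /lag_rate.
have h4 := is_deriveZ c h.
have h5 := is_deriveM h4 (h3 h2).
apply: is_derive_eq h5 _.
by rewrite /= /GRing.scale/=; field.
Qed.

Lemma is_derive_lag_amp (b s : R) : 0 <= s ->
  is_derive s (1 : R) (lag_amp b) (- (b * lag_rate s * lag_amp b s)).
Proof.
move=> s0.
have h1 := is_derive1_ln (lag_A_gt0 s0).
have h2 := @is_derive1_comp _ (@ln R) lag_A s _ _ h1 (is_derive_lag_A s).
have h3 := @is_derive1_comp _ (fun y => 1 * expR (- (b * y))) (@ln R \o lag_A) s _ _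
  (is_derive_exp_lin 1 b _) h2.
have -> : lag_amp b = (fun y => 1 * expR (- (b * y))) \o (@ln R \o lag_A).
  by apply/funext => y; rewrite /= mul1r.
apply: is_derive_eq h3 _.
by rewrite /lag_rate /lag_amp /=; ring.
Qed.

End laplace.

(** The right-hand side stays in the domain of the generator, by
    [laguerre_generator_exp], and solves the Cauchy problem, by
    [is_derive_exp_unif]. *)
Lemma laguerre_laplace {R : realType} (alpha : R) p (c t x : R) : -1 < alpha ->
  laguerre_density alpha p -> 0 < c -> 0 <= t -> 0 <= x ->
  density_op p t (fun y => expR (- (c * y))) x =
  lag_amp c (alpha + 1) t * expR (- (lag_rate c t * x)).
Proof.
move=> al [_ _ _ FD gen] c0 t0 x0.
pose u s y := lag_amp c (alpha + 1) s * expR (- (lag_rate c s * y)).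
pose v s y := (lag_amp c (alpha + 1) s * (lag_rate c s ^+ 2 + lag_rate c s) * y +
   - (lag_amp c (alpha + 1) s * (1 + alpha) * lag_rate c s)) *
   expR (- (lag_rate c s * y)).
rewrite -[RHS]/(u t x).
have <- : density_op p t (u 0) x = u t x.
  apply: (Feller_Dynkin_Cauchy FD (v := v)) => //.
    by move=> s s0; apply/gen; apply: laguerre_generator_exp => //; exact: lag_rate_gt0.
  move=> s e s0 e0.
  have [d d0 hd] := is_derive_exp_unif (is_derive_lag_amp c0 (alpha + 1) s0)
    (is_derive_lag_rate c0 s0) (lag_rate_gt0 c0 s0) e0.
  exists d => // r r0 rd y y0; apply: le_trans (hd r rd y y0).
  rewrite le_eqVlt; apply/orP; left; apply/eqP; rewrite /v /u; congr `| _ |.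
  move: (lag_amp _ _ r * _) (lag_amp c (alpha + 1) s) (lag_rate c s) => U A k.
  by move: (expR _) => E; ring.
congr density_op; apply/funext => y.
by rewrite /u /lag_amp /lag_rate /lag_A oppr0 expR0 subrr mulr0 addr0 ln1 mulr0 oppr0
  expR0 mul1r mulr1 divr1.
Qed.

(** * Real-valued Lebesgue integrals *)

Notation L1 mu f := (mu.-integrable [set: _] (EFin \o f)).

Section real_integrals.
Context {d} {T : measurableType d} {R : realType}.
Variable mu : {measure set T -> \bar R}.
Implicit Types f g : T -> R.

Lemma L1_measurable f : L1 mu f -> measurable_fun setT f.
Proof. by move=> /integrableP[/measurable_EFinP]. Qed.

Lemma L1_le f g : measurable_fun setT f -> L1 mu g ->
  (forall x, `|f x| <= g x) -> L1 mu f.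
Proof.
move=> mf ig fg; apply: (le_integrable _ _ _ ig) => //.
  exact/measurable_EFinP.
move=> x _; rewrite /= lee_fin; apply: le_trans (fg x) _; exact: ler_norm.
Qed.

Lemma L1_boundedM C f g : measurable_fun setT g -> (forall x, `|g x| <= C) ->
  L1 mu f -> L1 mu (fun x => g x * f x).
Proof.
move=> mg gC If; have Ig : L1 mu (fun x => C * `|f x|).
  have := integrableZl measurableT C (integrable_abse If).
  by apply: eq_integrable.
apply: L1_le Ig _; first by apply: measurable_funM => //; exact: L1_measurable.
by move=> x; rewrite normrM ler_wpM2r.
Qed.

Lemma L1Z c f : L1 mu f -> L1 mu (fun x => c * f x).
Proof.
move=> If; apply: (@L1_boundedM `|c| f (fun=> c)) => //.
Qed.

Lemma L1D f g : L1 mu f -> L1 mu g -> L1 mu (fun x => f x + g x).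
Proof.
move=> If Ig; have := integrableD measurableT If Ig.
by apply: eq_integrable.
Qed.

Lemma L1B f g : L1 mu f -> L1 mu g -> L1 mu (fun x => f x - g x).
Proof.
move=> If Ig; have := integrableB measurableT If Ig.
by apply: eq_integrable.
Qed.

Lemma L1_sum (I : Type) (s : seq I) (P : pred I) (F : I -> T -> R) :
  (forall i, P i -> L1 mu (F i)) -> L1 mu (fun x => \sum_(i <- s | P i) F i x).
Proof.
move=> IF; elim: s => [|i s IH].
  have -> : (fun x => \sum_(i <- [::] | P i) F i x) = cst 0.
    by apply/funext => x; rewrite big_nil.
  exact: integrable0.
have -> : (fun x => \sum_(j <- i :: s | P j) F j x) = (fun x => (if P i then F i x else 0) +
    \sum_(i <- s | P i) F i x).
  by apply/funext => x; rewrite big_cons; case: ifP => //; rewrite add0r.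
apply: L1D => //; case: (boolP (P i)) => Pi; [exact: IF|exact: integrable0].
Qed.

Lemma Rint_sum (I : Type) (s : seq I) (P : pred I) (F : I -> T -> R) :
  (forall i, P i -> L1 mu (F i)) ->
  \int[mu]_x (\sum_(i <- s | P i) F i x) = \sum_(i <- s | P i) \int[mu]_x F i x.
Proof.
move=> IF; elim: s => [|i s IH].
  under eq_Rintegral do rewrite big_nil.
  by rewrite big_nil /Rintegral integral0.
under eq_Rintegral do rewrite big_cons.
rewrite big_cons; case: ifPn => // Pi.
by rewrite RintegralD ?IH//; [exact: IF|exact: L1_sum].
Qed.

Lemma RintZ c f : L1 mu f -> \int[mu]_x (c * f x) = c * \int[mu]_x f x.
Proof. by move=> If; rewrite RintegralZl. Qed.

Lemma Rint_EFin f : L1 mu f -> (\int[mu]_x (f x)%:E = (\int[mu]_x f x)%:E)%E.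
Proof. by move=> If; rewrite /Rintegral fineK//; exact: integrable_fin_num. Qed.

Lemma Rint_norm_le f g : L1 mu f -> L1 mu g -> (forall x, `|f x| <= g x) ->
  `|\int[mu]_x f x| <= \int[mu]_x g x.
Proof.
move=> If Ig fg; apply: le_trans (le_normr_Rintegral measurableT If) _.
apply: le_Rintegral => //.
have := integrable_abse If; exact: eq_integrable.
Qed.

Lemma aeS (P Q : T -> Prop) : (forall x, P x -> Q x) ->
  {ae mu, forall x, P x} -> {ae mu, forall x, Q x}.
Proof. by move=> PQ; apply: filterS. Qed.

Lemma Rint_dominated (f_ : nat -> T -> R) f g :
  (forall n, measurable_fun setT (f_ n)) -> measurable_fun setT f ->
  {ae mu, forall x, f_ n x @[n --> \oo] --> f x} ->
  L1 mu g -> (forall n x, `|f_ n x| <= g x) ->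
  L1 mu f /\ \int[mu]_x f_ n x @[n --> \oo] --> \int[mu]_x f x.
Proof.
move=> mf_ mf ff Ig fg.
have [] := @dominated_convergence _ _ _ mu _ measurableT
  (fun n => EFin \o f_ n) (EFin \o f) (EFin \o g).
- by move=> n; exact/measurable_EFinP.
- exact/measurable_EFinP.
- apply: filterS ff => x h _ /=; apply: cvg_EFin; last exact: h.
  by apply: nearW.
- exact: Ig.
- by apply: aeW => x n _; rewrite /= lee_fin.
move=> If _ c; split=> //.
have h n : L1 mu (f_ n) by exact: L1_le (fg n).
move: c; rewrite (Rint_EFin If).
under eq_fun do rewrite (Rint_EFin (h _)).
by move/fine_cvgP => [_].
Qed.

End real_integrals.

Section product_integrals.
Context {d1 d2} {T1 : measurableType d1} {T2 : measurableType d2} {R : realType}.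
Variables (m1 : {sigma_finite_measure set T1 -> \bar R}).
Variables (m2 : {sigma_finite_measure set T2 -> \bar R}).

Lemma Rint_Fubini (f : T1 * T2 -> R) :
  L1 (m1 \x m2)%E f -> (forall x, L1 m2 (fun y => f (x, y))) ->
  (forall y, L1 m1 (fun x => f (x, y))) ->
  \int[m1]_x \int[m2]_y f (x, y) = \int[m2]_y \int[m1]_x f (x, y).
Proof.
move=> If f1 f2; have := Fubini If; rewrite /fubini_F /=.
under eq_integral do rewrite (Rint_EFin (f1 _)).
under [RHS]eq_integral do rewrite (Rint_EFin (f2 _)).
by rewrite /Rintegral => ->.
Qed.

Lemma L1_prod (f : T1 -> R) (g : T2 -> R) : L1 m1 f -> L1 m2 g ->
  L1 (m1 \x m2)%E (fun z => f z.1 * g z.2).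
Proof.
move=> If Ig; apply/integrable12ltyP.
  apply/measurable_EFinP; apply: measurable_funM.
    exact: (measurableT_comp (L1_measurable If)).
  exact: (measurableT_comp (L1_measurable Ig)).
have In : L1 m2 (fun x => `|g x|) by have := integrable_abse Ig; apply: eq_integrable.
have Im : L1 m1 (fun x => `|f x|) by have := integrable_abse If; apply: eq_integrable.
under eq_integral => x _.
  under eq_integral do rewrite /= normrM EFinM.
  rewrite (@ge0_integralZl_EFin _ _ _ m2 setT measurableT (fun y => `|g y|%:E))//;
    [|exact: measurable_int In].
  rewrite (Rint_EFin In).
  over.
rewrite (_ : (\int[m1]_x _)%E = (\int[m1]_x (`|f x| * \int[m2]_y `|g y|)%:E)%E)//.
have : L1 m1 (fun x => `|f x| * \int[m2]_y `|g y|).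
  by have := L1Z (\int[m2]_y `|g y|) Im; under eq_fun do rewrite mulrC.
by move=> h; rewrite (Rint_EFin h) ltry.
Qed.

Lemma Rint_prod (f : T1 -> R) (g : T2 -> R) : L1 m1 f -> L1 m2 g ->
  \int[(m1 \x m2)%E]_z (f z.1 * g z.2) = \int[m1]_x f x * \int[m2]_y g y.
Proof.
move=> If Ig; rewrite {1}/Rintegral -(integral12_prod_meas1 (L1_prod If Ig)).
rewrite /fubini_F /=.
under eq_integral => x _.
  rewrite (Rint_EFin (L1Z (f x) Ig)) RintZ//.
  over.
rewrite mulrC -RintZ// /Rintegral; congr fine; apply: eq_integral => x _.
by rewrite mulrC.
Qed.

End product_integrals.

Section change_of_measure.
Context {d} {T : measurableType d} {R : realType}.

Lemma L1_eq_measure (m1 m2 : {measure set T -> \bar R}) (f : T -> R) :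
  (forall A, measurable A -> m1 A = m2 A) -> L1 m1 f -> L1 m2 f.
Proof.
move=> m12 /integrableP[mf If]; apply/integrableP; split => //.
by rewrite (eq_measure_integral m1)// => A mA _; rewrite m12.
Qed.

End change_of_measure.

(** * The one-dimensional intertwining *)

Definition ind {R : realType} (b : bool) : R := if b then 1 else 0.

Lemma ind_ge0 {R : realType} b : 0 <= ind b :> R.
Proof. by case: b => /=. Qed.

Lemma ind_norm {R : realType} b : `|ind b : R| <= 1.
Proof. by case: b; rewrite /= ?normr1 ?normr0. Qed.
#[local] Hint Resolve ind_ge0 ind_norm : core.

Lemma measurable_ind {d} {T : measurableType d} {R : realType}
  (b : T -> bool) : measurable_fun setT b ->
  measurable_fun setT (fun x => ind (b x) : R).
Proof. by move=> mb; exact: measurable_fun_ifT. Qed.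

Section one_dim.
Context {R : realType}.
Implicit Types (k g : R -> R) (a b c x y z : R).
Local Notation mu := (@lebesgue_measure R).

Definition half_exp c y : R := ind (0 <= y) * expR (- (c * y)).

Lemma half_exp_ge0 c y : 0 <= half_exp c y.
Proof. by rewrite mulr_ge0 ?ind_ge0 ?expR_ge0. Qed.

Lemma continuous_exp_lin c : continuous (fun y : R => expR (- (c * y))).
Proof.
move=> x; apply: continuous_comp; last exact: continuous_expR.
by apply: cvgN; apply: cvgM; [exact: cvg_cst|exact: cvg_id].
Qed.

Lemma measurable_ler_l (a : R) : measurable_fun setT (fun y : R => ind (a <= y) : R).
Proof. by apply: measurable_ind; exact: measurable_fun_ler. Qed.

Lemma measurable_half_exp c : measurable_fun setT (half_exp c).
Proof.
apply: measurable_funM; first exact: measurable_ler_l.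
apply: continuous_measurable_fun; exact: continuous_exp_lin.
Qed.

Lemma half_exp_le c y : 1 <= c -> half_exp c y <= half_exp 1 y.
Proof.
move=> c1; rewrite /half_exp /ind; case: (leP 0 y) => y0; rewrite ?mul0r// !mul1r.
by rewrite ler_expR lerN2 ler_peMl.
Qed.

Lemma L1_half_exp c : 0 < c -> L1 mu (half_exp c).
Proof.
move=> c0; have I : L1 mu (exponential_pdf c).
  apply/integrableP; split.
    by apply/measurable_EFinP; exact: measurable_exponential_pdf.
  under eq_integral do rewrite /= ger0_norm ?exponential_pdf_ge0 ?(ltW c0)//.
  by rewrite integral_exponential_pdf// ltry.
have -> : half_exp c = (fun y => c^-1 * exponential_pdf c y).
  apply/funext => y; rewrite /half_exp /ind; case: (leP 0 y) => y0.
    by rewrite exponential_pdfE//= mulrA mulVf ?gt_eqF// mulNr.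
  by rewrite lt0_exponential_pdf// mulr0 mul0r.
exact: L1Z.
Qed.

Lemma Rint_exp_itv a b c : 0 < c -> a <= b ->
  \int[mu]_y (ind (a <= y <= b) * expR (- (c * y))) =
  (expR (- (c * a)) - expR (- (c * b))) / c.
Proof.
move=> c0; rewrite le_eqVlt => /predU1P[<-|ab].
  rewrite subrr mul0r; transitivity (\int[mu]_(y in [set a]) expR (- (c * y))).
    rewrite [RHS]Rintegral_mkcond; apply: eq_Rintegral => y _.
    rewrite patchE; have -> : (a <= y <= a) = (y \in [set a]).
      by rewrite -eq_le; apply/eqP/idP; rewrite inE => /= ->.
    by rewrite /ind; case: ifP => _; rewrite ?mul1r ?mul0r.
  by rewrite Rintegral_set1.
transitivity (\int[mu]_(y in `[a, b]) expR (- (c * y))).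
  rewrite [RHS]Rintegral_mkcond; apply: eq_Rintegral => y _.
  by rewrite patchE mem_setE in_itv/=; case: ifP => _; rewrite ?mul1r ?mul0r.
rewrite /Rintegral.
rewrite (@continuous_FTC2 _ _ (fun y => - c^-1 * expR (- (c * y))))//=.
- by field; rewrite gt_eqF.
- by apply: continuous_subspaceT; exact: continuous_exp_lin.
- split.
  + by move=> y _; have [] := is_derive_exp_lin (- c^-1) c y.
  + apply: cvg_at_right_filter; apply: cvgM; first exact: cvg_cst.
    exact: continuous_exp_lin.
  + apply: cvg_at_left_filter; apply: cvgM; first exact: cvg_cst.
    exact: continuous_exp_lin.
- move=> y _; rewrite derive1_exp_lin; by field; rewrite gt_eqF.
Qed.

Definition is_pdf k := [/\ forall y, 0 <= k y, L1 mu k,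
  forall y, y < 0 -> k y = 0 & \int[mu]_y k y = 1].

(** Extension of a transition density by zero, so that all integrals are over the
    whole line. *)
Definition ext (p : R -> R -> R -> R) t x y : R := ind (0 <= y) * p t x y.

Definition tail k y : R := \int[mu]_z (k z * ind (y <= z)).

Lemma density_opE p t g x : t != 0 ->
  density_op p t g x = \int[mu]_y (ext p t x y * g y).
Proof.
move=> /negPf t0; rewrite /density_op t0 Rintegral_mkcond.
apply: eq_Rintegral => y _; rewrite patchE /ext /ind.
have -> : (y \in @half_line R) = (0 <= y) by apply/idP/idP; rewrite inE.
by rewrite /ind; case: ifP => _; rewrite ?mul1r ?mul0r.
Qed.

Lemma laguerre_pdf alpha p t x : laguerre_density alpha p -> 0 < t -> 0 <= x ->
  is_pdf (ext p t x).
Proof.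
move=> [p0 pm p1 _ _] t0 x0.
have patchp : (ext p t x) = (p t x \_ (@half_line R)).
  apply/funext => y; rewrite patchE /ext /ind.
  have -> : (y \in @half_line R) = (0 <= y) by apply/idP/idP; rewrite inE.
  by rewrite /ind; case: ifP => _; rewrite ?mul1r ?mul0r.
have mh : measurable (@half_line R : set (measurableTypeR R)).
  rewrite (_ : @half_line R = `[0, +oo[%classic)//.
  by apply/seteqP; split => y /=; rewrite in_itv/= andbT.
have k0 y : 0 <= ext p t x y.
  by rewrite /ext /ind; case: (leP 0 y) => y0; rewrite ?mul0r// mul1r p0.
have mk : measurable_fun setT (ext p t x).
  have := (measurable_restrictT _ mh).1 (pm t x t0 x0).
  by rewrite patchp.
have ik : (\int[mu]_y (ext p t x y)%:E = 1)%E.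
  rewrite -(p1 t x t0 x0) [RHS]integral_mkcond; apply: eq_integral => y _.
  rewrite patchp !patchE.
  by case: ifP.
split => //.
- apply/integrableP; split; first exact/measurable_EFinP.
  under eq_integral do rewrite /= ger0_norm//.
  by rewrite ik ltry.
- by move=> y y0; rewrite /ext /ind leNgt y0/= mul0r.
- by rewrite /Rintegral ik.
Qed.

Section pdf.
Variable k : R -> R.
Hypothesis pk : is_pdf k.

Let k0 y : 0 <= k y. Proof. by case: pk. Qed.
Let Ik : L1 mu k. Proof. by case: pk. Qed.

Lemma pdf_L1 g C : measurable_fun setT g -> (forall y, `|g y| <= C) ->
  L1 mu (fun y => k y * g y).
Proof. by move=> mg gC; under eq_fun do rewrite mulrC; exact: L1_boundedM. Qed.

Let L1_tail y : L1 mu (fun z => k z * ind (y <= z)).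
Proof.
apply: (@pdf_L1 _ 1); first exact: measurable_ler_l.
by move=> z; exact: ind_norm.
Qed.

Lemma tail_le1 y : 0 <= tail k y <= 1.
Proof.
case: (pk) => _ _ _ <-; apply/andP; split.
  by apply: Rintegral_ge0 => z _; rewrite mulr_ge0// ind_ge0.
by apply: le_Rintegral => // z _; rewrite /ind; case: (y <= z); rewrite ?mulr1// mulr0.
Qed.

Lemma tail_0 y : y <= 0 -> tail k y = 1.
Proof.
case: (pk) => _ _ kn <- y0; apply: eq_Rintegral => z _.
rewrite /ind; case: (leP y z) => yz; rewrite ?mulr1// mulr0 kn//.
exact: lt_le_trans yz y0.
Qed.

Let measurable_kernel : measurable_fun setT
  (fun u : measurableTypeR R * measurableTypeR R => k u.2 * ind (u.1 <= u.2)).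
Proof.
apply: measurable_funM.
  exact: (measurableT_comp (L1_measurable Ik) measurable_snd).
by apply: measurable_ind; apply: measurable_fun_ler;
  [exact: measurable_fst|exact: measurable_snd].
Qed.

Lemma measurable_tail : measurable_fun setT (tail k).
Proof.
rewrite /tail /Rintegral; apply: (@measurableT_comp _ _ _ _ _ _ fine) => //.
apply: (@measurable_fun_fubini_tonelli_F _ _ _ _ R mu
  (fun u : measurableTypeR R * measurableTypeR R => (k u.2 * ind (u.1 <= u.2))%:E)).
  by apply/measurable_EFinP; exact: measurable_kernel.
by move=> u; rewrite lee_fin mulr_ge0// ind_ge0.
Qed.

(** Integration by parts, written as an exchange of integrals because [k] is
    merely integrable. *)
Lemma tail_Fubini g C : (forall y, `|g y| <= C) -> L1 mu g ->
  \int[mu]_y (g y * tail k y) = \int[mu]_z (k z * \int[mu]_y (g y * ind (y <= z))).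
Proof.
move=> gC Ig.
pose f (u : measurableTypeR R * measurableTypeR R) :=
  g u.1 * (k u.2 * ind (u.1 <= u.2)).
have If : L1 (mu \x mu)%E f.
  have := L1_prod Ig Ik => h.
  have := @L1_boundedM _ _ _ _ 1 _
    (fun u : measurableTypeR R * measurableTypeR R => ind (u.1 <= u.2)) _ _ h.
  have -> : f = (fun x : measurableTypeR R * measurableTypeR R =>
      ind (x.1 <= x.2) * (g x.1 * k x.2)).
    by apply: funext => u; rewrite /f mulrA mulrC.
  apply.
    by apply: measurable_ind; apply: measurable_fun_ler;
      [exact: measurable_fst|exact: measurable_snd].
  by move=> u; exact: ind_norm.
have gI z : L1 mu (fun y => g y * ind (y <= z)).
  under eq_fun do rewrite mulrC.
  apply: (@L1_boundedM _ _ _ _ 1) => //.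
  by apply: measurable_ind; exact: measurable_fun_ler.
have := @Rint_Fubini _ _ _ _ _ mu mu f If.
rewrite /f/= => H.
transitivity (\int[mu]_y \int[mu]_z (g y * (k z * ind (y <= z)))).
  by apply: eq_Rintegral => y _; rewrite RintZ; [|exact: L1_tail].
rewrite H.
- apply: eq_Rintegral => z _; rewrite -RintZ//; apply: eq_Rintegral => y _; ring.
- by move=> y; exact: L1Z.
- move=> z; have := L1Z (k z) (gI z).
  by under eq_fun do rewrite mulrCA.
Qed.

Lemma tail_exp c : 0 < c ->
  \int[mu]_y (half_exp c y * tail k y) =
  (1 - \int[mu]_y (k y * expR (- (c * y)))) / c.
Proof.
move=> c0; rewrite (@tail_Fubini _ 1); last exact: L1_half_exp.
  have m1 : measurable_fun setT (fun y : R => ind (0 <= y) * expR (- (c * y)) : R).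
    exact: measurable_half_exp.
  have b1 y : `|half_exp c y| <= 1.
    rewrite ger0_norm ?half_exp_ge0// /half_exp /ind; case: (leP 0 y) => y0.
      by rewrite mul1r -expR0 ler_expR oppr_le0 mulr_ge0// ltW.
    by rewrite mul0r.
  have e1 : \int[mu]_y (k y * expR (- (c * y))) = \int[mu]_y (k y * half_exp c y).
    apply: eq_Rintegral => y _; rewrite /half_exp /ind; case: (leP 0 y) => y0.
      by rewrite mul1r.
    by case: pk => _ _ -> //; rewrite !mul0r.
  rewrite e1; case: (pk) => _ _ kn <-.
  rewrite -RintegralB//; last exact: (@pdf_L1 _ 1).
  rewrite mulrC -RintZ; last by apply: L1B => //; exact: (@pdf_L1 _ 1).
  apply: eq_Rintegral => z _.
  have [z0|z0] := leP 0 z; last by rewrite kn// !mul0r subrr mulr0.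
  transitivity (k z * ((expR (- (c * 0)) - expR (- (c * z))) / c)).
    congr (_ * _); rewrite -Rint_exp_itv//; apply: eq_Rintegral => y _.
    by rewrite /half_exp /ind; case: (leP 0 y) => y0; case: (leP y z) => yz/=;
      rewrite ?mul0r ?mulr0 ?mulr1 ?mul1r.
  by rewrite mulr0 oppr0 expR0 /half_exp /ind z0 mul1r; field; rewrite gt_eqF.
move=> y; rewrite ger0_norm ?half_exp_ge0// /half_exp /ind; case: (leP 0 y) => y0.
  by rewrite mul1r -expR0 ler_expR oppr_le0 mulr_ge0// ltW.
by rewrite mul0r.
Qed.

End pdf.
End one_dim.

(** Bernoulli's inequality, and the upper bound that comes from
    (1 - s)(1 + s) <= 1. *)
Lemma ler_bernoulli {R : realType} (s : R) m : 0 <= s <= 1 ->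
  1 - m%:R * s <= (1 - s) ^+ m /\ (1 - s) ^+ m * (1 + m%:R * s) <= 1.
Proof.
move=> /andP[s0 s1]; elim: m => [|m [IH1 IH2]].
  by rewrite mul0r subr0 addr0 expr0 mulr1.
have ms : 0 <= m%:R * s by rewrite mulr_ge0.
split; rewrite exprS -natr1.
  have s2 : 0 <= 1 - s by rewrite subr_ge0.
  by have := ler_wpM2l s2 IH1; nra.
have e0 : 0 <= (1 - s) ^+ m by rewrite exprn_ge0// subr_ge0.
rewrite (_ : _ * _ = (1 - s) ^+ m * ((1 - s) * (1 + (m%:R + 1) * s))); last by ring.
apply: le_trans IH2; rewrite ler_wpM2l//; nra.
Qed.

Section one_dim_intertwining.
Context {R : realType}.
Implicit Types (g : R -> R) (a b c x y z : R).
Local Notation mu := (@lebesgue_measure R).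

(** A polynomial in e^{-y} converging to the indicator of [a, oo): with about
    e^{na} factors, (1 - e^{-ny})^{e^{na}} is close to exp(- e^{n(a-y)}), hence
    tends to 1 for y > a and to 0 for y < a. It passes from exponentials to
    indicators without a density theorem. *)
Definition cutoff a n y : R :=
  (1 - expR (- (n%:R * y))) ^+ Num.trunc (expR (n%:R * a)).

Lemma cutoff_bound a n y : 0 <= y -> 0 <= cutoff a n y <= 1.
Proof.
move=> y0; have e1 : expR (- (n%:R * y)) <= 1.
  by rewrite -expR0 ler_expR oppr_le0 mulr_ge0.
have e0 := expR_ge0 (- (n%:R * y)).
rewrite /cutoff exprn_ge0 ?subr_ge0//= exprn_ile1 ?subr_ge0//; lra.
Qed.

Lemma cutoff_cvg a y : 0 <= y -> y != a ->
  cutoff a n y @[n --> \oo] --> ind (a <= y).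
Proof.
move=> y0 ya; pose d := `|y - a|.
have d0 : 0 < d by rewrite normr_gt0 subr_eq0.
have h : (fun n : nat => expR (- d) ^+ n) @ \oo --> (0 : R).
  by apply: cvg_expr; rewrite gtr0_norm ?expR_gt0// -expR0 ltr_expR oppr_lt0.
apply/cvgrPdist_le => e e0.
have /cvgrPdist_le/(_ _ e0) := h; apply: filterS => n.
rewrite sub0r normrN ger0_norm ?exprn_ge0 ?expR_ge0// -expRM_natl.
apply: le_trans.
have e1 : 0 <= expR (- (n%:R * y)) <= 1.
  by rewrite expR_ge0 -expR0 ler_expR oppr_le0 mulr_ge0.
have [B1 B2] := ler_bernoulli (Num.trunc (expR (n%:R * a))) e1.
have /andP[t1 t2] := truncn_itv (expR_ge0 (n%:R * a)).
have /andP[c0 c1] := cutoff_bound a n y0.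
move: B1 B2 t1 t2 c0 c1; rewrite /cutoff.
set m := Num.trunc _; set s := expR (- (n%:R * y)) in e1 *.
case/andP : e1 => s0 s1 B1 B2 t1 t2 c0 c1.
case: (leP a y) => ay; rewrite /ind.
  rewrite ger0_norm ?subr_ge0//.
  have -> : n%:R * - d = - (n%:R * y) + n%:R * a.
    by rewrite /d ger0_norm ?subr_ge0//; ring.
  by rewrite expRD -/s lerBlDl -lerBlDr (le_trans _ B1)// lerD2l lerN2 mulrC ler_wpM2l.
rewrite sub0r normrN ger0_norm//.
have -> : n%:R * - d = - (- (n%:R * y) + n%:R * a).
  by rewrite /d ltr0_norm ?subr_lt0//; ring.
rewrite [leRHS]expRN -[leRHS]div1r ler_pdivlMr ?expR_gt0//.
apply: le_trans B2; rewrite ler_wpM2l//.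
rewrite expRD -/s; rewrite -natr1 in t2.
have : s * expR (n%:R * a) <= s * (m%:R + 1) by rewrite ler_wpM2l// ltW.
lra.
Qed.

Variables (alpha : R) (p q : R -> R -> R -> R) (t x1 x2 : R).
Hypotheses (al : -1 < alpha) (pd : laguerre_density alpha p)
  (qd : laguerre_density (alpha + 1) q) (t0 : 0 < t) (x10 : 0 <= x1) (x12 : x1 <= x2).

Definition tail_diff y : R := tail (ext p t x2) y - tail (ext p t x1) y.
Definition slice g w : R := ind (x1 <= w <= x2) * \int[mu]_y (ext q t w y * g y).

(** The one-dimensional intertwining against [g]: integrated over [y], it says
    that the derivative in [x] of P_t(x, [y, oo)) is e^{-t} q_t(x, y), where the
    density [q] belongs to alpha + 1. The bound by a multiple of e^{-y} makes all
    integrals converge and is kept under the limits below. *)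
Definition intertwined g := [/\ measurable_fun setT g,
  exists C, forall y, `|g y| <= C * half_exp 1 y,
  measurable_fun setT (slice g) &
  \int[mu]_w slice g w = expR t * \int[mu]_y (g y * tail_diff y)].

Let x20 : 0 <= x2. Proof. exact: le_trans x12. Qed.
Let p1 : is_pdf (ext p t x1). Proof. exact: (laguerre_pdf pd). Qed.
Let p2 : is_pdf (ext p t x2). Proof. exact: (laguerre_pdf pd). Qed.
Let pq w : 0 <= w -> is_pdf (ext q t w). Proof. exact: (laguerre_pdf qd). Qed.

Lemma tail_diff_norm y : `|tail_diff y| <= 1.
Proof.
have := tail_le1 p1 y; have := tail_le1 p2 y; rewrite /tail_diff ler_norml; lra.
Qed.

Lemma measurable_tail_diff : measurable_fun setT tail_diff.
Proof. by apply: measurable_funB; exact: measurable_tail. Qed.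

Lemma half_exp_bounded (g : R -> R) C :
  (forall y, `|g y| <= C * half_exp 1 y) -> forall y, `|g y| <= `|C|.
Proof.
move=> gC y; apply: le_trans (gC y) _; apply: le_trans (ler_norm _) _.
rewrite normrM ler_piMr// ger0_norm ?half_exp_ge0// /half_exp /ind.
by case: (leP 0 y) => y0; rewrite ?mul0r// !mul1r -expR0 ler_expR oppr_le0.
Qed.

Lemma half_exp_L1 (g : R -> R) C : measurable_fun setT g ->
  (forall y, `|g y| <= C * half_exp 1 y) -> L1 mu g.
Proof.
move=> mg gC; apply: (@L1_le _ _ _ mu g (fun y => C * half_exp 1 y)) => //.
by apply: L1Z; exact: L1_half_exp.
Qed.

Let L1_ind : L1 mu (fun w : R => ind (x1 <= w <= x2)).
Proof.
have -> : (fun w : R => ind (x1 <= w <= x2)) = (\1_(`[x1, x2]%classic) : R -> R).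
  by apply: funext => w; rewrite indicE mem_setE in_itv/= /ind; case: ifP.
exact: integrable_indic_itv.
Qed.

Lemma slice_norm g C : measurable_fun setT g -> (forall y, `|g y| <= C) ->
  forall w, `|slice g w| <= C * ind (x1 <= w <= x2).
Proof.
move=> mg gC w; rewrite /slice /ind; case: ifPn => [/andP[w1 w2]|_]; last first.
  by rewrite mul0r normr0 mulr0.
rewrite mul1r mulr1; have w0 := le_trans x10 w1.
have [k0 Ik _ k1] := pq w0.
have Ig := pdf_L1 (pq w0) mg gC.
apply: (@le_trans _ _ (\int[mu]_y (C * ext q t w y))); last by rewrite RintZ// k1 mulr1.
apply: Rint_norm_le => //; first exact: L1Z.
by move=> y; rewrite normrM (ger0_norm (k0 _)) mulrC ler_wpM2r.
Qed.

Lemma slice_L1 g C : measurable_fun setT g -> (forall y, `|g y| <= C) ->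
  measurable_fun setT (slice g) -> L1 mu (slice g).
Proof.
move=> mg gC ms; apply: (@L1_le _ _ _ mu _ (fun w => C * ind (x1 <= w <= x2))) => //;
  last exact: slice_norm.
exact: L1Z.
Qed.

Lemma intertwinedB g h : intertwined g -> intertwined h ->
  intertwined (fun y => g y - h y).
Proof.
move=> [mg [C gC] msg eg] [mh [D hD] msh eh].
have gC' := half_exp_bounded gC; have hD' := half_exp_bounded hD.
have sB : slice (fun y => g y - h y) = (fun w => slice g w - slice h w).
  apply: funext => w; rewrite /slice /ind; case: ifPn => [/andP[w1 w2]|_]; last first.
    by rewrite !mul0r subrr.
  have w0 := le_trans x10 w1.
  rewrite !mul1r -RintegralB//; [|exact: (pdf_L1 (pq w0) mg gC')
    |exact: (pdf_L1 (pq w0) mh hD')].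
  by apply: eq_Rintegral => y _; rewrite mulrBr.
split.
- exact: measurable_funB.
- exists (C + D) => y; rewrite mulrDl (le_trans (ler_normB _ _))// lerD//.
- by rewrite sB; exact: measurable_funB.
- rewrite sB RintegralB//; [|exact: slice_L1 gC' _|exact: slice_L1 hD' _].
  rewrite eg eh -mulrBr -RintegralB//.
  + congr (_ * _); apply: eq_Rintegral => y _; ring.
  + under [X in integrable _ _ X]eq_fun do rewrite /= mulrC.
    apply: (@L1_boundedM _ _ _ mu 1 _ tail_diff measurable_tail_diff
      tail_diff_norm).
    exact: half_exp_L1 gC.
  + under [X in integrable _ _ X]eq_fun do rewrite /= mulrC.
    apply: (@L1_boundedM _ _ _ mu 1 _ tail_diff measurable_tail_diff
      tail_diff_norm).
    exact: half_exp_L1 hD.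
Qed.

(** For [g] an exponential both sides are given by the Laplace transform. With
    A = 1 + c (1 - e^{-t}), raising alpha by one divides the amplitude by A, and
    integrating exp(- c e^{-t} w / A) over [x1, x2] multiplies it back by
    A e^t / c. *)
Lemma intertwined_exp c : 1 <= c -> intertwined (half_exp c).
Proof.
move=> c1; have c0 : 0 < c by exact: lt_le_trans c1.
have tn0 : t != 0 by rewrite gt_eqF.
have r0 := lag_rate_gt0 c0 (ltW t0).
have sE : slice (half_exp c) = (fun w => ind (x1 <= w <= x2) *
    (lag_amp c (alpha + 1 + 1) t * expR (- (lag_rate c t * w)))).
  apply: funext => w; rewrite /slice /ind; case: ifPn => [/andP[w1 w2]|_]; last first.
    by rewrite !mul0r.
  have w0 := le_trans x10 w1.
  have al1 : -1 < alpha + 1 by move: al; lra.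
  rewrite -(laguerre_laplace al1 qd c0 (ltW t0) w0) density_opE// !mul1r.
  apply: eq_Rintegral => y _; rewrite /half_exp /ext /ind.
  by case: (0 <= y); rewrite ?mul0r// !mul1r.
split.
- exact: measurable_half_exp.
- exists 1 => y; rewrite mul1r ger0_norm ?half_exp_ge0//; exact: half_exp_le.
- rewrite sE; apply: measurable_funM.
    by have := L1_measurable L1_ind.
  apply: measurable_funM => //; apply: continuous_measurable_fun.
  exact: continuous_exp_lin.
- have Ih := L1_half_exp c0.
  have tI k : is_pdf k -> L1 mu (fun y => half_exp c y * tail k y).
    move=> pk; under [X in integrable _ _ X]eq_fun do rewrite /= mulrC.
    apply: (@L1_boundedM _ _ _ mu 1) => //; first exact: measurable_tail.
    by move=> y; have /andP[u0 u1] := tail_le1 pk y; rewrite ger0_norm.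
  under [X in _ = _ * X]eq_Rintegral do rewrite mulrBr.
  rewrite RintegralB//; [|exact: tI|exact: tI].
  rewrite !tail_exp// -!density_opE// !(laguerre_laplace al pd c0 (ltW t0))//.
  rewrite sE.
  transitivity (\int[mu]_w (lag_amp c (alpha + 1 + 1) t *
      (ind (x1 <= w <= x2) * expR (- (lag_rate c t * w))))).
    by apply: eq_Rintegral => w _; ring.
  rewrite RintZ; last first.
    apply: (@L1_le _ _ _ mu _ (fun w => ind (x1 <= w <= x2))) => //.
      apply: measurable_funM; first by have := L1_measurable L1_ind.
      apply: continuous_measurable_fun; exact: continuous_exp_lin.
    move=> w; rewrite /ind; case: ifPn => [/andP[w1 w2]|_]; last first.
      by rewrite mul0r normr0.
    rewrite mul1r ger0_norm ?expR_ge0// -expR0 ler_expR oppr_le0 mulr_ge0 ?(ltW r0)//.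
    exact: le_trans w1.
  rewrite Rint_exp_itv//.
  have A0 := lag_A_gt0 c0 (ltW t0).
  have -> : lag_amp c (alpha + 1 + 1) t = lag_amp c (alpha + 1) t / lag_A c t.
    rewrite /lag_amp mulrDl mul1r opprD expRD; congr (_ * _).
    by rewrite expRN lnK.
  rewrite (_ : expR t = (expR (- t))^-1); last by rewrite expRN invrK.
  rewrite /lag_rate; field.
  by rewrite !gt_eqF ?expR_gt0.
Qed.

Lemma intertwined_cutoff a n m c : 1 <= c ->
  intertwined (fun y => half_exp c y * (1 - expR (- (n%:R * y))) ^+ m).
Proof.
elim: m c => [|m IH] c c1.
  under eq_fun do rewrite expr0 mulr1.
  exact: intertwined_exp.
have := intertwinedB (IH _ c1) (IH (c + n%:R) (ler_wpDr (ler0n _ _) c1)).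
congr intertwined; apply: funext => y; rewrite exprS /half_exp.
by rewrite (_ : - ((c + n%:R) * y) = - (c * y) + - (n%:R * y)) ?expRD; ring.
Qed.

(** Dominated convergence along [cutoff]. The factor e^{-y} provides the
    dominating function. *)
Lemma intertwined_ray a : intertwined (fun y => ind (a <= y) * half_exp 1 y).
Proof.
pose g_ n y := half_exp 1 y * cutoff a n y.
pose g y := ind (a <= y) * half_exp 1 y.
have Ig n : intertwined (g_ n) by exact: intertwined_cutoff.
have gn n y : `|g_ n y| <= half_exp 1 y.
  rewrite normrM (ger0_norm (half_exp_ge0 _ _)).
  have [y0|y0] := leP 0 y; last by rewrite /half_exp /ind [0 <= y]leNgt y0/= !mul0r.
  rewrite ler_piMr ?half_exp_ge0//.
  by have /andP[u0 u1] := cutoff_bound a n y0; rewrite ger0_norm.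
have gg y : `|g y| <= half_exp 1 y.
  rewrite normrM (ger0_norm (half_exp_ge0 _ _)) ler_piMl ?half_exp_ge0//.
  exact: ind_norm.
have mg : measurable_fun setT g.
  by apply: measurable_funM; [exact: measurable_ler_l|exact: measurable_half_exp].
have gcvg y : y != a -> g_ n y @[n --> \oo] --> g y.
  move=> ya; rewrite /g_ /g mulrC; have [y0|y0] := leP 0 y.
    by apply: cvgM; [exact: cvg_cst|exact: cutoff_cvg].
  rewrite /half_exp /ind [0 <= y]leNgt y0/= !mul0r.
  under eq_fun do rewrite mul0r.
  exact: cvg_cst.
have ae_a : {ae mu, forall y : measurableTypeR R, y != a}.
  exists [set a]; split => //; first exact: lebesgue_measure_set1.
  by move=> y /= /negP; rewrite negbK => /eqP.
have half_exp_le1 y : half_exp 1 y <= 1.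
  have := @half_exp_bounded (half_exp 1) 1; rewrite normr1 => h.
  apply: le_trans (ler_norm _) _; apply: h => z.
  by rewrite mul1r ger0_norm ?half_exp_ge0.
have scvg w : slice (g_ n) w @[n --> \oo] --> slice g w.
  rewrite /slice /ind; case: ifPn => [/andP[w1 w2]|_]; last first.
    rewrite mul0r; under eq_fun do rewrite mul0r.
    exact: cvg_cst.
  have w0 := le_trans x10 w1.
  rewrite mul1r; under eq_fun do rewrite mul1r.
  have [k0 Ik _ _] := pq w0.
  have mk := L1_measurable Ik.
  apply: (@Rint_dominated _ _ _ mu _ _ (ext q t w) _ _ _ Ik _).2.
  - by move=> n; apply: measurable_funM => //; case: (Ig n).
  - exact: measurable_funM.
  - apply: aeS ae_a => y ya; apply: cvgM; first exact: cvg_cst.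
    exact: gcvg.
  - move=> n y; rewrite normrM (ger0_norm (k0 _)) ler_piMr//.
    exact: le_trans (gn n y) _.
have msg : measurable_fun setT (slice g).
  apply: (@measurable_fun_cvg _ _ _ setT (fun n => slice (g_ n))) => //.
  by move=> n; case: (Ig n).
have g1 n y : `|g_ n y| <= 1 by exact: le_trans (gn n y) _.
split => //; first by exists 1 => y; rewrite mul1r; exact: gg.
have c1 : (\int[mu]_w slice (g_ n) w) @[n --> \oo] --> \int[mu]_w slice g w.
  apply: (@Rint_dominated _ _ _ mu _ _ (fun w => ind (x1 <= w <= x2)) _ _ _ L1_ind _).2 => //.
  - by move=> n; case: (Ig n).
  - by apply: aeW => w; exact: scvg.
  - move=> n w; have [mgn _ _ _] := Ig n.
    by have := slice_norm mgn (g1 n) w; rewrite mul1r.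
have c2 : (\int[mu]_y (g_ n y * tail_diff y)) @[n --> \oo] -->
    \int[mu]_y (g y * tail_diff y).
  have mt := measurable_tail_diff.
  apply: (@Rint_dominated _ _ _ mu _ _ (half_exp 1) _ _ _ (L1_half_exp ltr01) _).2 => //.
  - by move=> n; apply: measurable_funM => //; case: (Ig n).
  - exact: measurable_funM.
  - apply: aeS ae_a => y ya; apply: cvgM; last exact: cvg_cst.
    exact: gcvg.
  - move=> n y; rewrite normrM -[leRHS]mulr1 ler_pM//.
    exact: tail_diff_norm.
have c3 : (\int[mu]_w slice (g_ n) w) @[n --> \oo] -->
    expR t * \int[mu]_y (g y * tail_diff y).
  have -> : (fun n => \int[mu]_w slice (g_ n) w) =
      (fun n => expR t * \int[mu]_y (g_ n y * tail_diff y)).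
    by apply: funext => n; case: (Ig n).
  by apply: cvgM => //; exact: cvg_cst.
exact: (cvg_unique _ c1 c3).
Qed.

Lemma intertwined_itv a b : a <= b ->
  intertwined (fun y => ind (a <= y < b) * half_exp 1 y).
Proof.
move=> ab; have := intertwinedB (intertwined_ray a) (intertwined_ray b).
congr intertwined; apply: funext => y; rewrite -mulrBl; congr (_ * _).
rewrite /ind ltNge; case: (leP b y) => yb; rewrite ?andbF ?andbT ?subr0//.
by rewrite (le_trans ab yb) subrr.
Qed.

End one_dim_intertwining.

(** * Lebesgue measure on row vectors *)

Section rV_cons_theory.
Context {R : realType} {n : nat}.

Definition rV_tail (y : 'rV[R]_n.+1) : 'rV[R]_n := \row_j y ord0 (lift ord0 j).

Lemma rV_cons0 (u : measurableTypeR R * 'rV[R]_n) : rV_cons u ord0 ord0 = u.1.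
Proof. by rewrite mxE unlift_none. Qed.

Lemma rV_consS (u : measurableTypeR R * 'rV[R]_n) j :
  rV_cons u ord0 (lift ord0 j) = u.2 ord0 j.
Proof. by rewrite mxE liftK. Qed.

Lemma rV_consK (u : measurableTypeR R * 'rV[R]_n) : rV_tail (rV_cons u) = u.2.
Proof. by apply/rowP => j; rewrite mxE rV_consS. Qed.

Lemma measurable_rV_tail : measurable_fun setT rV_tail.
Proof.
apply: measurable_fun_rV => i; rewrite /comp /rV_coord.
under eq_fun do rewrite mxE.
exact: measurable_rV_coord.
Qed.

End rV_cons_theory.

Lemma sigma_finite_lebesgue_rV (R : realType) (n : nat) :
  sigma_finite setT (lebesgue_rV R n).
Proof.
elim: n => [|n /sigma_finiteP[G [TG ndG Goo]]].
  exists (fun=> setT); first by rewrite bigcup_const.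
  move=> k; split=> //; rewrite /= diracE; exact: ltry.
have /sigma_finiteP[F [TF ndF Foo]] := sigma_finiteT (@lebesgue_measure R).
exists (fun k => [set y : 'rV[R]_n.+1 | F k (y ord0 ord0) /\
   G k (rV_tail y)]).
  apply/esym; rewrite -subTset => y _.
  have [i _ Fi] : (\bigcup_i F i) (y ord0 ord0) by rewrite -TF.
  have [j _ Gj] : (\bigcup_i G i) (rV_tail y) by rewrite -TG.
  exists (maxn i j) => //=; split.
    by move: Fi; apply/subsetPset/ndF; rewrite leq_maxl.
  by move: Gj; apply/subsetPset/ndG; rewrite leq_maxr.
move=> k; have [mF Fk] := Foo k; have [mG Gk] := Goo k.
split.
  have h1 := @measurable_rV_coord R n.+1 ord0 measurableT _ mF.
  have h2 := @measurable_rV_tail R n measurableT _ mG.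
  by have := measurableI _ _ h1 h2; rewrite !setTI.
rewrite /= /pushforward.
set S := (X in ((_ \x^ _) X < _)%E); have -> : S = F k `*` G k.
  by apply/seteqP; split=> [u|u]; rewrite /S/= rV_consK rV_cons0.
by rewrite product_measure2E// lte_mul_pinfty// ge0_fin_numE.
Qed.

(** A constant to which a sigma-finite structure can be attached:
    [lebesgue_rV R n] is itself a bundled measure, computed by recursion. *)
Definition leb (R : realType) (n : nat) : set 'rV[R]_n -> \bar R :=
  lebesgue_rV R n.
Arguments leb : clear implicits.

HB.instance Definition _ (R : realType) (n : nat) :=
  Measure.copy (leb R n) (lebesgue_rV R n).
HB.instance Definition _ (R : realType) (n : nat) :=
  @Measure_isSigmaFinite.Build _ _ _ (leb R n) (sigma_finite_lebesgue_rV R n).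

Section leb_theory.
Context {R : realType}.
Local Notation mu := (@lebesgue_measure R).

Lemma leb_cons n (f : 'rV[R]_n.+1 -> R) : measurable_fun setT f ->
  L1 (mu \x leb R n)%E (f \o @rV_cons R n) ->
  L1 (leb R n.+1) f /\
  \int[leb R n.+1]_y f y = \int[(mu \x leb R n)%E]_u f (rV_cons u).
Proof.
move=> mf If.
have e12 A : measurable A -> (mu \x leb R n)%E A = (mu \x^ leb R n)%E A.
  move=> mA; apply: product_measure_unique => // B C mB mC.
  exact: product_measure2E.
have If2 := L1_eq_measure e12 If.
have mE : measurable_fun setT (EFin \o f) by exact/measurable_EFinP.
split.
  exact: (integrable_pushforward (@measurable_rV_cons R n) mE If2 measurableT).
rewrite /Rintegral; congr fine.
rewrite (integral_pushforward (@measurable_rV_cons R n) mE If2 measurableT).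
by rewrite preimage_setT; apply: eq_measure_integral => A mA _; symmetry; exact: e12.
Qed.

Lemma measurable_prod_coord n (h : 'I_n -> R -> R) :
  (forall i, measurable_fun setT (h i)) ->
  measurable_fun setT (fun y : 'rV[R]_n => \prod_i h i (y ord0 i)).
Proof.
move=> mh; apply: measurable_prod => i _.
by apply: (measurableT_comp (mh i)); exact: measurable_rV_coord.
Qed.

Lemma leb_prod n (h : 'I_n -> R -> R) : (forall i, L1 mu (h i)) ->
  L1 (leb R n) (fun y : 'rV[R]_n => \prod_i h i (y ord0 i)) /\
  \int[leb R n]_y \prod_i h i (y ord0 i) = \prod_i \int[mu]_u h i u.
Proof.
elim: n => [|n IH] in h *.
  move=> _.
  have -> : (fun y : 'rV[R]_0 => \prod_i h i (y ord0 i)) = cst 1.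
    by apply: funext => y; rewrite big_ord0.
  split.
    have -> : EFin \o (cst 1 : 'rV[R]_0 -> R) = cst 1%E by [].
    apply/integrableP; split; first exact: measurable_cst.
    rewrite (eq_integral (cst 1%E)); last by move=> y _; rewrite /= normr1.
    by rewrite integral_cst// mul1e; exact: ltry.
  rewrite Rintegral_cst// big_ord0 mul1r.
  by rewrite -[LHS]/(fine (\1_[set: 'rV[R]_0] 0)%:E) indicT.
move=> Ih.
have [J1 J2] := IH _ (fun j => Ih (lift ord0 j)).
have E : (fun y : 'rV[R]_n.+1 => \prod_i h i (y ord0 i)) \o @rV_cons R n =
    (fun u => h ord0 u.1 * \prod_j h (lift ord0 j) (u.2 ord0 j)).
  apply: funext => u; rewrite /= big_ord_recl rV_cons0; congr (_ * _).
  by apply: eq_bigr => j _; rewrite rV_consS.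
have [] := @leb_cons n (fun y : 'rV[R]_n.+1 => \prod_i h i (y ord0 i)).
- by apply: measurable_prod_coord => i; exact: L1_measurable (Ih i).
- by rewrite E; exact: L1_prod (Ih ord0) J1.
move=> H1 H2; split => //; rewrite H2 big_ord_recl -J2.
rewrite -(Rint_prod (Ih ord0) J1); apply: eq_Rintegral => u _.
by have := congr1 (@^~ u) E.
Qed.

(** A determinant whose column [j] only involves the coordinate [y_j] is a
    signed sum of products of functions of one coordinate. *)
Lemma leb_det n (h : 'I_n -> 'I_n -> R -> R) : (forall i j, L1 mu (h i j)) ->
  L1 (leb R n) (fun y : 'rV[R]_n => \det (\matrix_(i, j) h i j (y ord0 j))) /\
  \int[leb R n]_y \det (\matrix_(i, j) h i j (y ord0 j)) =
  \det (\matrix_(i, j) \int[mu]_u h i j u).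
Proof.
move=> Ih.
have E (k : 'I_n -> 'I_n -> R) : \det (\matrix_(i, j) k i j) =
    \sum_(s : 'S_n) (-1) ^+ s * \prod_j k (s j) j.
  rewrite -det_tr; apply: eq_bigr => s _; congr (_ * _).
  by apply: eq_bigr => j _; rewrite !mxE.
have J s := leb_prod (fun j => Ih ((s : 'S_n) j) j).
have -> : (fun y : 'rV[R]_n => \det (\matrix_(i, j) h i j (y ord0 j))) =
    (fun y => \sum_(s : 'S_n) (-1) ^+ s * \prod_j h (s j) j (y ord0 j)).
  by apply: funext => y; rewrite (E (fun i j => h i j (y ord0 j))).
split.
  by apply: L1_sum => s _; apply: L1Z; case: (J s).
rewrite E Rint_sum; last by move=> s _; apply: L1Z; case: (J s).
by apply: eq_bigr => s _; have [J1 J2] := J s; rewrite RintZ// J2.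
Qed.

Lemma leb_det_row n (h : 'I_n -> 'I_n -> R -> R) : (forall i j, L1 mu (h i j)) ->
  L1 (leb R n) (fun y : 'rV[R]_n => \det (\matrix_(i, j) h i j (y ord0 i))) /\
  \int[leb R n]_y \det (\matrix_(i, j) h i j (y ord0 i)) =
  \det (\matrix_(i, j) \int[mu]_u h i j u).
Proof.
move=> Ih; have [J1 J2] := leb_det (fun i j => Ih j i).
have T y : \det (\matrix_(i, j) h i j (y ord0 i)) =
    \det (\matrix_(i, j) h j i (y ord0 j)).
  by rewrite -det_tr; congr (\det _); apply/matrixP => i j; rewrite !mxE.
split; first by move: J1; under eq_fun do rewrite -T.
under eq_Rintegral do rewrite T.
by rewrite J2 -det_tr; congr (\det _); apply/matrixP => i j; rewrite !mxE.
Qed.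

Lemma leb_coord_null n (i : 'I_n) (c : R) :
  (leb R n).-negligible [set y : 'rV[R]_n | y ord0 i = c].
Proof.
have mS m (j : 'I_m) : measurable [set y : 'rV[R]_m | y ord0 j = c].
  have := @measurable_rV_coord R m j measurableT [set c] (measurable_set1 c).
  by rewrite setTI.
apply/negligibleP => //; elim: n i => [[]//|n IH] i.
rewrite -[LHS]/((mu \x^ leb R n)%E (@rV_cons R n @^-1` [set y | y ord0 i = c])).
case: (unliftP ord0 i) => [j|] ->.
  set S := (X in (_ \x^ _)%E X); have -> : S = setT `*` [set y : 'rV[R]_n | y ord0 j = c].
    by apply/seteqP; split=> u; rewrite /S/= rV_consS => //= -[].
  transitivity (mu setT * leb R n [set y : 'rV[R]_n | y ord0 j = c])%E.
    by apply: product_measure2E => //; exact: mS.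
  have -> : leb R n [set y : 'rV[R]_n | y ord0 j = c] = 0%E by exact: IH.
  by rewrite mule0.
set S := (X in (_ \x^ _)%E X); have -> : S = [set c] `*` setT.
  by apply/seteqP; split=> u; rewrite /S/= rV_cons0 => //= -[].
transitivity (mu [set c] * leb R n setT)%E; first by apply: product_measure2E.
by rewrite lebesgue_measure_set1 mul0e.
Qed.

End leb_theory.

(** * Densities, and topology of row vectors *)

Section density.
Context {d} {T : measurableType d} {R : realType}.

Lemma L1_bounded (m : {measure set T -> \bar R}) (f : T -> R) C :
  (m setT < +oo)%E -> measurable_fun setT f -> (forall x, `|f x| <= C) -> L1 m f.
Proof.
move=> moo mf fC; apply: measurable_bounded_integrable => //.
exists `|C|; split; first exact: num_real.
move=> M CM x _; apply: le_trans (fC x) _; apply: le_trans (ler_norm _) _.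
exact: ltW.
Qed.

(** The density is not assumed nonnegative (determinants have no visible sign),
    so it is compared with the Radon-Nikodym derivative of [m], to which the
    change of variables applies. *)
Lemma density_Rint (m : {measure set T -> \bar R})
    (nu : {sigma_finite_measure set T -> \bar R}) (k f : T -> R) C :
  (m setT < +oo)%E ->
  (forall A, measurable A -> m A = (\int[nu]_(x in A) (k x)%:E)%E) ->
  measurable_fun setT k -> measurable_fun setT f -> (forall x, `|f x| <= C) ->
  L1 nu (fun x => f x * k x) /\ \int[m]_x f x = \int[nu]_x (f x * k x).
Proof.
move=> moo mk km mf fC.
pose m' := mfrestr measurableT moo.
have m'E A : m' A = m A by rewrite /m' /mfrestr /mrestr setIT.
have dom : m' `<< nu.
  move=> A nA B mB BA; rewrite -[LHS]/(m' B) m'E mk//.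
  by apply: null_set_integral => //; [exact/measurable_EFinP/measurable_funTS|exact: nA].
have domc : charge_of_finite_measure m' `<< nu by exact: dom.
have IRN := Radon_Nikodym_integrable domc.
have aek : ae_eq nu setT (Radon_Nikodym (charge_of_finite_measure m') nu) (EFin \o k).
  apply: integral_ae_eq => //; first exact/measurable_EFinP.
  by move=> E _ mE; rewrite -Radon_Nikodym_integral//= -mk// -m'E.
have Im' : L1 m' f.
  by apply: (@L1_bounded _ _ C) => //; rewrite [X in (X < _)%E]m'E.
have mfk : measurable_fun setT (fun x => f x * k x) by exact: measurable_funM.
have aefk : ae_eq nu setT (fun x => ((f x)%:E *
    (Radon_Nikodym (charge_of_finite_measure m') nu) x)%E) (fun x => (f x * k x)%:E).
  by apply: filterS aek => x h _; rewrite h.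
have mRN := measurable_int _ IRN.
have Ik : L1 nu k.
  apply/integrableP; split; first exact/measurable_EFinP.
  have /integrableP[_] := IRN; congr (_ < _)%E; apply: ae_eq_integral => //.
  - exact: measurableT_comp.
  - by apply: measurableT_comp => //; exact/measurable_EFinP.
  - by apply: filterS aek => x h _; rewrite h.
split; first exact: (@L1_boundedM _ _ _ nu C).
rewrite /Rintegral; congr fine.
transitivity (\int[m']_x (f x)%:E)%E.
  by apply: eq_measure_integral => A _ _; exact/esym/m'E.
rewrite -(Radon_Nikodym_change_of_variables dom measurableT Im').
apply: ae_eq_integral => //; last exact/measurable_EFinP.
by apply: emeasurable_funM => //; exact/measurable_EFinP.
Qed.

End density.

Lemma fin_bigcap_measurableT {d} {T : measurableType d} (I : finType) (D : set I)
    (F : I -> set T) : (forall i, D i -> measurable (F i)) ->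
  measurable (\bigcap_(i in D) F i).
Proof.
move=> mF; rewrite -(setCK (\bigcap_(i in D) F i)) setC_bigcap.
apply: measurableC; apply: fin_bigcup_measurable; first exact: finite_finset.
by move=> i Di; apply: measurableC; exact: mF.
Qed.

Section rV_topology.
Context {R : realType} {n : nat}.
Implicit Types (f : 'rV[R]_n -> R) (E : set 'rV[R]_n) (x y : 'rV[R]_n).

Lemma nbhs_rVP x (P : set 'rV[R]_n) : nbhs x P <-> exists2 d : R, 0 < d &
  forall y, (forall j, `|y ord0 j - x ord0 j| < d) -> P y.
Proof.
split.
  move=> /nbhs_ballP[d d0 dP]; exists d => // y yx; apply: dP; split=> // i j.
  by rewrite (ord1 i) /ball/= distrC.
move=> [d d0 dP]; apply/nbhs_ballP; exists d => // y [_ yx]; apply: dP => j.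
by have := yx ord0 j; rewrite /ball/= distrC.
Qed.

Lemma rV_withinP E f : {within E, continuous f} <->
  forall x, E x -> forall e, 0 < e -> exists2 d, 0 < d &
  forall y, E y -> (forall j, `|y ord0 j - x ord0 j| < d) -> `|f y - f x| < e.
Proof.
split.
  move=> /subspace_continuousP fc x Ex e e0.
  have /cvgrPdist_lt/(_ _ e0) := fc x Ex.
  rewrite near_withinE => /nbhs_rVP[d d0 dP]; exists d => // y Ey yx.
  by rewrite distrC; exact: dP.
move=> H; apply/subspace_continuousP => x Ex; apply/cvgrPdist_lt => e e0.
have [d d0 dP] := H x Ex e e0.
rewrite near_withinE; apply/nbhs_rVP; exists d => // y yx Ey.
by rewrite distrC; exact: dP.
Qed.

Lemma rV_continuousP f : continuous f <->
  forall x e, 0 < e -> exists2 d, 0 < d &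
  forall y, (forall j, `|y ord0 j - x ord0 j| < d) -> `|f y - f x| < e.
Proof.
have -> : continuous f <-> {within setT, continuous f}.
  exact: continuous_subspace_setT.
rewrite rV_withinP; split => H x.
  by move=> e e0; have [d d0 dP] := H x I e e0; exists d => // y; exact: dP.
by move=> _ e e0; have [d d0 dP] := H x e e0; exists d => // y _; exact: dP.
Qed.

Lemma rV_cvgP (u_ : nat -> 'rV[R]_n) x :
  (forall j, u_ k ord0 j @[k --> \oo] --> x ord0 j) <-> u_ k @[k --> \oo] --> x.
Proof.
split=> H.
  move=> P /nbhs_rVP[d d0 dP].
  have : \forall k \near \oo, forall j, `|u_ k ord0 j - x ord0 j| < d.
    apply: (@filter_forall _ _ (fun j k => `|u_ k ord0 j - x ord0 j| < d)) => j.
    have /cvgrPdist_lt/(_ _ d0) := H j; apply: filterS => k.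
    by rewrite distrC.
  by apply: filterS => k; exact: dP.
move=> j; apply/cvgrPdist_lt => e e0.
apply: (H [set y | `|x ord0 j - y ord0 j| < e]).
by apply/nbhs_rVP; exists e => // y /(_ j); rewrite distrC.
Qed.

(** Rounding down to the grid of mesh 1 / m; [grid] takes countably many values,
    so functions of [grid m y] are measurable, and continuous functions are their
    limits. This relates the product topology to the product sigma-algebra. *)
Definition grid m y : 'rV[R]_n :=
  \row_j ((Num.floor (m%:R * y ord0 j))%:~R / m%:R).

Lemma grid_dist m y j : (0 < m)%N -> 0 <= y ord0 j - grid m y ord0 j < m%:R^-1.
Proof.
move=> m0; have mR : 0 < m%:R :> R by rewrite ltr0n.
rewrite mxE; have := floor_itv (m%:R * y ord0 j).
move=> /andP[h1 h2].
set F := (Num.floor _)%:~R in h1 h2 *.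
have -> : y ord0 j - F / m%:R = (m%:R * y ord0 j - F) / m%:R.
  by field; rewrite gt_eqF.
rewrite divr_ge0 ?subr_ge0 ?ler0n//= -[ltRHS]mul1r ltr_pM2r ?invr_gt0//.
by rewrite intrD1 in h2; rewrite ltrBlDl.
Qed.

Lemma grid_cvg y : grid k.+1 y @[k --> \oo] --> y.
Proof.
apply/rV_cvgP => j; apply/cvgrPdist_lt => e e0.
have : \forall k \near \oo, k.+1%:R^-1 < e by exact: near_infty_natSinv_lt (PosNum e0).
apply: filterS => k ke; have /andP[h1 h2] := @grid_dist k.+1 y j isT.
by rewrite ger0_norm// (lt_trans h2).
Qed.

Lemma measurable_grid_comp m (f : 'rV[R]_n -> R) :
  measurable_fun setT (fun y => f (grid m y)).
Proof.
pose F (z : {ffun 'I_n -> int}) : R := f (\row_j ((z j)%:~R / m%:R)).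
pose Z y : {ffun 'I_n -> int} := [ffun j => Num.floor (m%:R * y ord0 j)].
have FZ y : f (grid m y) = F (Z y).
  by congr f; apply/rowP => j; rewrite !mxE ffunE.
move=> _ B mB; rewrite setTI.
have -> : (fun y => f (grid m y)) @^-1` B =
    \bigcup_(z in [set z | B (F z)]) \bigcap_(j in [set: 'I_n])
      [set y : 'rV[R]_n | Num.floor (m%:R * y ord0 j) = z j].
  apply/seteqP; split => y.
    rewrite /= FZ => BF; exists (Z y) => //= j _; by rewrite /= ffunE.
  move=> [z /= Bz zy]; rewrite FZ; suff -> : Z y = z by [].
  by apply/ffunP => j; rewrite ffunE; exact: zy.
rewrite bigcup_mkcond; apply: countable_bigcupT_measurable => [|z]; first exact: countableP.
case: ifP => // _; apply: fin_bigcap_measurableT => j _.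
have mh : measurable_fun setT (fun y : 'rV[R]_n => m%:R * y ord0 j).
  by apply: measurable_funM => //; exact: measurable_rV_coord.
have := mh measurableT `[(z j)%:~R, (z j + 1)%:~R[%classic (measurable_itv _).
rewrite setTI; congr measurable; apply/seteqP; split => y /=; rewrite in_itv/=.
  by move=> h; apply: floor_def.
move=> <-; exact: floor_itv.
Qed.

Lemma continuous_rV_measurable f : continuous f -> measurable_fun setT f.
Proof.
move=> fc; apply: (@measurable_fun_cvg _ _ _ setT (fun k y => f (grid k.+1 y))).
  by move=> k; exact: measurable_grid_comp.
by move=> y _; apply: continuous_cvg; [exact: fc|exact: grid_cvg].
Qed.

End rV_topology.

(** * Determinants, Weyl chambers and Vandermonde products *)

Lemma prod_ind {R : realType} (I : finType) (b : I -> bool) :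
  \prod_i ind (b i) = ind [forall i, b i] :> R.
Proof.
rewrite /ind; case: forallP => [h|/forallP].
  by rewrite big1// => i _; rewrite h.
by move=> /forallPn[i /negPf bi]; rewrite (bigD1 i)//= bi mul0r.
Qed.

Section determinants.
Context {R : realType}.

Lemma det_mul_cols n (A : 'I_n -> 'I_n -> R) (c : 'I_n -> R) :
  \det (\matrix_(i, j) (A i j * c j)) = \det (\matrix_(i, j) A i j) * \prod_j c j.
Proof.
rewrite /determinant mulr_suml; apply: eq_bigr => s _.
rewrite -mulrA; congr (_ * _).
under eq_bigr do rewrite mxE; under [in RHS]eq_bigr do rewrite mxE.
by rewrite big_split/=; congr (_ * _); rewrite [RHS](reindex_perm s).
Qed.

Lemma det_eq_rows n (A : 'I_n -> 'I_n -> R) i1 i2 : i1 != i2 ->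
  (forall j, A i1 j = A i2 j) -> \det (\matrix_(i, j) A i j) = 0.
Proof.
by move=> i12 e; apply: (determinant_alternate i12) => j; rewrite !mxE.
Qed.

(** The matrix on the left is B U with B = [1 | a] and U unipotent (differences
    of consecutive columns). Replacing U by the unipotent L on the left
    (differences of consecutive rows) does not change the determinant, and the
    first column of L B is (1, 0, ..., 0). The determinant on the left comes from
    integrating over particles interlacing with [y], the one on the right from
    integrating over particles interlacing with [x]. *)
Lemma det_interlace n (a : 'I_n.+1 -> 'I_n -> R) :
  \det (\matrix_(i < n.+1, l < n.+1)
     ((if unlift ord0 l is Some j then a i j else 1) -
      (if unlift ord_max l is Some j then a i j else 0))) =
  \det (\matrix_(i < n, j < n) (a (lift ord0 i) j - a (widen_ord (leqnSn n) i) j)).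
Proof.
pose B := \matrix_(i < n.+1, l < n.+1)
  (if unlift ord0 l is Some j then a i j else 1).
pose U : 'M[R]_n.+1 := \matrix_(k, l) ((k == l)%:R - (k == l.+1 :> nat)%:R).
have dU : \det U = 1.
  rewrite det_trig; last first.
    apply/is_trig_mxP => i j ij; rewrite mxE.
    rewrite (_ : (i == j) = false); last by rewrite -val_eqE/= ltn_eqF.
    by rewrite (_ : (i == j.+1 :> nat) = false) ?subrr// ltn_eqF// ltnW.
  by apply: big1 => i _; rewrite mxE eqxx (_ : (i == i.+1 :> nat) = false) ?subr0// ltn_eqF.
pose L : 'M[R]_n.+1 := \matrix_(i, k) ((i == k)%:R - (i == k.+1 :> nat)%:R).
have dL : \det L = 1 by exact: dU.
have BU : B *m U = \matrix_(i < n.+1, l < n.+1)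
     ((if unlift ord0 l is Some j then a i j else 1) -
      (if unlift ord_max l is Some j then a i j else 0)).
  apply/matrixP => i l; rewrite !mxE.
  under eq_bigr do rewrite mxE mxE mulrBr.
  rewrite big_split/= sumrN; congr (_ - _).
    rewrite (bigD1 l)//= eqxx mulr1 big1 ?addr0// => k /negPf kl.
    by rewrite kl mulr0.
  case: (unliftP ord_max l) => [j lj|->]; last first.
    apply: big1 => k _; rewrite (_ : (k == _ :> nat) = false) ?mulr0//.
    by rewrite ltn_eqF//=.
  have lE : l = j :> nat by rewrite lj lift_max.
  rewrite (bigD1 (lift ord0 j))//= lE /bump leq0n add1n eqxx mulr1 liftK.
  rewrite big1 ?addr0// => k kj; rewrite (_ : (k == j.+1 :> nat) = false) ?mulr0//.
  by apply: contra_neqF kj => /eqP kj; apply/val_inj; rewrite /= kj.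
rewrite -BU det_mulmx dU mulr1 -[LHS]mul1r -dL -det_mulmx.
have LB0 i : (L *m B) i ord0 = (i == ord0)%:R.
  rewrite mxE; under eq_bigr do rewrite !mxE unlift_none mulr1.
  rewrite big_split/= sumrN; rewrite (bigD1 i)//= eqxx big1; last first.
    by move=> k /negPf; rewrite eq_sym => ->.
  case: (unliftP ord0 i) => [j|] ->.
    rewrite (bigD1 (widen_ord (leqnSn n) j))//= /bump leq0n add1n eqxx.
    rewrite big1 ?addr0 ?subrr//.
    move=> k kj; rewrite eqSS (_ : (_ == _) = false)//.
    by apply: contra_neqF kj => /eqP kj; apply/val_inj; rewrite /= kj.
  by rewrite eqxx big1 ?addr0 ?subr0.
have LBS i j : (L *m B) (lift ord0 i) (lift ord0 j) =
    a (lift ord0 i) j - a (widen_ord (leqnSn n) i) j.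
  rewrite mxE; under eq_bigr do rewrite !mxE liftK mulrBl.
  rewrite big_split/= sumrN; congr (_ - _).
    rewrite (bigD1 (lift ord0 i))//= eqxx mul1r big1 ?addr0// => k /negPf.
    by rewrite eq_sym => ->; rewrite mul0r.
  rewrite (bigD1 (widen_ord (leqnSn n) i))//= /bump leq0n add1n eqxx mul1r.
  rewrite big1 ?addr0// => k kj; rewrite eqSS (_ : (_ == _) = false) ?mul0r//.
  by apply: contra_neqF kj => /eqP kj; apply/val_inj; rewrite /= kj.
rewrite (expand_det_col _ ord0) (bigD1 ord0)//= LB0 eqxx mul1r big1 ?addr0; last first.
  by move=> k /negPf k0; rewrite LB0 k0 mul0r.
rewrite /cofactor/= addn0 expr0 mul1r; congr (\det _).
by apply/matrixP => i j; rewrite 2!mxE [RHS]mxE LBS.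
Qed.

End determinants.

Section weyl.
Context {R : realType} {n : nat}.
Implicit Types (x y : 'rV[R]_n) (f : 'rV[R]_n -> R).

Lemma measurable_coord_le (i j : 'I_n) :
  measurable [set y : 'rV[R]_n | y ord0 i <= y ord0 j].
Proof.
have mb : measurable_fun setT (fun y : 'rV[R]_n => y ord0 i <= y ord0 j).
  by apply: measurable_fun_ler; exact: measurable_rV_coord.
by have := mb measurableT [set true] I; rewrite setTI.
Qed.

Lemma measurable_coord_itv (i : 'I_n) (b : interval R) :
  measurable [set y : 'rV[R]_n | y ord0 i \in b].
Proof.
have := @measurable_rV_coord R n i measurableT [set` b] (measurable_itv b).
by rewrite setTI.
Qed.

Lemma measurable_weyl : measurable (@weyl R n).
Proof.
have -> : @weyl R n = \bigcap_(i in [set: 'I_n])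
    \bigcap_(j in [set j : 'I_n | (i <= j)%N]) [set y | y ord0 i <= y ord0 j].
  by apply/seteqP; split => y H i; [move=> _ j ij; exact: H|move=> j ij; exact: H].
apply: fin_bigcap_measurableT => i _; apply: fin_bigcap_measurableT => j _.
exact: measurable_coord_le.
Qed.

Lemma measurable_weyl_ge : measurable (@weyl_ge R n).
Proof.
have -> : @weyl_ge R n = @weyl R n `&`
    \bigcap_(i in [set: 'I_n]) [set y | y ord0 i \in `[0, +oo[].
  apply/seteqP; split => y [wy H]; split => // i.
    by move=> _ /=; rewrite in_itv/= H.
  by have := H i I; rewrite /= in_itv/= andbT.
apply: measurableI; first exact: measurable_weyl.
by apply: fin_bigcap_measurableT => i _; exact: measurable_coord_itv.
Qed.

(** A continuous retraction of R^n onto the chamber: it turns functions that are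
    continuous on the chamber into functions continuous on the whole space. The
    maximum starts from 0, which makes the coordinates nonnegative. *)
Definition run_max y : 'rV[R]_n :=
  \row_i \big[Num.max/0]_(j < n | (j <= i)%N) y ord0 j.

Lemma run_max_weyl_ge y : weyl_ge (run_max y).
Proof.
split=> [i j ij|i]; rewrite !mxE; last exact: bigmax_ge_id.
apply: bigmax_le; first exact: bigmax_ge_id.
by move=> k ki; apply: (le_bigmax_cond 0 (fun k => y ord0 k)); exact: leq_trans ij.
Qed.

Lemma run_max_id y : weyl_ge y -> run_max y = y.
Proof.
move=> [wy y0]; apply/rowP => i; rewrite mxE; apply/eqP; rewrite eq_le.
rewrite bigmax_le//=; last by move=> j; exact: wy.
exact: (le_bigmax_cond 0 (fun k => y ord0 k)).
Qed.

Lemma run_max_lip x y (d : R) : 0 <= d ->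
  (forall j, `|y ord0 j - x ord0 j| <= d) ->
  forall j, `|run_max y ord0 j - run_max x ord0 j| <= d.
Proof.
move=> d0.
have main (u v : 'rV[R]_n) : (forall j, `|u ord0 j - v ord0 j| <= d) ->
    forall j, run_max u ord0 j <= run_max v ord0 j + d.
  move=> uv j; rewrite !mxE; apply: bigmax_le => [|k kj].
    by rewrite addr_ge0// bigmax_ge_id.
  have : v ord0 k <= \big[Num.max/0]_(k < n | (k <= j)%N) v ord0 k.
    exact: (le_bigmax_cond 0 (fun k => v ord0 k)).
  by have := uv k; rewrite ler_norml; lra.
move=> yx j; have h1 := main y x yx j.
have h2 : run_max x ord0 j <= run_max y ord0 j + d.
  by apply: main => k; rewrite distrC.
by rewrite ler_norml; lra.
Qed.

Lemma run_max_continuous f : {within @weyl_ge R n, continuous f} ->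
  continuous (f \o run_max).
Proof.
move=> /rV_withinP fc; apply/rV_continuousP => x e e0.
have [d d0 dP] := fc _ (run_max_weyl_ge x) e e0.
have d2 : 0 < d / 2 by rewrite divr_gt0.
exists (d / 2) => // y yx; apply: dP; first exact: run_max_weyl_ge.
move=> j; apply: (@le_lt_trans _ _ (d / 2)); last by lra.
by apply: run_max_lip => [|k]; apply: ltW.
Qed.

Definition wcut f y : R := (f \_ (@weyl_ge R n)) y.

Lemma wcutE f y : weyl_ge y -> wcut f y = f y.
Proof. by move=> wy; rewrite /wcut patchE mem_set. Qed.

Lemma wcut0 f y : ~ weyl_ge y -> wcut f y = 0.
Proof. by move=> wy; rewrite /wcut patchE memNset. Qed.

Lemma eq_wcut f g : (forall y, weyl_ge y -> f y = g y) -> wcut f = wcut g.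
Proof.
move=> fg; apply: funext => y; have [wy|wy] := pselect (weyl_ge y).
  by rewrite !wcutE// fg.
by rewrite !wcut0.
Qed.

Lemma measurable_wcut f : measurable_fun setT f -> measurable_fun setT (wcut f).
Proof.
move=> mf; apply/(measurable_restrictT _ measurable_weyl_ge).
exact: measurable_funTS.
Qed.

Lemma measurable_wcut_continuous f : {within @weyl_ge R n, continuous f} ->
  measurable_fun setT (wcut f).
Proof.
move=> fc; rewrite (@eq_wcut f (f \o run_max)).
  apply: measurable_wcut; apply: continuous_rV_measurable.
  exact: run_max_continuous fc.
by move=> y wy /=; rewrite run_max_id.
Qed.

Lemma wcut_norm f C : 0 <= C -> (forall y, weyl_ge y -> `|f y| <= C) ->
  forall y, `|wcut f y| <= C.
Proof.
move=> C0 fC y; have [wy|wy] := pselect (weyl_ge y); first by rewrite wcutE// fC.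
by rewrite wcut0// normr0.
Qed.

Lemma C_infty_bounded f : C_infty (@weyl_ge R n) f ->
  exists2 C, 0 <= C & forall y, weyl_ge y -> `|f y| <= C.
Proof.
move=> [fc f0]; have [K [cK KE Kf]] := f0 1 ltr01.
have cfK : compact (f @` K).
  by apply: continuous_compact => //; exact: continuous_subspaceW fc.
have [M [_ MP]] := compact_bounded cfK.
exists (`|M| + 1) => [|y wy]; first by rewrite addr_ge0.
have [Ky|Ky] := pselect (K y).
  apply: (MP (`|M| + 1)); first by rewrite (le_lt_trans (ler_norm _))// ltrDl.
  by exists y.
by rewrite (le_trans (ltW (Kf y wy Ky)))// lerDr.
Qed.

Lemma vandermonde_gt0 y : weyl_strict y -> 0 < vandermonde y.
Proof.
move=> wy; apply: prodr_gt0 => i _; apply: prodr_gt0 => j ij.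
by rewrite subr_gt0 wy.
Qed.

Lemma not_weyl_strictP y : weyl y -> ~ weyl_strict y ->
  exists i j : 'I_n, (i < j)%N /\ y ord0 i = y ord0 j.
Proof.
move=> wy ns; apply: contrapT => H; apply: ns => i j ij.
rewrite lt_neqAle wy 1?ltnW// andbT; apply/eqP => yij; apply: H.
by exists i, j.
Qed.

Lemma vandermonde_eq0 y : weyl y -> ~ weyl_strict y -> vandermonde y = 0.
Proof.
move=> wy /(not_weyl_strictP wy)[i [j [ij yij]]].
by rewrite /vandermonde (bigD1 i)//= (bigD1 j)//= yij subrr !mul0r.
Qed.

Lemma vandermonde_cvg (u_ : nat -> 'rV[R]_n) x :
  u_ k @[k --> \oo] --> x -> vandermonde (u_ k) @[k --> \oo] --> vandermonde x.
Proof.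
move=> /rV_cvgP ux; apply: cvg_big => // [|i _].
  by move=> z; apply: mul_continuous.
apply: cvg_big => // [|j _]; first by move=> z; apply: mul_continuous.
by apply: cvgB; exact: ux.
Qed.

Lemma measurable_vandermonde : measurable_fun setT (@vandermonde R n).
Proof.
apply: measurable_prod => i _; under eq_fun do rewrite big_mkcond.
apply: measurable_prod => j _; case: (i < j)%N => //.
by apply: measurable_funB; exact: measurable_rV_coord.
Qed.

End weyl.

Section kernels.
Context {d d'} {X : measurableType d} {Y : measurableType d'} {R : realType}.
Variable K : R.-pker X ~> Y.

Lemma pker_L1 (f : Y -> R) C x : measurable_fun setT f ->
  (forall y, `|f y| <= C) -> L1 (K x) f.
Proof. by move=> mf fC; apply: (L1_bounded _ mf fC); rewrite prob_kernel ltry. Qed.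

Lemma pker_norm (f : Y -> R) C x : measurable_fun setT f ->
  (forall y, `|f y| <= C) -> `|\int[K x]_y f y| <= C.
Proof.
move=> mf fC; have Ic : L1 (K x) (cst C : Y -> R).
  by apply: (@pker_L1 _ `|C|).
apply: le_trans (Rint_norm_le (pker_L1 x mf fC) Ic fC) _.
by rewrite Rintegral_cst// prob_kernel mulr1.
Qed.

Lemma measurable_pker_Rint (f : Y -> R) C : measurable_fun setT f ->
  (forall y, `|f y| <= C) -> measurable_fun setT (fun x => \int[K x]_y f y).
Proof.
move=> mf fC.
have E x : \int[K x]_y f y = \int[K x]_y (f y + C) - C.
  have Ic : L1 (K x) (cst C : Y -> R) by apply: (@pker_L1 _ `|C|).
  rewrite RintegralD//; last exact: pker_L1 fC.
  by rewrite Rintegral_cst// prob_kernel mulr1 addrK.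
under eq_fun do rewrite E.
apply: measurable_funB => //.
rewrite /Rintegral; apply: (@measurableT_comp _ _ _ _ _ _ fine) => //.
apply: (@measurable_fun_integral_kernel _ _ _ _ _ (fun x => K x)).
- by move=> U mU; exact: measurable_kernel.
- move=> y; rewrite lee_fin; have := fC y; rewrite ler_norml; lra.
- by apply/measurable_EFinP; apply: measurable_funD.
Qed.

End kernels.

(** * The kernels in terms of their densities *)

Section laguerre_N.
Context {R : realType} {n : nat} (alpha : R) (p : R -> R -> R -> R)
  (T : R -> R.-pker 'rV[R]_n ~> 'rV[R]_n).
Hypotheses (pd : laguerre_density alpha p) (Ts : laguerre_semigroup p T).
Variables (t : R) (t0 : 0 < t).

Definition karlin_mcgregor (w y : 'rV[R]_n) : R :=
  \det (\matrix_(i < n, j < n) ext p t (w ord0 i) (y ord0 j)).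

Lemma laguerre_density_NE (w y : 'rV[R]_n) : weyl_ge y ->
  laguerre_density_N p t w y =
  expR (n%:R * (n%:R - 1) / 2 * t) * (vandermonde y / vandermonde w) *
  karlin_mcgregor w y.
Proof.
move=> [_ y0]; rewrite /laguerre_density_N /= opprK; congr (_ * _).
congr (\det _); apply/matrixP => i j; rewrite !mxE /ext /ind y0 mul1r.
by [].
Qed.

Lemma measurable_karlin_mcgregor w : weyl_ge_interior w ->
  measurable_fun setT (karlin_mcgregor w).
Proof.
move=> [_ w0]; have [] := @leb_det R n (fun i _ => ext p t (w ord0 i)).
  by move=> i j; have [] := laguerre_pdf pd t0 (ltW (w0 i)).
by move=> /L1_measurable.
Qed.

Lemma laguerre_semigroup_Rint (w : 'rV[R]_n) (f : 'rV[R]_n -> R) (C : R) : weyl_ge_interior w ->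
  measurable_fun setT f -> (forall y, `|f y| <= C) ->
  \int[T t w]_y f y = expR (n%:R * (n%:R - 1) / 2 * t) / vandermonde w *
    \int[leb R n]_y wcut (fun y => f y * vandermonde y * karlin_mcgregor w y) y.
Proof.
move=> wi mf fC; have [_ _ dens] := Ts.
pose c := expR (n%:R * (n%:R - 1) / 2 * t) / vandermonde w.
pose k y := wcut (fun y => c * (vandermonde y * karlin_mcgregor w y)) y.
have mvk : measurable_fun setT (fun y => vandermonde y * karlin_mcgregor w y).
  apply: measurable_funM; first exact: measurable_vandermonde.
  exact: measurable_karlin_mcgregor.
have mk : measurable_fun setT k.
  by apply: measurable_wcut; apply: measurable_funM.
have kE : (laguerre_density_N p t w) \_ (@weyl_ge R n) = k.
  apply: (@eq_wcut R n) => y wy; rewrite laguerre_density_NE// /c; ring.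
have [] := @density_Rint _ _ _ (T t w) (leb R n) k f C _ _ mk mf fC.
- by rewrite prob_kernel ltry.
- move=> A mA; rewrite dens// integral_mkcondr; apply: eq_integral => y _.
  by rewrite -kE !patchE; case: ifP.
move=> J1 ->.
have [v0|v0] := eqVneq (vandermonde w) 0.
  by move: wi => [/vandermonde_gt0]; rewrite v0 ltxx.
have c0 : c != 0 by rewrite /c mulf_neq0 ?invr_eq0// gt_eqF ?expR_gt0.
have E : (fun y => wcut (fun y => f y * vandermonde y * karlin_mcgregor w y) y) =
   (fun y => c^-1 * (f y * k y)).
  apply: funext => y; rewrite /k; have [wy|wy] := pselect (weyl_ge y).
    by rewrite !wcutE//; field.
  by rewrite !wcut0// !mulr0.
by rewrite -/c E RintZ// mulrA mulfV// mul1r.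
Qed.

End laguerre_N.

Section interlacing.
Context {R : realType} {n : nat} (Lambda : R.-pker 'rV[R]_n.+1 ~> 'rV[R]_n).
Hypothesis Lk : interlacing_kernel Lambda.
Implicit Types (x : 'rV[R]_n.+1) (y : 'rV[R]_n).

Definition interlaceb x y : bool := [forall i : 'I_n,
  x ord0 (widen_ord (leqnSn n) i) <= y ord0 i <= x ord0 (lift ord0 i)].

(** For [x] in the chamber the interlacing inequalities force [y] to be
    ordered. The boolean form is a product of conditions on single
    coordinates. *)
Lemma interlaceP x y : weyl x -> interlace x y <-> interlaceb x y.
Proof.
move=> wx; split => [[_ H]|/forallP H]; first exact/forallP.
split => // i j; rewrite leq_eqVlt => /predU1P[ij|ij].
  by rewrite (val_inj ij).
have /andP[_ h1] := H i; have /andP[h2 _] := H j.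
apply: le_trans h1 (le_trans _ h2); apply: wx => /=.
by rewrite /bump leq0n add1n.
Qed.

Lemma ind_interlaceb x y : ind (interlaceb x y) =
  \prod_(i < n) ind (x ord0 (widen_ord (leqnSn n) i) <= y ord0 i <= x ord0 (lift ord0 i))
  :> R.
Proof. by rewrite prod_ind. Qed.

Lemma measurable_interlaceb x :
  measurable_fun setT (fun y => ind (interlaceb x y) : R).
Proof.
under eq_fun do rewrite ind_interlaceb.
apply: (@measurable_prod_coord _ _ (fun i u => ind (_ <= u <= _))) => i.
apply: measurable_ind; apply: measurable_and; exact: measurable_fun_ler.
Qed.

Lemma interlacing_Rint x (f : 'rV[R]_n -> R) (C : R) : weyl_strict x ->
  measurable_fun setT f -> (forall y, `|f y| <= C) ->
  L1 (leb R n) (fun y => ind (interlaceb x y) * (f y * vandermonde y)) /\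
  \int[Lambda x]_y f y = n`!%:R / vandermonde x *
    \int[leb R n]_y (ind (interlaceb x y) * (f y * vandermonde y)).
Proof.
move=> sx mf fC; have [dens _] := Lk.
have wx : weyl x.
  move=> i j; rewrite leq_eqVlt => /predU1P[ij|ij]; last exact/ltW/sx.
  by rewrite (val_inj ij).
pose c : R := n`!%:R / vandermonde x.
pose k y := ind (interlaceb x y) * (c * vandermonde y).
have mk : measurable_fun setT k.
  apply: measurable_funM; first exact: measurable_interlaceb.
  by apply: measurable_funM => //; exact: measurable_vandermonde.
have [] := @density_Rint _ _ _ (Lambda x) (leb R n) k f C _ _ mk mf fC.
- by rewrite prob_kernel ltry.
- move=> A mA; rewrite dens// integral_mkcondr; apply: eq_integral => y _.
  rewrite patchE /k.
  have -> : (y \in interlace x) = interlaceb x y.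
    by apply/idP/idP => [|h]; rewrite inE; [move=> h|]; exact/(interlaceP _ wx).
  by rewrite /ind; case: ifP => _; rewrite ?mul0r// mul1r /c; congr EFin; ring.
move=> J1 ->.
have c0 : c != 0.
  by rewrite mulf_neq0// invr_eq0 gt_eqF// vandermonde_gt0.
have E y : ind (interlaceb x y) * (f y * vandermonde y) = c^-1 * (f y * k y).
  by rewrite /k; field.
split; first by under eq_fun do rewrite E; exact: L1Z.
by under [in RHS]eq_Rintegral do rewrite E; rewrite RintZ// mulrA mulfV// mul1r.
Qed.

End interlacing.

(** * The intertwining on box functions *)

Lemma kernel_opE {R : realType} (m n : nat) (K : R.-pker 'rV[R]_m ~> 'rV[R]_n) f x :
  kernel_op K (@weyl_ge R n) f x = \int[K x]_y wcut f y.
Proof. by rewrite /kernel_op Rintegral_mkcond. Qed.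

Lemma Rint_ae_eq {d} {T : measurableType d} {R : realType}
    (m : {measure set T -> \bar R}) (f g : T -> R) :
  measurable_fun setT f -> measurable_fun setT g ->
  {ae m, forall x, f x = g x} -> \int[m]_x f x = \int[m]_x g x.
Proof.
move=> mf mg fg; rewrite /Rintegral; congr fine; apply: ae_eq_integral => //.
- exact/measurable_EFinP.
- exact/measurable_EFinP.
- by apply: aeS fg => x /= -> _.
Qed.

Lemma tail_itv {R : realType} (k : R -> R) (c d : R) : is_pdf k -> c <= d ->
  \int[@lebesgue_measure R]_u (k u * ind (c <= u <= d)) = tail k c - tail k d.
Proof.
move=> pk cd; have [_ Ik _ _] := pk; have mk := L1_measurable Ik.
have J e : L1 (@lebesgue_measure R) (fun u => k u * ind (e <= u)).
  apply: (pdf_L1 pk (C := 1)); first exact: measurable_ler_l.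
  by move=> u; exact: ind_norm.
rewrite /tail -RintegralB//; apply: Rint_ae_eq.
- apply: measurable_funM => //; apply: measurable_ind.
  by apply: measurable_and; exact: measurable_fun_ler.
- by apply: measurable_funB; apply: measurable_funM => //; exact: measurable_ler_l.
- exists [set d]; split => //; first exact: lebesgue_measure_set1.
  move=> u /= H; apply: contrapT => ud; apply: H; rewrite -mulrBr; congr (_ * _).
  have {}ud : u != d by exact/eqP.
  rewrite /ind; case: (leP d u) => du; first by
    rewrite (le_trans cd du) (_ : (u <= d) = false) ?andbF ?subrr//;
    apply/negbTE; rewrite -ltNge lt_neqAle eq_sym ud.
  by rewrite (ltW du) andbT subr0.
Qed.

Section box.
Context {R : realType} {N : nat} (alpha : R) (p q : R -> R -> R -> R)
  (T : R -> R.-pker 'rV[R]_N.+1 ~> 'rV[R]_N.+1)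
  (T' : R -> R.-pker 'rV[R]_N ~> 'rV[R]_N)
  (Lambda : R.-pker 'rV[R]_N.+1 ~> 'rV[R]_N).
Hypotheses (al : -1 < alpha) (pd : laguerre_density alpha p)
  (qd : laguerre_density (alpha + 1) q) (Ts : laguerre_semigroup p T)
  (Ts' : laguerre_semigroup q T') (Lk : interlacing_kernel Lambda).
Variables (t : R) (t0 : 0 < t) (x : 'rV[R]_N.+1) (xi : weyl_ge_interior x).
Variables (a b : 'I_N -> R).
Hypotheses (a0 : forall j, 0 <= a j) (ab : forall j, a j <= b j)
  (sep : forall i j : 'I_N, (i < j)%N -> b i < a j).
Local Notation mu := (@lebesgue_measure R).

(** The test functions are products over separated, ordered intervals [a_j, b_j),
    divided by the Vandermonde product. The division cancels the factor
    [vandermonde] that both kernels put in front of their determinant, so that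
    only products of functions of one coordinate are left to integrate; the
    separation of the intervals keeps it bounded. *)
Definition box_fun (j : 'I_N) (u : R) : R := ind (a j <= u < b j) * half_exp 1 u.
Definition box_prod (y : 'rV[R]_N) : R := \prod_j box_fun j (y ord0 j).
Definition box_test (y : 'rV[R]_N) : R := box_prod y / vandermonde y.

Let g := box_fun.
Let gap : R := \prod_(i < N) \prod_(j < N | (i < j)%N) (a j - b i).
Let xl (i : 'I_N) := x ord0 (widen_ord (leqnSn N) i).
Let xr (i : 'I_N) := x ord0 (lift ord0 i).
Let td (i : 'I_N) := tail_diff p t (xl i) (xr i).
Let core : R := \det (\matrix_(i < N, j < N) \int[mu]_u (g j u * td i u)).

Let x0 i : 0 < x ord0 i. Proof. by case: xi. Qed.
Let xl0 i : 0 <= xl i. Proof. exact/ltW/x0. Qed.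
Let xlr i : xl i <= xr i.
Proof. by case: xi => sx _; apply/ltW/sx => /=; rewrite /bump leq0n add1n. Qed.

Let gi i j : intertwined p q t (xl i) (xr i) (g j).
Proof. exact: (intertwined_itv al pd qd t0 (xl0 i) (xlr i) (ab j)). Qed.

Let mg j : measurable_fun setT (g j).
Proof.
apply: measurable_funM; last exact: measurable_half_exp.
apply: measurable_ind; apply: measurable_and.
  exact: measurable_fun_ler.
exact: measurable_fun_ltr.
Qed.

Let g_le j u : `|g j u| <= 1 * half_exp 1 u.
Proof.
rewrite mul1r normrM (ger0_norm (half_exp_ge0 _ _)) ler_piMl ?half_exp_ge0//.
exact: ind_norm.
Qed.

Let g_le1 j u : `|g j u| <= 1.
Proof. by have := half_exp_bounded (g_le j) u; rewrite normr1. Qed.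

Let Ig j : L1 mu (g j). Proof. exact: half_exp_L1 (mg j) (g_le j). Qed.

Lemma box_prod_neq0 y : box_prod y != 0 -> weyl_strict y /\ (forall j, a j <= y ord0 j < b j).
Proof.
move=> /prodf_neq0 H.
have yab j : a j <= y ord0 j < b j.
  have := H j isT; rewrite /box_fun /ind; case: ifP => //.
  by rewrite mul0r eqxx.
split => // i j ij; have /andP[_ h1] := yab i; have /andP[h2 _] := yab j.
exact: lt_le_trans (lt_trans h1 (sep ij)) h2.
Qed.

Let box_prod_weyl y : box_prod y != 0 -> weyl_ge y.
Proof.
move=> /box_prod_neq0[sy yab]; split => [i j|j].
  by rewrite leq_eqVlt => /predU1P[/val_inj ->//|ij]; exact/ltW/sy.
by have /andP[h _] := yab j; exact: le_trans h.
Qed.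

Let gap_gt0 : 0 < gap.
Proof.
by apply: prodr_gt0 => i _; apply: prodr_gt0 => j ij; rewrite subr_gt0 sep.
Qed.

Lemma box_testM y : box_test y * vandermonde y = box_prod y.
Proof.
have [e|/box_prod_neq0[sy _]] := eqVneq (box_prod y) 0.
  by rewrite /box_test e !mul0r.
by rewrite /box_test divfK// gt_eqF// vandermonde_gt0.
Qed.

Let box_prod_le1 y : `|box_prod y| <= 1.
Proof.
rewrite normr_prod; apply: prodr_ile1 => // j _.
by rewrite normr_ge0 g_le1.
Qed.

Let gap_le y : box_prod y != 0 -> gap <= vandermonde y.
Proof.
move=> /box_prod_neq0[_ yab].
apply: ler_prod => i _; rewrite prodr_ge0 => [|j ij]; last by rewrite subr_ge0 ltW// sep.
apply: ler_prod => j ij; rewrite subr_ge0 ltW ?sep//=.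
have /andP[_ h1] := yab i; have /andP[h2 _] := yab j.
by rewrite lerB// ltW.
Qed.

Lemma box_test_norm y : `|box_test y| <= gap^-1.
Proof.
have [e|n0] := eqVneq (box_prod y) 0.
  by rewrite /box_test e mul0r normr0 invr_ge0 ltW.
have [sy yab] := box_prod_neq0 n0; have v0 := vandermonde_gt0 sy.
rewrite normrM -[leRHS]mul1r ler_pM//.
by rewrite gtr0_norm ?invr_gt0// lef_pV2 ?posrE// gap_le.
Qed.

Let m_box_prod : measurable_fun setT box_prod.
Proof. exact: (measurable_prod_coord (h := g)). Qed.

Lemma measurable_box_test : measurable_fun setT box_test.
Proof.
have -> : box_test = (fun y => box_prod y * (Num.max (vandermonde y) gap)^-1).
  apply: funext => y; rewrite /box_test.
  have [->|n0] := eqVneq (box_prod y) 0; first by rewrite !mul0r.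
  by rewrite (max_idPl (gap_le n0)).
apply: measurable_funM => //.
apply: (@measurableT_comp _ _ _ _ _ _ (fun z : R => (Num.max z gap)^-1));
  last exact: measurable_vandermonde.
apply: continuous_measurable_fun => z; apply: cvgV.
  by rewrite gt_eqF// lt_max gap_gt0 orbT.
by apply: continuous_max; [exact: cvg_id|exact: cvg_cst].
Qed.

Let wcut_box : wcut box_test = box_test.
Proof.
apply: funext => y; have [wy|wy] := pselect (weyl_ge y); first by rewrite wcutE.
rewrite wcut0// /box_test; have [->|/box_prod_weyl//] := eqVneq (box_prod y) 0.
by rewrite mul0r.
Qed.

(** Integrating the Karlin-McGregor determinant of [q] against the box in [y]
    gives det [Q g_j(w_i)], and integrating each row [i] over the interval
    [x_i, x_{i+1}] gives, by the one-dimensional intertwining, e^t times the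
    integral of [g_j] against the difference of tails. *)
Lemma box_rhs :
  kernel_op Lambda (@weyl_ge R N) (kernel_op (T' t) (@weyl_ge R N) box_test) x =
  N`!%:R / vandermonde x * (expR (N%:R * (N%:R - 1) / 2 * t) * (expR t ^+ N * core)).
Proof.
set E' := expR (_ / 2 * t).
pose F w := \int[T' t w]_y box_test y.
have FE : kernel_op (T' t) (@weyl_ge R N) box_test = F.
  by apply: funext => w; rewrite kernel_opE wcut_box.
have mF : measurable_fun setT F.
  exact: measurable_pker_Rint measurable_box_test box_test_norm.
have FC w : `|F w| <= gap^-1 by exact: pker_norm measurable_box_test box_test_norm.
rewrite FE kernel_opE.
have sx : weyl_strict x by case: xi.
have mcF := measurable_wcut mF.
have cFC : forall w, `|wcut F w| <= gap^-1.
  by apply: wcut_norm => //; rewrite invr_ge0 ltW.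
have [_ ->] := interlacing_Rint Lk sx mcF cFC; congr (_ * _).
pose Q (w : R) j := \int[mu]_y (ext q t w y * g j y).
have main w : ind (interlaceb x w) * (wcut F w * vandermonde w) =
    E' * \det (\matrix_(i < N, j < N) slice q t (xl i) (xr i) (g j) (w ord0 i)).
  have -> : \det (\matrix_(i < N, j < N) slice q t (xl i) (xr i) (g j) (w ord0 i)) =
      ind (interlaceb x w) * \det (\matrix_(i < N, j < N) Q (w ord0 i) j).
    rewrite ind_interlaceb mulrC -[in RHS]det_tr -[LHS]det_tr.
    rewrite (_ : (\matrix_(i < N, j < N) Q (w ord0 i) j)^T =
      \matrix_(j < N, i < N) Q (w ord0 i) j); last by apply/matrixP => i j; rewrite !mxE.
    rewrite -det_mul_cols; congr (\det _).
    by apply/matrixP => i j; rewrite !mxE /slice mulrC.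
  rewrite [RHS]mulrCA /ind; case: ifPn => ib; last by rewrite !mul0r.
  rewrite !mul1r.
  have iw : interlace x w.
    apply/(interlaceP w) => // i j; rewrite leq_eqVlt => /predU1P[/val_inj ->//|ij].
    exact/ltW/sx.
  have w0 j : 0 < w ord0 j.
    by have [_ /(_ j)/andP[h _]] := iw; exact: lt_le_trans (x0 _) h.
  have [ww _] := iw.
  have wg : weyl_ge w by split => // j; exact: ltW.
  (* With two equal coordinates both sides vanish. At the other points the
     density of [T' t w] is known. *)
  rewrite wcutE//; have [sw|ns] := pselect (weyl_strict w); last first.
    rewrite vandermonde_eq0// mulr0.
    have [i [j [ij wij]]] := not_weyl_strictP ww ns.
    rewrite (@det_eq_rows _ _ _ i j) ?mulr0//; last by move=> k; rewrite wij.
    by rewrite -val_eqE/= ltn_eqF.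
  have wi : weyl_ge_interior w by [].
  rewrite /F (laguerre_semigroup_Rint qd Ts' t0 wi measurable_box_test box_test_norm).
  rewrite -/E' mulrAC divfK ?gt_eqF ?vandermonde_gt0//; congr (_ * _).
  have J (i j : 'I_N) : L1 mu (fun y => ext q t (w ord0 i) y * g j y).
    exact: (pdf_L1 (laguerre_pdf qd t0 (ltW (w0 i))) (mg j) (g_le1 j)).
  rewrite -(leb_det J).2; apply: eq_Rintegral => y _.
  have -> : wcut (fun y => box_test y * vandermonde y * karlin_mcgregor q t w y) y =
      karlin_mcgregor q t w y * box_prod y.
    have [wy|wy] := pselect (weyl_ge y); first by rewrite wcutE// box_testM mulrC.
    rewrite wcut0//; have [->|/box_prod_weyl//] := eqVneq (box_prod y) 0.
    by rewrite mulr0.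
  by rewrite /karlin_mcgregor /box_prod -det_mul_cols.
under eq_Rintegral do rewrite main.
have Js i j : L1 mu (slice q t (xl i) (xr i) (g j)).
  by have [_ _ ms _] := gi i j; exact: (slice_L1 qd t0 (xl0 i) (mg j) (g_le1 j) ms).
have [J1 J2] := leb_det_row Js.
rewrite RintZ// J2; congr (_ * _); rewrite /core -detZ; congr (\det _).
by apply/matrixP => i j; rewrite !mxE; have [_ _ _ ->] := gi i j.
Qed.

(** The constraints on [z_l] alone that make up interlacing of [y] with [z] in the
    chamber: y_{l-1} <= z_l <= y_l, the first being replaced by 0 <= z_0 and the
    last one being void. *)
Let between (y : 'rV[R]_N) (l : 'I_N.+1) (u : R) : bool :=
  [&& 0 <= u, (if unlift ord0 l is Some j then y ord0 j <= u else true) &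
      (if unlift ord_max l is Some j then u <= y ord0 j else true)].

Let measurable_between y l : measurable_fun setT (fun u => ind (between y l u) : R).
Proof.
apply: measurable_ind; apply: measurable_and; first exact: measurable_fun_ler.
by apply: measurable_and; case: unlift => [j|] //; exact: measurable_fun_ler.
Qed.

Let lift_max_widen (j : 'I_N) : lift ord_max j = widen_ord (leqnSn N) j.
Proof. by apply/val_inj; exact: lift_max. Qed.

Let betweenP y (z : 'rV[R]_N.+1) : weyl_ge y -> (forall l, 0 <= z ord0 l) ->
  (`[< weyl_ge z >] && interlaceb z y) = [forall l, between y l (z ord0 l)].
Proof.
move=> [wy y0] z0; apply/andP/forallP => [[_ /forallP H] l|H].
  rewrite /between z0/=; apply/andP; split.
    case: unliftP => // j ->; by have /andP[_] := H j.
  by case: unliftP => // j ->; rewrite lift_max_widen; have /andP[] := H j.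
have ib : interlaceb z y.
  apply/forallP => j; have /and3P[_ _] := H (widen_ord (leqnSn N) j).
  rewrite -lift_max_widen liftK => ->/=.
  by have /and3P[_] := H (lift ord0 j); rewrite liftK.
split => //; apply/asboolP; split => // i j; rewrite leq_eqVlt.
move=> /predU1P[/val_inj ->//|ij].
have iN : (i < N)%N by rewrite (leq_trans ij)// -ltnS.
have jN : (j.-1 < N)%N by rewrite -ltnS prednK// (leq_ltn_trans _ ij).
have /andP[h1 _] := forallP ib (Ordinal iN).
have /andP[_ h2] := forallP ib (Ordinal jN).
have -> : i = widen_ord (leqnSn N) (Ordinal iN) by exact/val_inj.
have -> : j = lift ord0 (Ordinal jN).
  by apply/val_inj; rewrite /= /bump leq0n add1n prednK// (leq_ltn_trans _ ij).
apply: le_trans h1 (le_trans _ h2); apply: wy => /=.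
by rewrite -ltnS prednK// (leq_ltn_trans _ ij).
Qed.

Let pdx (i : 'I_N.+1) : is_pdf (ext p t (x ord0 i)).
Proof. exact/(laguerre_pdf pd t0)/ltW/x0. Qed.

Let between_int y l i : weyl_ge y ->
  \int[mu]_u (ext p t (x ord0 i) u * ind (between y l u)) =
  (if unlift ord0 l is Some j then tail (ext p t (x ord0 i)) (y ord0 j) else 1) -
  (if unlift ord_max l is Some j then tail (ext p t (x ord0 i)) (y ord0 j) else 0).
Proof.
move=> [wy y0]; have [k0 Ik kn k1] := pdx i.
set k := ext p t (x ord0 i) in k0 Ik kn k1 *.
have kE (c : bool -> bool) u : k u * ind (c (0 <= u)) = k u * ind (c true).
  by case: (leP 0 u) => // u0; rewrite kn// !mul0r.
rewrite /between.
under eq_Rintegral do rewrite (kE (fun b => b && _)) /=.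
case: (unliftP ord0 l) => [j lj|l0]; case: (unliftP ord_max l) => [j' lj'|lm].
- rewrite tail_itv//; apply: wy.
  have : val l = (j.+1)%N by rewrite lj /= /bump leq0n add1n.
  by rewrite lj' lift_max_widen /= => ->.
- rewrite subr0; apply: eq_Rintegral => u _; by rewrite andbT.
- have <- : tail k 0 = 1 by exact: tail_0.
  rewrite -(tail_itv (pdx i))//; apply: eq_Rintegral => u _.
  by rewrite -(kE (fun b => b && _)).
- by rewrite subr0 -k1; apply: eq_Rintegral => u _; rewrite mulr1.
Qed.

Let Ikm : L1 (leb R N.+1) (karlin_mcgregor p t x).
Proof.
have J (i l : 'I_N.+1) : L1 mu (ext p t (x ord0 i)) by case: (pdx i).
exact: (leb_det J).1.
Qed.

(** The integral of the Karlin-McGregor determinant over all [z] that interlace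
    with [y] is a determinant of size N+1 in differences of tails at consecutive
    [y]; [det_interlace] turns it into one of size N in differences of tails at
    consecutive [x]. *)
Let km_int y : weyl_ge y ->
  \int[leb R N.+1]_z (ind (`[< weyl_ge z >] && interlaceb z y) * karlin_mcgregor p t x z) =
  \det (\matrix_(i < N, j < N) td i (y ord0 j)).
Proof.
move=> wy.
have J (i l : 'I_N.+1) : L1 mu (fun u => ext p t (x ord0 i) u * ind (between y l u)).
  by apply: (pdf_L1 (pdx i)); [exact: measurable_between|move=> u; exact: ind_norm].
transitivity (\int[leb R N.+1]_z \det (\matrix_(i < N.+1, l < N.+1)
    (ext p t (x ord0 i) (z ord0 l) * ind (between y l (z ord0 l))))).
  apply: eq_Rintegral => z _; rewrite det_mul_cols prod_ind -/(karlin_mcgregor p t x z).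
  have [z0|] := pselect (forall l, 0 <= z ord0 l).
    by rewrite betweenP// mulrC.
  move=> /existsNP[l /negP]; rewrite -ltNge => zl.
  rewrite /karlin_mcgregor (_ : \det _ = 0) ?mulr0 ?mul0r//.
  rewrite (expand_det_col _ l) big1// => i _; rewrite mxE.
  by have [_ _ -> //] := pdx i; rewrite mul0r.
rewrite (leb_det J).2.
transitivity (\det (\matrix_(i < N.+1, l < N.+1)
     ((if unlift ord0 l is Some j then tail (ext p t (x ord0 i)) (y ord0 j) else 1) -
      (if unlift ord_max l is Some j then tail (ext p t (x ord0 i)) (y ord0 j) else 0)))).
  by congr (\det _); apply/matrixP => i l; rewrite !mxE between_int.
exact: (det_interlace (fun i j => tail (ext p t (x ord0 i)) (y ord0 j))).
Qed.

Let bpI : L1 (leb R N) box_prod.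
Proof. exact: (leb_prod Ig).1. Qed.

(** When two coordinates of [z] coincide, the kernel is only known as a weak
    limit; both sides are then 0, the right one because some interval
    [z_i, z_{i+1}] is reduced to a point. *)
Let box_inner z : weyl_ge z ->
  kernel_op Lambda (@weyl_ge R N) box_test z * vandermonde z =
  N`!%:R * \int[leb R N]_y (ind (interlaceb z y) * box_prod y).
Proof.
move=> [wz z0]; rewrite kernel_opE wcut_box.
have [sz|ns] := pselect (weyl_strict z).
  have [_ ->] := interlacing_Rint Lk sz measurable_box_test box_test_norm.
  rewrite mulrAC divfK ?gt_eqF ?vandermonde_gt0//; congr (_ * _).
  by apply: eq_Rintegral => y _; rewrite box_testM.
rewrite vandermonde_eq0// mulr0.
have : exists i : 'I_N, z ord0 (widen_ord (leqnSn N) i) = z ord0 (lift ord0 i).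
  have [i [j [ij zij]]] := not_weyl_strictP wz ns.
  have iN : (i < N)%N by rewrite (leq_trans ij)// -ltnS.
  exists (Ordinal iN); apply/eqP; rewrite eq_le.
  have -> : widen_ord (leqnSn N) (Ordinal iN) = i by exact/val_inj.
  rewrite [z ord0 i]zij in wz *; apply/andP; split; last first.
    by apply: wz; rewrite /= /bump leq0n add1n.
  rewrite -zij; apply: wz => /=; rewrite /bump leq0n add1n; exact: leqnSn.
move=> [i zi].
pose h (j : 'I_N) u := ind (z ord0 (widen_ord (leqnSn N) j) <= u <= z ord0 (lift ord0 j)) * g j u.
have mh (j : 'I_N) : measurable_fun setT
    (fun u => ind (z ord0 (widen_ord (leqnSn N) j) <= u <= z ord0 (lift ord0 j)) : R).
  by apply: measurable_ind; apply: measurable_and; exact: measurable_fun_ler.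
have Jh j : L1 mu (h j).
  by apply: (@L1_boundedM _ _ _ mu 1) => //; exact: mh.
transitivity (N`!%:R * \int[leb R N]_y \prod_j h j (y ord0 j)); last first.
  congr (_ * _); apply: eq_Rintegral => y _.
  by rewrite big_split/= -ind_interlaceb.
rewrite (leb_prod Jh).2 (bigD1 i)//=.
suff -> : \int[mu]_u h i u = 0 by rewrite mul0r mulr0.
rewrite -[RHS](Rintegral_set1 (h i) (z ord0 (lift ord0 i))) [RHS]Rintegral_mkcond.
apply: eq_Rintegral => u _; rewrite patchE; case: ifPn => // /negP.
rewrite inE /= => /eqP uz; rewrite /h zi (_ : (_ <= u <= _) = false) ?mul0r//.
by rewrite -eq_le eq_sym; apply/negbTE.
Qed.

Lemma box_lhs :
  kernel_op (T t) (@weyl_ge R N.+1) (kernel_op Lambda (@weyl_ge R N) box_test) x =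
  expR (N.+1%:R * (N.+1%:R - 1) / 2 * t) / vandermonde x * (N`!%:R * core).
Proof.
set E := expR _.
pose G z := \int[Lambda z]_y box_test y.
have GE : kernel_op Lambda (@weyl_ge R N) box_test = G.
  by apply: funext => w; rewrite kernel_opE wcut_box.
have mG : measurable_fun setT G.
  exact: measurable_pker_Rint measurable_box_test box_test_norm.
have GC w : `|G w| <= gap^-1 by exact: pker_norm measurable_box_test box_test_norm.
rewrite GE kernel_opE.
have mcG := measurable_wcut mG.
have cGC : forall w, `|wcut G w| <= gap^-1.
  by apply: wcut_norm => //; rewrite invr_ge0 ltW.
rewrite (laguerre_semigroup_Rint pd Ts t0 xi mcG cGC) -/E; congr (_ * _).
(* [f] is the joint integrand; integrating [z] first, for fixed [y] in the box,
   leaves a determinant of functions of the coordinates of [y]. *)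
pose c (z : 'rV[R]_N.+1) (y : 'rV[R]_N) : R := ind (`[< weyl_ge z >] && interlaceb z y).
pose f (u : 'rV[R]_N.+1 * 'rV[R]_N) :=
  c u.1 u.2 * (karlin_mcgregor p t x u.1 * box_prod u.2).
have mc : measurable_fun setT (fun u : 'rV[R]_N.+1 * 'rV[R]_N => c u.1 u.2).
  have -> : (fun u => c u.1 u.2) = (fun u : 'rV[R]_N.+1 * 'rV[R]_N =>
      wcut (cst 1) u.1 * \prod_(i < N) ind (u.1 ord0 (widen_ord (leqnSn N) i) <=
      u.2 ord0 i <= u.1 ord0 (lift ord0 i))).
    apply: funext => -[z y] /=; rewrite prod_ind /c.
    have [wz|wz] := pselect (weyl_ge z).
      by rewrite wcutE// mul1r (asboolT wz).
    by rewrite wcut0// mul0r (asboolF wz).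
  apply: measurable_funM.
    by apply: (measurableT_comp (measurable_wcut _)) => //; exact: measurable_cst.
  apply: measurable_prod => i _; apply: measurable_ind.
  have m1 j : measurable_fun setT (fun u : 'rV[R]_N.+1 * 'rV[R]_N => u.1 ord0 j).
    exact: (measurableT_comp (measurable_rV_coord j) measurable_fst).
  have m2 j : measurable_fun setT (fun u : 'rV[R]_N.+1 * 'rV[R]_N => u.2 ord0 j).
    exact: (measurableT_comp (measurable_rV_coord j) measurable_snd).
  by apply: measurable_and; apply: measurable_fun_ler.
have mc1 z : measurable_fun setT (c z).
  exact: (measurableT_comp mc (measurable_pair1 z)).
have mc2 y : measurable_fun setT (c ^~ y).
  exact: (measurableT_comp mc (measurable_pair2 y)).
have If : L1 (leb R N.+1 \x leb R N)%E f.
  apply: (@L1_boundedM _ _ _ _ 1) => //; first by move=> u; exact: ind_norm.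
  exact: L1_prod.
have F1 z : L1 (leb R N) (fun y => c z y * box_prod y).
  by apply: (@L1_boundedM _ _ _ _ 1) => // u; exact: ind_norm.
have F2 y : L1 (leb R N.+1) (fun z => c z y * karlin_mcgregor p t x z).
  by apply: (@L1_boundedM _ _ _ _ 1) => // u; exact: ind_norm.
transitivity (\int[leb R N.+1]_z (N`!%:R * \int[leb R N]_y f (z, y))).
  apply: eq_Rintegral => z _; rewrite /f /=.
  transitivity (N`!%:R *
      (karlin_mcgregor p t x z * \int[leb R N]_y (c z y * box_prod y))); last first.
    congr (_ * _); rewrite -RintZ//; apply: eq_Rintegral => y _.
    by rewrite mulrCA.
  have [wz|wz] := pselect (weyl_ge z).
    rewrite !wcutE// -GE box_inner// mulrC mulrCA; congr (_ * (_ * _)).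
    by apply: eq_Rintegral => y _; rewrite /c asboolT.
  rewrite wcut0//; under eq_Rintegral do rewrite /c asboolF// mul0r.
  by rewrite Rintegral_cst// mul0r !mulr0.
have fub := Rint_Fubini If.
have IF : L1 (leb R N.+1) (fun z => \int[leb R N]_y f (z, y)).
  have H := integrable_fubini_F If.
  apply: eq_integrable H => // z _; rewrite /fubini_F /= Rint_EFin//.
  have := L1Z (karlin_mcgregor p t x z) (F1 z).
  by under eq_fun do rewrite mulrCA.
rewrite RintZ//; congr (_ * _); rewrite fub; last 2 first.
- move=> z; have := L1Z (karlin_mcgregor p t x z) (F1 z).
  by under eq_fun do rewrite mulrCA.
- move=> y; have := L1Z (box_prod y) (F2 y).
  by congr (integrable _ _ _); apply: funext => z; rewrite /f/=; congr EFin; ring.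
have Jtd (i j : 'I_N) : L1 mu (fun u => td i u * g j u).
  apply: (@L1_boundedM _ _ _ mu 1) => //.
    exact: (measurable_tail_diff pd t0 (xl0 i) (xlr i)).
  exact: (tail_diff_norm pd t0 (xl0 i) (xlr i)).
transitivity (\int[leb R N]_y \det (\matrix_(i < N, j < N)
    (td i (y ord0 j) * g j (y ord0 j)))).
  apply: eq_Rintegral => y _; rewrite /f /=.
  transitivity (box_prod y * \int[leb R N.+1]_z (c z y * karlin_mcgregor p t x z)).
    rewrite -RintZ//; apply: eq_Rintegral => z _; ring.
  rewrite det_mul_cols -/(box_prod y) mulrC.
  have [->|/box_prod_weyl wy] := eqVneq (box_prod y) 0; first by rewrite !mulr0.
  by rewrite km_int.
rewrite (leb_det Jtd).2 /core; congr (\det _); apply/matrixP => i j.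
by rewrite !mxE; apply: eq_Rintegral => u _; rewrite mulrC.
Qed.

(** The two exponents differ by N t, which is the product of the factors e^t
    coming from the N coordinates. *)
Lemma box_identity :
  kernel_op (T t) (@weyl_ge R N.+1) (kernel_op Lambda (@weyl_ge R N) box_test) x =
  kernel_op Lambda (@weyl_ge R N) (kernel_op (T' t) (@weyl_ge R N) box_test) x.
Proof.
rewrite box_lhs box_rhs -expRM_natl.
have -> : expR (N.+1%:R * (N.+1%:R - 1) / 2 * t) =
    expR (N%:R * (N%:R - 1) / 2 * t) * expR (N%:R * t).
  by rewrite -expRD; congr expR; rewrite -natr1; field.
by ring.
Qed.

End box.

(** * Approximation by box functions *)

Section kernel_op_theory.
Context {R : realType} {m n : nat} (K : R.-pker 'rV[R]_m ~> 'rV[R]_n).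
Implicit Types (f g : 'rV[R]_n -> R) (x : 'rV[R]_m).
Local Notation W := (@weyl_ge R n).

Definition bounded_measurable f (C : R) :=
  measurable_fun setT (wcut f) /\ forall y, `|wcut f y| <= C.

Lemma kernel_op_norm f C : bounded_measurable f C ->
  forall x, `|kernel_op K W f x| <= C.
Proof. by move=> [mf fC] x; rewrite kernel_opE; exact: pker_norm. Qed.

Lemma measurable_kernel_op f C : bounded_measurable f C ->
  measurable_fun setT (kernel_op K W f).
Proof.
move=> [mf fC]; rewrite (_ : kernel_op K W f = fun x => \int[K x]_y wcut f y).
  exact: measurable_pker_Rint mf fC.
by apply: funext => x; rewrite kernel_opE.
Qed.

Lemma kernel_op_lin (c : R) f g C D x : bounded_measurable f C ->
  bounded_measurable g D ->
  kernel_op K W (fun y => c * f y + g y) x =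
  c * kernel_op K W f x + kernel_op K W g x.
Proof.
move=> [mf fC] [mg gD]; rewrite !kernel_opE.
have If := pker_L1 K x mf fC; have Ig := pker_L1 K x mg gD.
rewrite -RintZ// -RintegralD//; last exact: L1Z.
apply: eq_Rintegral => y _; have [wy|wy] := pselect (W y).
  by rewrite !wcutE.
by rewrite !wcut0// mulr0 addr0.
Qed.

Lemma kernel_op_dominated (f_ : nat -> 'rV[R]_n -> R) f C x :
  (forall k, bounded_measurable (f_ k) C) -> measurable_fun setT (wcut f) ->
  {ae K x, forall y, wcut (f_ k) y @[k --> \oo] --> wcut f y} ->
  kernel_op K W (f_ k) x @[k --> \oo] --> kernel_op K W f x.
Proof.
move=> fC mf ff; rewrite kernel_opE.
under eq_fun do rewrite kernel_opE.
apply: (@Rint_dominated _ _ _ (K x) _ _ (cst C) _ mf ff _ _).2.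
- by move=> k; case: (fC k).
- by apply: (@pker_L1 _ _ _ _ _ _ _ `|C|).
- by move=> k y; case: (fC k).
Qed.

End kernel_op_theory.

Lemma bounded_measurable_kernel_op {R : realType} {m n : nat}
    (K : R.-pker 'rV[R]_m ~> 'rV[R]_n) (f : 'rV[R]_n -> R) (C : R) :
  0 <= C -> bounded_measurable f C ->
  bounded_measurable (kernel_op K (@weyl_ge R n) f) C.
Proof.
move=> C0 fC; split; first by apply: measurable_wcut; exact: measurable_kernel_op fC.
by apply: wcut_norm => // y _; exact: kernel_op_norm.
Qed.

Lemma measurable_vandermonde0 {R : realType} n :
  measurable [set y : 'rV[R]_n | vandermonde y = 0].
Proof.
have := @measurable_vandermonde R n measurableT [set 0] (measurable_set1 0).
by rewrite setTI.
Qed.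

Lemma ae_vandermonde_neq0 {R : realType} {n : nat} (p : R -> R -> R -> R)
    (T : R -> R.-pker 'rV[R]_n ~> 'rV[R]_n) (t : R) (w : 'rV[R]_n) :
  laguerre_semigroup p T -> 0 < t -> weyl_ge_interior w ->
  {ae T t w, forall y, vandermonde y != 0}.
Proof.
move=> [_ _ dens] t0 wi; exists [set y | vandermonde y = 0]; split.
- exact: measurable_vandermonde0.
- rewrite dens//; last exact: measurable_vandermonde0.
  apply: integral0_eq => y [/= v0 _].
  by rewrite /laguerre_density_N v0 mul0r mulr0 mul0r.
- by move=> y /= /negP; rewrite negbK => /eqP.
Qed.

Lemma ae_interlace {R : realType} {n : nat}
    (L : R.-pker 'rV[R]_n.+1 ~> 'rV[R]_n) (x : 'rV[R]_n.+1) :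
  interlacing_kernel L -> weyl_strict x ->
  {ae L x, forall y, interlace x y /\ vandermonde y != 0}.
Proof.
move=> [dens _] sx.
have wx : weyl x.
  by move=> i j; rewrite leq_eqVlt => /predU1P[/val_inj ->//|ij]; exact/ltW/sx.
pose A := [set y : 'rV[R]_n | vandermonde y = 0] `|` ~` [set y | interlaceb x y].
have mA : measurable A.
  apply: measurableU; first exact: measurable_vandermonde0.
  apply: measurableC.
  have := measurable_interlaceb x measurableT (measurable_set1 1).
  rewrite setTI; congr measurable; apply/seteqP; split => y /=; rewrite /ind.
    by case: ifP => // _ /eqP; rewrite eq_sym oner_eq0.
  by move=> ->.
exists A; split => //.
- rewrite dens//; apply: integral0_eq => y [[/= v0 _|/= nI /(interlaceP y wx)//]].
  by rewrite v0 mul0r mulr0.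
- move=> y /= H; apply: contrapT => /not_orP[/= v0 /contrapT iy]; apply: H.
  by split; [exact/interlaceP|exact/eqP].
Qed.

Section grid_approximation.
Context {R : realType} {N : nat}.
Implicit Types (f : 'rV[R]_N -> R) (y : 'rV[R]_N).

(** The cells have side 1 / m and corners in (1 / m) {0, ..., m^2 - 1}^N, so that
    they exhaust the chamber; the condition of being apart leaves a gap between
    the intervals, which keeps the Vandermonde product away from 0. *)
Definition cell_lo (m : nat) (k : {ffun 'I_N -> 'I_(m * m)}) (j : 'I_N) : R :=
  (k j : nat)%:R / m%:R.
Definition cell_hi (m : nat) (k : {ffun 'I_N -> 'I_(m * m)}) (j : 'I_N) : R :=
  (k j).+1%:R / m%:R.
Definition cells_apart (m : nat) (k : {ffun 'I_N -> 'I_(m * m)}) : bool :=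
  [forall i : 'I_N, forall j : 'I_N, (i < j)%N ==> ((k i).+1 < k j)%N].

(** The factors make up for e^{-y} / vandermonde y in [box_test]. The Vandermonde
    product is compensated by its infimum over the cell, and e^{-y} by its
    supremum, so that the approximation stays below the supremum of f. *)
Definition cell_coef (m : nat) f (k : {ffun 'I_N -> 'I_(m * m)}) : R :=
  f (\row_j cell_lo k j) *
  (\prod_(i < N) \prod_(j < N | (i < j)%N) (cell_lo k j - cell_hi k i)) *
  \prod_j expR (cell_lo k j).

Definition step_approx (m : nat) f y : R :=
  \sum_(k : {ffun 'I_N -> 'I_(m * m)} | cells_apart k)
    cell_coef f k * box_test (cell_lo k) (cell_hi k) y.

Lemma cell_sep m (k : {ffun 'I_N -> 'I_(m * m)}) : (0 < m)%N -> cells_apart k ->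
  forall i j : 'I_N, (i < j)%N -> cell_hi k i < cell_lo k j.
Proof.
move=> m0 /forallP sk i j ij; have /forallP/(_ j)/implyP/(_ ij) h := sk i.
by rewrite /cell_hi /cell_lo ltr_pM2r ?invr_gt0 ?ltr0n// ltr_nat.
Qed.

Lemma cell_lo_ge0 m (k : {ffun 'I_N -> 'I_(m * m)}) j : 0 <= cell_lo k j.
Proof. by rewrite divr_ge0. Qed.

Lemma cell_lo_le m (k : {ffun 'I_N -> 'I_(m * m)}) j : cell_lo k j <= cell_hi k j.
Proof. by rewrite ler_wpM2r ?invr_ge0// ler_nat. Qed.

Lemma cell_weyl m (k : {ffun 'I_N -> 'I_(m * m)}) : (0 < m)%N -> cells_apart k ->
  weyl_ge (\row_j cell_lo k j).
Proof.
move=> m0 sk; split => [i j|j]; rewrite !mxE ?cell_lo_ge0//.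
rewrite leq_eqVlt => /predU1P[/val_inj ->//|ij].
exact: le_trans (cell_lo_le _ _) (ltW (cell_sep m0 sk ij)).
Qed.

Lemma cell_floor m (k : {ffun 'I_N -> 'I_(m * m)}) y j : (0 < m)%N ->
  cell_lo k j <= y ord0 j < cell_hi k j -> (k j : nat) = Num.trunc (m%:R * y ord0 j).
Proof.
move=> m0; have mR : 0 < m%:R :> R by rewrite ltr0n.
rewrite /cell_lo /cell_hi ler_pdivrMr// ltr_pdivlMr// mulrC => h.
by rewrite (truncn_def h).
Qed.

Lemma cell_termE m f (k : {ffun 'I_N -> 'I_(m * m)}) y :
  (forall j, cell_lo k j <= y ord0 j < cell_hi k j) ->
  cell_coef f k * box_test (cell_lo k) (cell_hi k) y =
  f (\row_j cell_lo k j) *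
  ((\prod_(i < N) \prod_(j < N | (i < j)%N) (cell_lo k j - cell_hi k i)) /
    vandermonde y) * \prod_j expR (cell_lo k j - y ord0 j).
Proof.
move=> yk; rewrite /cell_coef /box_test /box_prod.
have -> : \prod_j box_fun (cell_lo k) (cell_hi k) j (y ord0 j) =
    \prod_j expR (- y ord0 j).
  apply: eq_bigr => j _; rewrite /box_fun /half_exp /ind yk.
  have /andP[h _] := yk j; rewrite (le_trans (cell_lo_ge0 _ _) h).
  by rewrite !mul1r.
have -> : \prod_j expR (cell_lo k j - y ord0 j) =
    (\prod_j expR (cell_lo k j)) * \prod_j expR (- y ord0 j).
  by rewrite -big_split/=; apply: eq_bigr => j _; rewrite expRD.
ring.
Qed.

Lemma cell_term_uniq m f y (k0 : {ffun 'I_N -> 'I_(m * m)}) : (0 < m)%N ->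
  cells_apart k0 -> (forall j, cell_lo k0 j <= y ord0 j < cell_hi k0 j) ->
  step_approx m f y = cell_coef f k0 * box_test (cell_lo k0) (cell_hi k0) y.
Proof.
move=> m0 s0 yk0; rewrite /step_approx (bigD1 k0)//= big1 ?addr0// => k /andP[sk kk0].
rewrite /box_test; have [->|/(box_prod_neq0 (cell_sep m0 sk))[_ yk]] :=
  eqVneq (box_prod (cell_lo k) (cell_hi k) y) 0; first by rewrite mul0r mulr0.
exfalso; move/eqP : kk0; apply; apply/ffunP => j; apply/val_inj.
by rewrite /= (cell_floor m0 (yk j)) (cell_floor m0 (yk0 j)).
Qed.

Lemma step_approx_norm m f C : (0 < m)%N -> 0 <= C ->
  (forall y, weyl_ge y -> `|f y| <= C) -> forall y, `|step_approx m f y| <= C.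
Proof.
move=> m0 C0 fC y.
have [[k0 [s0 n0]]|H] := pselect (exists k0 : {ffun 'I_N -> 'I_(m * m)},
  cells_apart k0 /\ box_prod (cell_lo k0) (cell_hi k0) y != 0); last first.
  rewrite /step_approx big1 ?normr0// => k sk.
  rewrite /box_test; have [->|n0] := eqVneq (box_prod (cell_lo k) (cell_hi k) y) 0.
    by rewrite mul0r mulr0.
  by exfalso; apply: H; exists k.
have sep := cell_sep m0 s0.
have [sy yk] := box_prod_neq0 sep n0.
rewrite (cell_term_uniq _ m0 s0 yk) cell_termE// !normrM -[leRHS]mulr1 ler_pM//.
  rewrite -[leRHS]mulr1 ler_pM//; first exact: fC (cell_weyl m0 s0).
  have v0 := vandermonde_gt0 sy.
  rewrite normfV (gtr0_norm v0) ler_pdivrMr// mul1r ger0_norm.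
    apply: ler_prod => i _; rewrite prodr_ge0 => [|j ij]; last by rewrite subr_ge0 ltW// sep.
    apply: ler_prod => j ij; rewrite subr_ge0 ltW ?sep//=.
    have /andP[_ h1] := yk i; have /andP[h2 _] := yk j.
    by rewrite lerB// ltW.
  by apply: prodr_ge0 => i _; apply: prodr_ge0 => j ij; rewrite subr_ge0 ltW// sep.
rewrite normr_prod; apply: prodr_ile1 => // j _.
rewrite normr_ge0/= ger0_norm ?expR_ge0// -expR0 ler_expR subr_le0.
by have /andP[] := yk j.
Qed.

Lemma step_approx_cvg f y : {within @weyl_ge R N, continuous f} ->
  weyl_ge y -> weyl_strict y -> step_approx n.+1 f y @[n --> \oo] --> f y.
Proof.
move=> fc [wy y0] sy.
pose a n := grid n.+1 y : 'rV[R]_N.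
(* The value of the step function, written in terms of the grid point [a n]. *)
pose h n := f (a n) *
  ((\prod_(i < N) \prod_(j < N | (i < j)%N) (a n ord0 j - (a n ord0 i + n.+1%:R^-1))) /
    vandermonde y) * \prod_j expR (a n ord0 j - y ord0 j).
have ac j : a n ord0 j @[n --> \oo] --> y ord0 j.
  by move: (@grid_cvg R N y) => /rV_cvgP/(_ j).
have ga n j : 0 <= a n ord0 j.
  by rewrite mxE divr_ge0// ler0z Num.Theory.floor_ge0 mulr_ge0.
have wa n : weyl_ge (a n).
  split => // i j ij; rewrite !mxE ler_wpM2r// ler_int.
  by apply: Num.Theory.le_floor; rewrite ler_wpM2l// wy.
have hc : h n @[n --> \oo] --> f y.
  have -> : f y = f y * (vandermonde y / vandermonde y) * \prod_(j < N) (1 : R).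
    by rewrite divff ?gt_eqF ?vandermonde_gt0// big1_eq !mulr1.
  apply: cvgM; [apply: cvgM|].
  - apply/cvgrPdist_lt => e e0.
    have [d d0 dP] := (rV_withinP _ _).1 fc y (conj wy y0) e e0.
    have : \forall n \near \oo, n.+1%:R^-1 < d by exact: near_infty_natSinv_lt (PosNum d0).
    apply: filterS => n nd; rewrite distrC; apply: dP => // j.
    have /andP[h1 h2] := @grid_dist R N n.+1 y j isT.
    by rewrite distrC ger0_norm// (lt_trans h2).
  - apply: cvgM; last exact: cvg_cst.
    apply: cvg_big => // [|i _]; first by move=> z; apply: mul_continuous.
    apply: cvg_big => // [|j _]; first by move=> z; apply: mul_continuous.
    rewrite -[X in _ --> _ - X]addr0; apply: cvgB => //; apply: cvgD => //.
    exact: cvg_harmonic.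
  - apply: cvg_big => // [|j _]; first by move=> z; apply: mul_continuous.
    rewrite -[X in _ --> X](@expR0 R) -(subrr (y ord0 j)).
    apply: continuous_cvg; first exact: continuous_expR.
    by apply: cvgB => //; exact: cvg_cst.
apply: cvg_trans hc; apply: near_eq_cvg.
have big : \forall n \near \oo, forall j, y ord0 j < n.+1%:R.
  apply: (@filter_forall _ _ (fun j n => y ord0 j < n.+1%:R)) => j.
  near=> n; apply: (@le_lt_trans _ _ (Num.trunc (y ord0 j)).+1%:R).
    by have /andP[_ /ltW] := truncn_itv (y0 j).
  by rewrite ltr_nat ltnS; near: n; exact: nbhs_infty_gt.
have gaps : \forall n \near \oo, forall u : 'I_N * 'I_N, (u.1 < u.2)%N ->
    2 * n.+1%:R^-1 < y ord0 u.2 - y ord0 u.1.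
  apply: (@filter_forall _ _ (fun (u : 'I_N * 'I_N) n => (u.1 < u.2)%N ->
    2 * n.+1%:R^-1 < y ord0 u.2 - y ord0 u.1)) => -[i j] /=.
  have [ij|ij] := boolP (i < j)%N; last by apply: nearW.
  have d0 : 0 < (y ord0 j - y ord0 i) / 2 by rewrite divr_gt0// subr_gt0 sy.
  have : \forall n \near \oo, n.+1%:R^-1 < (y ord0 j - y ord0 i) / 2.
    exact: near_infty_natSinv_lt (PosNum d0).
  by apply: filterS => n nd _; rewrite mulrC -ltr_pdivlMr.
(* Once all gaps of [y] exceed 2 / n and its coordinates are below n, the point
   [y] lies in exactly one admissible cell [k], whose lower corner is [a n]. *)
near=> n.
have bign : forall j, y ord0 j < n.+1%:R by near: n; exact: big.
have gapn : forall u : 'I_N * 'I_N, (u.1 < u.2)%N ->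
    2 * n.+1%:R^-1 < y ord0 u.2 - y ord0 u.1 by near: n; exact: gaps.
have nR : 0 < n.+1%:R :> R by rewrite ltr0n.
have kb j : (Num.trunc (n.+1%:R * y ord0 j) < n.+1 * n.+1)%N.
  rewrite -(ltr_nat R) natrM.
  have /andP[h1 _] := truncn_itv (mulr_ge0 (ltW nR) (y0 j)).
  by apply: (le_lt_trans h1); rewrite ltr_pM2l.
pose k : {ffun 'I_N -> 'I_(n.+1 * n.+1)} := [ffun j => Ordinal (kb j)].
have kE j : (k j)%:R = n.+1%:R * a n ord0 j.
  rewrite ffunE /= mxE [RHS]mulrC divfK ?gt_eqF//.
  have z0 : 0 <= n.+1%:R * y ord0 j by rewrite mulr_ge0.
  rewrite (@floor_def _ _ (Posz (Num.trunc (n.+1%:R * y ord0 j))))//.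
  have /andP[h1 h2] := truncn_itv z0; rewrite -[ltRHS]natr1 in h2.
  by rewrite intrD1; apply/andP; split; [exact: h1|exact: h2].
have loE j : cell_lo k j = a n ord0 j by rewrite /cell_lo kE mulrC mulKf ?gt_eqF.
have hiE j : cell_hi k j = a n ord0 j + n.+1%:R^-1.
  by rewrite /cell_hi -natr1 mulrDl -/(cell_lo k j) loE mul1r.
have dist j := @grid_dist R N n.+1 y j isT.
have yk j : cell_lo k j <= y ord0 j < cell_hi k j.
  by rewrite loE hiE; have /andP[h1 h2] := dist j; rewrite -subr_ge0 h1/= addrC -ltrBlDr.
have sk : cells_apart k.
  apply/forallP => i; apply/forallP => j; apply/implyP => ij.
  rewrite -(ltr_nat R) -(ltr_pM2r (x := n.+1%:R^-1)) ?invr_gt0//.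
  rewrite -/(cell_hi k i) -/(cell_lo k j) hiE loE.
  have /andP[h1 h2] := dist j; have /andP[h3 h4] := dist i.
  have /= := gapn (i, j) ij.
  clear -h1 h2 h3 h4; move: h1 h2 h3 h4; set e := (n.+1%:R^-1 : R).
  move: (a n ord0 j) (a n ord0 i) (y ord0 j) (y ord0 i) => u v z w; lra.
rewrite (cell_term_uniq _ (ltn0Sn n) sk yk) cell_termE// /h.
have -> : \row_j cell_lo k j = a n by apply/rowP => j; rewrite mxE loE.
congr (_ * (_ / _) * _).
  by apply: eq_bigr => i _; apply: eq_bigr => j _; rewrite loE hiE.
by apply: eq_bigr => j _; rewrite loE.
Unshelve. all: by end_near. Qed.

End grid_approximation.

(** * The intertwining at interior points *)

Section interior.
Context {R : realType} {N : nat} (alpha : R) (p q : R -> R -> R -> R)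
  (T : R -> R.-pker 'rV[R]_N.+1 ~> 'rV[R]_N.+1)
  (T' : R -> R.-pker 'rV[R]_N ~> 'rV[R]_N)
  (Lambda : R.-pker 'rV[R]_N.+1 ~> 'rV[R]_N).
Hypotheses (al : -1 < alpha) (pd : laguerre_density alpha p)
  (qd : laguerre_density (alpha + 1) q) (Ts : laguerre_semigroup p T)
  (Ts' : laguerre_semigroup q T') (Lk : interlacing_kernel Lambda).
Variables (t : R) (t0 : 0 < t) (x : 'rV[R]_N.+1) (xi : weyl_ge_interior x).

Let TLambda (f : 'rV[R]_N -> R) :=
  kernel_op (T t) (@weyl_ge R N.+1) (kernel_op Lambda (@weyl_ge R N) f) x.
Let LambdaT' (f : 'rV[R]_N -> R) :=
  kernel_op Lambda (@weyl_ge R N) (kernel_op (T' t) (@weyl_ge R N) f) x.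

Let good (f : 'rV[R]_N -> R) :=
  [/\ measurable_fun setT f, exists C, forall y, `|f y| <= C & TLambda f = LambdaT' f].

Let bm (f : 'rV[R]_N -> R) (C : R) : measurable_fun setT f -> (forall y, `|f y| <= C) ->
  bounded_measurable f `|C|.
Proof.
move=> mf fC; split; first exact: measurable_wcut.
by apply: wcut_norm => // y _; rewrite (le_trans (fC y))// ler_norm.
Qed.

Let good_lin (c : R) (f g : 'rV[R]_N -> R) : good f -> good g -> good (fun y => c * f y + g y).
Proof.
move=> [mf [C fC] ef] [mg [D gD] eg].
have Bf := bm mf fC; have Bg := bm mg gD.
have lin (m n : nat) (K1 : R.-pker 'rV[R]_m ~> 'rV[R]_n)
  (K2 : R.-pker 'rV[R]_n ~> 'rV[R]_N) z :
  kernel_op K1 (@weyl_ge R n) (kernel_op K2 (@weyl_ge R N) (fun y => c * f y + g y)) z =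
  c * kernel_op K1 (@weyl_ge R n) (kernel_op K2 (@weyl_ge R N) f) z +
    kernel_op K1 (@weyl_ge R n) (kernel_op K2 (@weyl_ge R N) g) z.
  have -> : kernel_op K2 (@weyl_ge R N) (fun y => c * f y + g y) =
     (fun w => c * kernel_op K2 (@weyl_ge R N) f w + kernel_op K2 (@weyl_ge R N) g w).
    by apply: funext => w; rewrite (kernel_op_lin K2 c w Bf Bg).
  rewrite (kernel_op_lin K1 c z (C := `|C|) (D := `|D|))//.
    exact: bounded_measurable_kernel_op.
  exact: bounded_measurable_kernel_op.
split.
- by apply: measurable_funD => //; exact: measurable_funM.
- exists (`|c| * C + D) => y; rewrite (le_trans (ler_normD _ _))// lerD//.
  by rewrite normrM ler_wpM2l.
- by rewrite /TLambda /LambdaT' !lin -/(TLambda f) -/(TLambda g) ef eg.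
Qed.

Let good0 : good (fun=> 0).
Proof.
have k0 (m n : nat) (K : R.-pker 'rV[R]_m ~> 'rV[R]_n) :
    kernel_op K (@weyl_ge R n) (fun=> 0) = (fun=> 0).
  by apply: funext => z; rewrite /kernel_op /Rintegral integral0.
split => //; first by exists 0 => y; rewrite normr0.
by rewrite /TLambda /LambdaT' !k0.
Qed.

Let good_step m f : (0 < m)%N -> good (step_approx m f).
Proof.
move=> m0; rewrite /step_approx.
pose term (k : {ffun 'I_N -> 'I_(m * m)}) (y : 'rV[R]_N) : R :=
  cell_coef f k * box_test (@cell_lo R N m k) (@cell_hi R N m k) y.
have H (s : seq {ffun 'I_N -> 'I_(m * m)}) :
    good (fun y => \sum_(k <- s | cells_apart k) term k y).
  elim: s => [|k s IH].
    have -> : (fun y => \sum_(k <- [::] | cells_apart k) term k y) = fun=> 0.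
      by apply: funext => y; rewrite big_nil.
    exact: good0.
  have [sk|sk] := boolP (cells_apart k); last first.
    have -> : (fun y => \sum_(j <- k :: s | cells_apart j) term j y) =
        (fun y => \sum_(j <- s | cells_apart j) term j y).
      by apply: funext => y; rewrite big_cons (negPf sk).
    exact: IH.
  have -> : (fun y => \sum_(j <- k :: s | cells_apart j) term j y) =
      (fun y => cell_coef f k * box_test (@cell_lo R N m k) (@cell_hi R N m k) y +
        \sum_(j <- s | cells_apart j) term j y).
    by apply: funext => y; rewrite big_cons sk.
  have sep := cell_sep (R := R) m0 sk.
  apply: (@good_lin _ (box_test (@cell_lo R N m k) (@cell_hi R N m k)) _ _ IH).
  split.
  - exact: measurable_box_test sep.
  - by eexists => y; exact: (box_test_norm sep).
  - exact: (box_identity al pd qd Ts Ts' Lk t0 xi (cell_lo_ge0 k) (cell_lo_le k) sep).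
exact: H.
Qed.

(** Two nested dominated convergences on each side: at an interior point both
    kernels are absolutely continuous, hence do not charge the coincidence set
    where the step functions may fail to converge. *)
Lemma intertwining_interior f C : 0 <= C -> {within @weyl_ge R N, continuous f} ->
  (forall y, weyl_ge y -> `|f y| <= C) -> TLambda f = LambdaT' f.
Proof.
move=> C0 fc fC.
pose f_ n := step_approx n.+1 f.
have gf n : good (f_ n) by exact: good_step.
have mf := measurable_wcut_continuous fc.
have Bf n : bounded_measurable (f_ n) C.
  have [mfn _ _] := gf n; split; first exact: measurable_wcut.
  by apply: wcut_norm => // y _; exact: step_approx_norm.
have Bf0 : bounded_measurable f C by split => //; exact: wcut_norm.
have cf y : vandermonde y != 0 -> wcut (f_ n) y @[n --> \oo] --> wcut f y.
  move=> v0; have [wy|wy] := pselect (weyl_ge y); last first.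
    rewrite wcut0//; under eq_fun do rewrite wcut0//.
    exact: cvg_cst.
  rewrite wcutE//; under eq_fun do rewrite wcutE//.
  apply: step_approx_cvg => //; apply: contrapT => ns.
  by move: v0; rewrite vandermonde_eq0 ?eqxx//; case: wy.
have c1 : TLambda (f_ n) @[n --> \oo] --> TLambda f.
  apply: (@kernel_op_dominated _ _ _ (T t) _ _ C).
  - by move=> n; apply: bounded_measurable_kernel_op.
  - by apply: measurable_wcut; exact: measurable_kernel_op Bf0.
  - apply: aeS (ae_vandermonde_neq0 Ts t0 xi) => z vz.
    have [wz|wz] := pselect (weyl_ge z); last first.
      rewrite wcut0//; under eq_fun do rewrite wcut0//.
      exact: cvg_cst.
    rewrite wcutE//; under eq_fun do rewrite wcutE//.
    apply: (@kernel_op_dominated _ _ _ Lambda _ _ C) => //.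
    have sz : weyl_strict z.
      apply: contrapT => ns; move: vz; rewrite vandermonde_eq0 ?eqxx//.
      by case: wz.
    by apply: aeS (ae_interlace Lk sz) => y [_ vy]; exact: cf.
have sx : weyl_strict x by case: xi.
have c2 : LambdaT' (f_ n) @[n --> \oo] --> LambdaT' f.
  apply: (@kernel_op_dominated _ _ _ Lambda _ _ C).
  - by move=> n; apply: bounded_measurable_kernel_op.
  - by apply: measurable_wcut; exact: measurable_kernel_op Bf0.
  - apply: aeS (ae_interlace Lk sx) => w [[ww iw] vw].
    have w0 j : 0 < w ord0 j.
      have /andP[h _] := iw j; apply: lt_le_trans h; by case: xi.
    have wg : weyl_ge w by split => // j; exact: ltW.
    have wi : weyl_ge_interior w.
      split => //; apply: contrapT => ns; move: vw.
      by rewrite vandermonde_eq0 ?eqxx.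
    rewrite wcutE//; under eq_fun do rewrite wcutE//.
    apply: (@kernel_op_dominated _ _ _ (T' t) _ _ C) => //.
    by apply: aeS (ae_vandermonde_neq0 Ts' t0 wi) => y; exact: cf.
have e : (fun n => TLambda (f_ n)) = (fun n => LambdaT' (f_ n)).
  by apply: funext => n; case: (gf n).
have c3 : TLambda (f_ n) @[n --> \oo] --> LambdaT' f by rewrite e.
exact: (cvg_unique _ c1 c3).
Qed.

End interior.

(** * Continuity up to the boundary of the chamber *)

Section approach.
Context {R : realType} {n : nat}.
Implicit Types (x : 'rV[R]_n).

Lemma within_cvg (F : 'rV[R]_n -> R) (z : nat -> 'rV[R]_n) x :
  {within @weyl_ge R n, continuous F} -> (forall k, weyl_ge (z k)) -> weyl_ge x ->
  z k @[k --> \oo] --> x -> F (z k) @[k --> \oo] --> F x.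
Proof.
move=> /rV_withinP Fc wz wx /rV_cvgP zx; apply/cvgrPdist_lt => e e0.
have [d d0 dP] := Fc x wx e e0.
have : \forall k \near \oo, forall j, `|z k ord0 j - x ord0 j| < d.
  apply: (@filter_forall _ _ (fun j k => `|z k ord0 j - x ord0 j| < d)) => j.
  by have /cvgrPdist_lt/(_ _ d0) := zx j; apply: filterS => k; rewrite distrC.
by apply: filterS => k kd; rewrite distrC; exact: dP.
Qed.

Definition spread x (k : nat) : 'rV[R]_n := \row_j (x ord0 j + k.+1%:R^-1 * j.+1%:R).

Lemma spread_cvg x : spread x k @[k --> \oo] --> x.
Proof.
apply/rV_cvgP => j; under eq_fun do rewrite mxE.
have : x ord0 j + k.+1%:R^-1 * j.+1%:R @[k --> \oo] --> x ord0 j + 0 * j.+1%:R.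
  apply: cvgD; first exact: cvg_cst.
  by apply: cvgM; [exact: cvg_harmonic|exact: cvg_cst].
by rewrite mul0r addr0.
Qed.

Lemma spread_interior x k : weyl_ge x -> weyl_ge_interior (spread x k).
Proof.
move=> [wx x0]; split => [i j ij|j]; rewrite !mxE.
  apply: ler_ltD; first by apply: wx; exact: ltnW.
  by rewrite ltr_pM2l ?invr_gt0// ltr_nat.
by rewrite ltr_wpDl// mulr_gt0// invr_gt0.
Qed.

Lemma interior_weyl_ge x : weyl_ge_interior x -> weyl_ge x.
Proof.
move=> [sx x0]; split => [i j|j]; last exact: ltW.
by rewrite leq_eqVlt => /predU1P[/val_inj ->//|ij]; exact/ltW/sx.
Qed.

(** Sequences with strictly increasing coordinates suffice to test continuity,
    because any point of the chamber can be moved slightly inside.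
    This is the form in which the weak limits defining the kernel are given. *)
Lemma within_of_strict_sequences (F : 'rV[R]_n -> R) :
  (forall x z, weyl_ge x -> (forall k, weyl_strict (z k)) ->
    (forall k, weyl_ge (z k)) -> z k @[k --> \oo] --> x ->
    F (z k) @[k --> \oo] --> F x) ->
  {within @weyl_ge R n, continuous F}.
Proof.
move=> H; apply/rV_withinP => x wx e e0.
have e2 : 0 < e / 2 by rewrite divr_gt0.
have [d d0 dP] : exists2 d, 0 < d & forall z, weyl_ge z -> weyl_strict z ->
    (forall j, `|z ord0 j - x ord0 j| < d) -> `|F z - F x| < e / 2.
  apply: contrapT => nd.
  have ex k : exists z : 'rV[R]_n, [/\ weyl_ge z, weyl_strict z,
      forall j, `|z ord0 j - x ord0 j| < k.+1%:R^-1 & ~ `|F z - F x| < e / 2].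
    apply: contrapT => nz; apply: nd; exists k.+1%:R^-1; first by rewrite invr_gt0.
    by move=> z wz sz zx; apply: contrapT => nF; apply: nz; exists z.
  have [z zP] := choice ex.
  have zx : z k @[k --> \oo] --> x.
    apply/rV_cvgP => j; apply/cvgrPdist_lt => d d0.
    have : \forall k \near \oo, k.+1%:R^-1 < d by exact: near_infty_natSinv_lt (PosNum d0).
    apply: filterS => k kd; rewrite distrC; apply: lt_trans kd.
    by have [_ _ /(_ j)] := zP k.
  have /cvgrPdist_lt/(_ _ e2)[K _ /(_ K (leqnn K))] : F (z k) @[k --> \oo] --> F x.
    by apply: H => // k; have [] := zP k.
  by rewrite distrC => hK; have [_ _ _] := zP K.
exists (d / 2) => [|y wy yx]; first by rewrite divr_gt0.
apply: (@le_lt_trans _ _ (e / 2)); last by lra.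
have c : F (spread y k) @[k --> \oo] --> F y.
  apply: H => // [k|k|].
  - by have [] := spread_interior k wy.
  - exact/interior_weyl_ge/spread_interior.
  - exact: spread_cvg.
have c2 : `|F (spread y k) - F x| @[k --> \oo] --> `|F y - F x|.
  by apply: cvg_norm; apply: cvgB => //; exact: cvg_cst.
apply: (closed_cvg (fun u => u <= e / 2)) c2; first exact: closed_le.
have d2 : 0 < d / 2 by rewrite divr_gt0.
have : \forall k \near \oo, forall j, `|spread y k ord0 j - y ord0 j| < d / 2.
  apply: (@filter_forall _ _ (fun j k => `|spread y k ord0 j - y ord0 j| < d / 2)) => j.
  have /cvgrPdist_lt/(_ _ d2) := (rV_cvgP _ _).2 (@spread_cvg y) j.
  by apply: filterS => k; rewrite distrC.
apply: filterS => k kd; apply/ltW/dP.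
- exact/interior_weyl_ge/spread_interior.
- by have [] := spread_interior k wy.
- move=> j; have := kd j; have := yx j; rewrite !ltr_norml; lra.
Qed.

End approach.

Lemma continuous_sum_dist {R : realType} {X : topologicalType} {I : finType}
    (f g : I -> X -> R) : (forall j, continuous (f j)) ->
  (forall j, continuous (g j)) -> continuous (fun y => \sum_j `|f j y - g j y|).
Proof.
move=> fc gc y; apply: cvg_big => // [|j _]; first by move=> z; apply: add_continuous.
by apply: cvg_norm; apply: cvgB; [exact: fc|exact: gc].
Qed.

Section interlacing_continuity.
Context {R : realType} {n : nat} (L : R.-pker 'rV[R]_n.+1 ~> 'rV[R]_n).
Hypothesis Lk : interlacing_kernel L.
Implicit Types (x : 'rV[R]_n.+1) (y : 'rV[R]_n).
Local Notation mu := (@lebesgue_measure R).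

(** A bounded continuous function vanishing exactly on the chamber: it is
    integrable for every kernel and tests its support. *)
Let dist_weyl y : R := Num.min 1 (\sum_j `|run_max y ord0 j - y ord0 j|).

Let run_max_coord_cvg (j : 'I_n) : continuous (fun y : 'rV[R]_n => run_max y ord0 j).
Proof.
apply/rV_continuousP => y e e0; exists (e / 2); first by rewrite divr_gt0.
move=> z zy; apply: (@le_lt_trans _ _ (e / 2)); last by lra.
by apply: run_max_lip => [|i]; apply: ltW => //; rewrite divr_gt0.
Qed.

Let coord_cvg (j : 'I_n) : continuous (fun y : 'rV[R]_n => y ord0 j).
Proof. by apply/rV_continuousP => y e e0; exists e. Qed.

Let dist_weyl_continuous : continuous dist_weyl.
Proof.
move=> y; apply: continuous_min; first exact: cst_continuous.
exact: (@continuous_sum_dist _ _ _ (fun j y => run_max y ord0 j) (fun j y => y ord0 j)).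
Qed.

Let dist_weyl_ge0 y : 0 <= dist_weyl y.
Proof. by rewrite /dist_weyl le_min ler01/= sumr_ge0. Qed.

Let dist_weyl_le1 y : `|dist_weyl y| <= 1.
Proof. by rewrite ger0_norm// /dist_weyl ge_min lexx. Qed.

Let dist_weyl0 y : dist_weyl y = 0 -> weyl_ge y.
Proof.
rewrite /dist_weyl /Num.min; case: ifP => [_ /eqP|_ /eqP]; first by rewrite oner_eq0.
rewrite psumr_eq0// => /allP H; suff -> : y = run_max y by exact: run_max_weyl_ge.
apply/rowP => j; have := H j (mem_index_enum _); rewrite normr_eq0 subr_eq0.
by move=> /eqP.
Qed.

Lemma interlace_weyl_ge x y : weyl_ge x -> interlace x y -> weyl_ge y.
Proof.
move=> [_ x0] [wy H]; split => // j; have /andP[h _] := H j.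
exact: le_trans (x0 _) h.
Qed.

Let ae_weyl_strict x : weyl_ge x -> weyl_strict x -> {ae L x, forall y, weyl_ge y}.
Proof.
move=> wx sx; apply: aeS (ae_interlace Lk sx) => y [iy _].
exact: interlace_weyl_ge iy.
Qed.

(** At a boundary point the measure is a weak limit of measures carried by the
    chamber, so the integral of [dist_weyl] is a limit of zeros. *)
Lemma ae_interlacing_weyl_ge x : weyl_ge x -> {ae L x, forall y, weyl_ge y}.
Proof.
move=> wx; have [sx|ns] := pselect (weyl_strict x); first exact: ae_weyl_strict.
have [_ wl] := Lk; have wx' : weyl x by case: wx.
have mh := continuous_rV_measurable dist_weyl_continuous.
have sz k : weyl_strict (spread x k) by have [] := spread_interior k wx.
have H := wl x (spread x) wx' ns sz (@spread_cvg _ _ x) dist_weyl dist_weyl_continuous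
  (ex_intro _ 1 dist_weyl_le1).
have z0 k : \int[L (spread x k)]_y dist_weyl y = 0.
  transitivity (\int[L (spread x k)]_y (0 : R)); last by rewrite /Rintegral integral0.
  apply: Rint_ae_eq => //; apply: aeS (ae_weyl_strict _ (sz k)) => [y wy|].
    rewrite /dist_weyl; rewrite big1; first by rewrite (min_idPr ler01).
    by move=> j _; rewrite run_max_id// subrr normr0.
  exact/interior_weyl_ge/spread_interior.
have I0 : \int[L x]_y dist_weyl y = 0.
  rewrite (_ : (fun k => _) = fun=> 0) in H; last by apply: funext => k; exact: z0.
  have H0 : (fun=> 0 : R) @ \oo --> (0 : R) by exact: cvg_cst.
  exact: (cvg_unique _ H H0).
have Ih : L1 (L x) dist_weyl by exact: pker_L1.
have mE : measurable_fun setT (EFin \o dist_weyl) by exact/measurable_EFinP.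
have /(ae_eq_integral_abs (L x) measurableT mE) h0 :
    (\int[L x]_y `|(EFin \o dist_weyl) y| = 0)%E.
  under eq_integral do rewrite /= ger0_norm//.
  by rewrite (Rint_EFin Ih) I0.
apply: aeS h0 => y /(_ I) [] ; exact: dist_weyl0.
Qed.

Let xl x (i : 'I_n) := x ord0 (widen_ord (leqnSn n) i).
Let xr x (i : 'I_n) := x ord0 (lift ord0 i).

Lemma ind_itv_cvg (u v : nat -> R) (a b c : R) : c != a -> c != b ->
  u k @[k --> \oo] --> a -> v k @[k --> \oo] --> b ->
  ind (u k <= c <= v k) @[k --> \oo] --> (ind (a <= c <= b) : R).
Proof.
move=> ca cb ua vb.
have hu : \forall k \near \oo, (u k <= c) = (a <= c).
  case: (ltgtP a c) ca => // ac _; last 1 first.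
  - by near=> k; apply/negbTE; rewrite -ltNge; near: k; exact: cvgr_gt ua _ ac.
  - by near=> k; apply/ltW; near: k; exact: cvgr_lt ua _ ac.
have hv : \forall k \near \oo, (c <= v k) = (c <= b).
  case: (ltgtP c b) cb => // bc _; last 1 first.
  - by near=> k; apply/negbTE; rewrite -ltNge; near: k; exact: cvgr_lt vb _ bc.
  - by near=> k; apply/ltW; near: k; exact: cvgr_gt vb _ bc.
apply: cvg_near_cst; near=> k.
have -> : (u k <= c) = (a <= c) by near: k.
by have -> : (c <= v k) = (c <= b) by near: k.
Unshelve. all: by end_near. Qed.

Let ae_off_boundary x : {ae leb R n, forall y, forall i, y ord0 i != xl x i /\ y ord0 i != xr x i}.
Proof.
pose A (i : 'I_n) := [set y : 'rV[R]_n | y ord0 i = xl x i] `|` [set y | y ord0 i = xr x i].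
have nA i : (leb R n).-negligible (A i) by apply: negligibleU; exact: leb_coord_null.
have nU : (leb R n).-negligible (\big[setU/set0]_i A i).
  by apply: big_ind => //; [exact: negligible_set0|move=> *; exact: negligibleU].
apply: negligibleS nU => y /= H; apply: contrapT => nA'; apply: H => i.
split; apply/eqP => yi; apply: nA'; rewrite -bigcup_seq; exists i => //=.
- by rewrite mem_index_enum.
- by left.
- by rewrite mem_index_enum.
- by right.
Qed.

(** Inside the chamber the density converges almost everywhere: the indicators of
    interlacing fail to converge only when a coordinate of [y] equals one of
    [x]. *)
Let kernel_op_cvg_bounded f C x (z : nat -> 'rV[R]_n.+1) : 0 <= C ->
  bounded_measurable f C -> weyl_strict x ->
  (forall k, weyl_strict (z k)) -> (forall k j, `|z k ord0 j - x ord0 j| <= 1) ->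
  z k @[k --> \oo] --> x ->
  kernel_op L (@weyl_ge R n) f (z k) @[k --> \oo] --> kernel_op L (@weyl_ge R n) f x.
Proof.
move=> C0 [mf fC] sx sz zb zx.
pose J w := \int[leb R n]_y (ind (interlaceb w y) * (wcut f y * vandermonde y)).
have KE w : weyl_strict w ->
    kernel_op L (@weyl_ge R n) f w = n`!%:R / vandermonde w * J w.
  by move=> sw; rewrite kernel_opE (interlacing_Rint Lk sw mf fC).2.
rewrite KE//; under eq_fun do rewrite KE//.
apply: cvgM.
  apply: cvgM; first exact: cvg_cst.
  by apply: cvgV; [rewrite gt_eqF// vandermonde_gt0|exact: vandermonde_cvg].
pose B := 1 + \sum_j `|x ord0 j|.
have B0 : 0 <= B by rewrite addr_ge0// sumr_ge0.
have zB k j : `|z k ord0 j| <= B.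
  rewrite (_ : z k ord0 j = (z k ord0 j - x ord0 j) + x ord0 j); last by rewrite subrK.
  by rewrite (le_trans (ler_normD _ _))// lerD// (bigD1 j)//= lerDl sumr_ge0.
pose V : R := \prod_(i < n) \prod_(j < n | (i < j)%N) (B + B).
have V0 : 0 <= V by rewrite prodr_ge0// => i _; rewrite prodr_ge0// => j _; rewrite addr_ge0.
pose bound y := C * V * \prod_j ind (- B <= y ord0 j <= B).
have Ib : L1 (leb R n) bound.
  apply: L1Z.
  have h (j : 'I_n) : L1 mu (fun u => ind (- B <= u <= B)).
    have -> : (fun u : R => ind (- B <= u <= B)) = (\1_(`[- B, B]%classic) : R -> R).
      by apply: funext => w; rewrite indicE mem_setE in_itv/= /ind; case: ifP.
    exact: integrable_indic_itv.
  exact: (leb_prod h).1.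
have mint w : weyl_strict w -> measurable_fun setT
    (fun y => ind (interlaceb w y) * (wcut f y * vandermonde y)).
  by move=> sw; exact: L1_measurable (interlacing_Rint Lk sw mf fC).1.
apply: (@Rint_dominated _ _ _ (leb R n) _ _ bound _ _ _ Ib _).2.
- by move=> k; exact: mint.
- exact: mint.
- apply: aeS (ae_off_boundary x) => y yx; apply: cvgM; last exact: cvg_cst.
  rewrite ind_interlaceb; under eq_fun do rewrite ind_interlaceb.
  apply: cvg_big => // [|i _]; first by move=> u; apply: mul_continuous.
  have [y1 y2] := yx i.
  by apply: ind_itv_cvg => //; move/rV_cvgP : zx; apply.
- move=> k y; rewrite /bound prod_ind normrM.
  have [ib|ib] := boolP (interlaceb (z k) y); last first.
    by rewrite {1}/ind normr0 mul0r mulr_ge0 ?ind_ge0// mulr_ge0.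
  have yB j : - B <= y ord0 j <= B.
    have /andP[h1 h2] := forallP ib j.
    have := zB k (widen_ord (leqnSn n) j); have := zB k (lift ord0 j).
    rewrite !ler_norml => /andP[_ h3] /andP[h4 _].
    by rewrite (le_trans h4 h1) (le_trans h2 h3).
  have -> : [forall j, - B <= y ord0 j <= B] by exact/forallP.
  rewrite /ind normr1 mul1r mulr1 normrM ler_pM// /V normr_prod.
  apply: ler_prod => i _; rewrite normr_ge0/= normr_prod; apply: ler_prod => j _.
  rewrite normr_ge0/= (le_trans (ler_normB _ _))// lerD// ler_norml; exact: yB.
Qed.

(** At a boundary point the weak convergence is applied to [f] composed with the
    retraction [run_max], which is continuous on the whole space and agrees with
    [f] on the supports. *)
Lemma kernel_op_interlacing_continuous f C : 0 <= C ->
  {within @weyl_ge R n, continuous f} -> (forall y, weyl_ge y -> `|f y| <= C) ->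
  {within @weyl_ge R n.+1, continuous (kernel_op L (@weyl_ge R n) f)}.
Proof.
move=> C0 fc fC; apply: within_of_strict_sequences => x z wx sz wz zx.
have mf := measurable_wcut_continuous fc.
have Bf : bounded_measurable f C by split => //; exact: wcut_norm.
have [sx|ns] := pselect (weyl_strict x).
  have : \forall k \near \oo, forall j, `|z k ord0 j - x ord0 j| < 1.
    apply: (@filter_forall _ _ (fun j k => `|z k ord0 j - x ord0 j| < 1)) => j.
    have /cvgrPdist_lt/(_ _ ltr01) := (rV_cvgP _ _).2 zx j.
    by apply: filterS => k; rewrite distrC.
  move=> [K _ KP]; rewrite -(cvg_shiftn K).
  apply: (kernel_op_cvg_bounded C0 Bf sx (z := fun k => z (k + K)%N)) => //.
    by move=> k j; apply/ltW/KP; rewrite /= leq_addl.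
  by rewrite (cvg_shiftn K z).
have [_ wl] := Lk; have wx' : weyl x by case: wx.
have gc := run_max_continuous fc.
have gb : exists M : R, forall y, `|(f \o run_max) y| <= M.
  by exists C => y; apply: fC; exact: run_max_weyl_ge.
have H := wl x z wx' ns sz zx (f \o run_max) gc gb.
have E w : weyl_ge w -> kernel_op L (@weyl_ge R n) f w = \int[L w]_y (f \o run_max) y.
  move=> ww; rewrite kernel_opE; apply: Rint_ae_eq => //.
    exact: continuous_rV_measurable.
  by apply: aeS (ae_interlacing_weyl_ge ww) => y wy; rewrite wcutE//= run_max_id.
rewrite E//; under eq_fun do rewrite E//.
exact: H.
Qed.

End interlacing_continuity.

(** * Bounded continuous functions under the semigroup, and conclusion *)

Lemma continuous_clamp {R : realType} {X : topologicalType} (c : R) (s : X -> R) :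
  continuous s -> continuous (fun y => Num.max 0 (Num.min 1 (c - s y))).
Proof.
move=> sc y.
have dc : {for y, continuous (fun y => c - s y : R^o)}.
  by apply: cvgB; [exact: cvg_cst|exact: sc].
have c0 (a : R) : {for y, continuous (fun=> a : R^o)} by exact: cst_continuous.
exact: (continuous_max (c0 0) (continuous_min (c0 1) dc)).
Qed.

(** The image of f under the interlacing kernel enters as a bounded continuous
    function, while the Feller property speaks of functions vanishing at
    infinity. The cutoffs [bump] and the conservativity of [T] bridge the gap,
    without an estimate of the kernel at infinity. *)
Section bounded_Feller.
Context {R : realType} {n : nat} (p : R -> R -> R -> R)
  (T : R -> R.-pker 'rV[R]_n ~> 'rV[R]_n).
Hypothesis Ts : laguerre_semigroup p T.
Local Notation W := (@weyl_ge R n).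
Implicit Types (x y : 'rV[R]_n).

Definition bump (M : nat) y : R :=
  Num.max 0 (Num.min 1 (M.+1%:R - \sum_j `|y ord0 j - 0|)).

Lemma bump_ge0_le1 M y : 0 <= bump M y <= 1.
Proof. by rewrite /bump le_max lexx/= ge_max ler01 ge_min lexx. Qed.

Lemma bump1 M y : \sum_j `|y ord0 j - 0| <= M%:R -> bump M y = 1.
Proof.
move=> h; rewrite /bump.
have -> : Num.min 1 (M.+1%:R - \sum_j `|y ord0 j - 0|) = 1.
  by apply/min_idPl; rewrite -natr1; lra.
by apply/max_idPr.
Qed.

Lemma bump0 M y j : M.+1%:R < y ord0 j -> bump M y = 0.
Proof.
move=> h; rewrite /bump; apply/max_idPl; rewrite ge_min; apply/orP; right.
rewrite subr_le0 (le_trans (ltW h))//.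
rewrite (le_trans (ler_norm _))// (bigD1 j)//= subr0 lerDl sumr_ge0//.
Qed.

Lemma coord_continuous (j : 'I_n) : continuous (fun y : 'rV[R]_n => y ord0 j).
Proof. by apply/rV_continuousP => y e e0; exists e. Qed.

Lemma bump_continuous M : continuous (bump M).
Proof.
apply: continuous_clamp.
apply: (@continuous_sum_dist _ _ _ (fun j y => y ord0 j) (fun j y => 0)) => j.
  exact: coord_continuous.
exact: cst_continuous.
Qed.

Lemma bump_C_infty M (h : 'rV[R]_n -> R) : {within W, continuous h} ->
  C_infty W (fun y => h y * bump M y).
Proof.
move=> hc; split.
  move=> y; apply: (@continuousM _ (subspace W) h (bump M)); first exact: hc.
  exact: (continuous_subspaceT (@bump_continuous M)).
move=> e e0.
pose box := [set y : 'rV[R]_n | forall j, `[0, M.+1%:R]%classic (y ord0 j)].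
have cbox : compact box.
  have := @rV_compact R n (fun=> `[0, M.+1%:R]%classic).
  by apply=> j; exact: segment_compact.
have rc : continuous (@run_max R n).
  move=> y P /nbhs_rVP[d d0 dP]; apply/nbhs_rVP; exists (d / 2); first by rewrite divr_gt0.
  move=> z zy; apply: dP => j; apply: (@le_lt_trans _ _ (d / 2)); last by lra.
  by apply: run_max_lip => [|i]; apply: ltW => //; rewrite divr_gt0.
(* The image of the box under the retraction is a compact subset of the
   chamber. *)
exists (@run_max R n @` box); split.
- apply: continuous_compact => //; exact: continuous_subspaceT.
- by move=> _ [y _ <-]; exact: run_max_weyl_ge.
- move=> y wy ny; have [j hj] : exists j, M.+1%:R < y ord0 j.
    apply: contrapT => H; apply: ny; exists y; last exact: run_max_id.
    move=> j /=; rewrite in_itv/=; have [_ ->] := wy.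
    by rewrite leNgt; apply/negP => hj; apply: H; exists j.
  by rewrite (bump0 hj) mulr0 normr0.
Qed.

Variables (t : R) (t0 : 0 <= t).

Let bounded_bump M : bounded_measurable (bump M) 1.
Proof.
split.
  by apply: measurable_wcut; apply: continuous_rV_measurable; exact: bump_continuous.
apply: wcut_norm => // y _; have /andP[h1 h2] := bump_ge0_le1 M y.
by rewrite ger0_norm.
Qed.

Let one_cont : {within W, continuous (fun=> 1 : R)}.
Proof. by apply: continuous_subspaceT => y; exact: cst_continuous. Qed.

Let bump_C M : C_infty W (bump M).
Proof.
have := bump_C_infty M one_cont.
by under eq_fun do rewrite mul1r.
Qed.

Let T_bump_cvg x : W x -> kernel_op (T t) W (bump M) x @[M --> \oo] --> (1 : R).
Proof.
move=> wx; have [supp _ _] := Ts.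
have -> : 1 = kernel_op (T t) W (fun=> 1) x :> R.
  rewrite /kernel_op Rintegral_cst//; last exact: measurable_weyl_ge.
  by rewrite supp// mulr1.
apply: (@kernel_op_dominated _ _ _ (T t) _ _ 1).
- by [].
- by apply: measurable_wcut.
- apply: aeW => y; have [wy|wy] := pselect (W y); last first.
    by rewrite wcut0//; under eq_fun do rewrite wcut0//; exact: cvg_cst.
  rewrite wcutE//; under eq_fun do rewrite wcutE//.
  apply: cvg_near_cst; near=> M; apply: bump1.
  apply: (@le_trans _ _ (Num.trunc (\sum_j `|y ord0 j - 0|)).+1%:R).
    have /truncn_itv/andP[_ /ltW //] : 0 <= \sum_j `|y ord0 j - 0| by exact: sumr_ge0.
  by rewrite ler_nat; near: M; exact: nbhs_infty_gt.
Unshelve. all: by end_near. Qed.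

(** The error made by the cutoff is controlled by T (1 - bump), whose value at
    nearby points is controlled in turn by the continuity of T bump. *)
Let T_cut_dist (h : 'rV[R]_n -> R) C M x : 0 <= C -> {within W, continuous h} ->
  (forall y, W y -> `|h y| <= C) -> W x ->
  `|kernel_op (T t) W h x - kernel_op (T t) W (fun y => h y * bump M y) x| <=
  C * (1 - kernel_op (T t) W (bump M) x).
Proof.
move=> C0 hc hC wx; have [supp _ _] := Ts.
have mh := measurable_wcut_continuous hc.
have Ih : L1 (T t x) (wcut h) by apply: (pker_L1 _ _ mh (C := C)); exact: wcut_norm.
have mb : measurable_fun setT (wcut (bump M)) by case: (bounded_bump M).
have Ib : L1 (T t x) (wcut (bump M)).
  by apply: (pker_L1 _ _ mb (C := 1)); case: (bounded_bump M).
have cE : wcut (fun y => h y * bump M y) = (fun y => wcut h y * wcut (bump M) y).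
  apply: funext => y; have [wy|wy] := pselect (W y); first by rewrite !wcutE.
  by rewrite !wcut0// mulr0.
have Ihb : L1 (T t x) (fun y => wcut h y * wcut (bump M) y).
  apply: (@L1_boundedM _ _ _ (T t x) C) => //; exact: wcut_norm.
have I1 : L1 (T t x) (wcut (fun=> 1)).
  apply: (pker_L1 _ _ _ (C := 1)); first exact: measurable_wcut.
  by apply: wcut_norm => // y _; rewrite normr1.
have -> : 1 = \int[T t x]_y wcut (fun=> 1 : R) y.
  rewrite -kernel_opE /kernel_op Rintegral_cst//; last exact: measurable_weyl_ge.
  by rewrite supp// mulr1.
rewrite !kernel_opE cE -!RintegralB// -RintZ; last exact: L1B.
apply: Rint_norm_le; [exact: L1B|apply: L1Z; exact: L1B|] => y.
have [wy|wy] := pselect (W y); last by rewrite !wcut0// mul0r !subrr mulr0 normr0.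
rewrite !wcutE//; have /andP[b0 b1] := bump_ge0_le1 M y.
rewrite (_ : h y - h y * bump M y = h y * (1 - bump M y)); last by ring.
by rewrite normrM [`|1 - _|]ger0_norm ?subr_ge0// ler_wpM2r ?subr_ge0// hC.
Qed.

Lemma laguerre_semigroup_continuous (h : 'rV[R]_n -> R) C : 0 <= C ->
  {within W, continuous h} -> (forall y, W y -> `|h y| <= C) ->
  {within W, continuous (kernel_op (T t) W h)}.
Proof.
move=> C0 hc hC; apply/rV_withinP => x wx e e0.
have [_ FD _] := Ts.
have C1 : 0 < 8 * (C + 1) by lra.
have e1 : 0 < e / (8 * (C + 1)) by rewrite divr_gt0.
have e4 : 0 < e / 4 by rewrite divr_gt0.
have /cvgrPdist_lt/(_ _ e1)[M _ /(_ M (leqnn M)) hM] := T_bump_cvg wx.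
have [cb _] := FD_C_infty FD t0 (bump_C M).
have [ch _] := FD_C_infty FD t0 (bump_C_infty M hc).
have [d1 d10 D1] := (rV_withinP _ _).1 cb x wx _ e1.
have [d2 d20 D2] := (rV_withinP _ _).1 ch x wx _ e4.
exists (Num.min d1 d2); first by rewrite lt_min d10.
move=> y wy yx.
have {}D1 : `|kernel_op (T t) W (bump M) y - kernel_op (T t) W (bump M) x| <
    e / (8 * (C + 1)).
  by apply: D1 => // j; have := yx j; rewrite lt_min => /andP[].
have {}D2 := D2 y wy _.
have {}D2 : `|kernel_op (T t) W (fun y => h y * bump M y) y -
    kernel_op (T t) W (fun y => h y * bump M y) x| < e / 4.
  by apply: D2 => j; have := yx j; rewrite lt_min => /andP[].
have B1 := T_cut_dist M C0 hc hC wx; have B2 := T_cut_dist M C0 hc hC wy.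
have eE : e = 8 * (C + 1) * (e / (8 * (C + 1))) by field; rewrite gt_eqF//; lra.
set b := e / (8 * (C + 1)) in e1 hM D1 eE.
have b1 : C * (1 - kernel_op (T t) W (bump M) x) <= C * b.
  by rewrite ler_wpM2l//; move: hM; rewrite ltr_norml; lra.
have b2 : C * (1 - kernel_op (T t) W (bump M) y) <= C * (2 * b).
  by rewrite ler_wpM2l//; move: hM D1; rewrite !ltr_norml; lra.
have Cb : 0 <= C * b by rewrite mulr_ge0// ltW.
move: B1 B2 D2; rewrite !ler_norml !ltr_norml; nra.
Qed.

Lemma laguerre_semigroup_id (h : 'rV[R]_n -> R) C x : t = 0 -> 0 <= C ->
  {within W, continuous h} -> (forall y, W y -> `|h y| <= C) -> W x ->
  kernel_op (T t) W h x = h x.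
Proof.
move=> tz C0 hc hC wx; have [_ FD _] := Ts.
pose M := (Num.trunc (\sum_j `|x ord0 j - 0|)).+1.
have Mx : bump M x = 1.
  apply: bump1; have : 0 <= \sum_j `|x ord0 j - 0| by exact: sumr_ge0.
  by move=> /truncn_itv/andP[_ /ltW].
have := T_cut_dist M C0 hc hC wx.
rewrite tz (FD_id FD (bump_C M) wx) (FD_id FD (bump_C_infty M hc) wx) Mx mulr1.
rewrite subrr mulr0 => H; apply/eqP; rewrite -subr_eq0 -normr_le0; exact: H.
Qed.

End bounded_Feller.

Theorem lemma3p5 (R : realType) (alpha : R) (N : nat)
    (p q : R -> R -> R -> R)
    (T : R -> R.-pker 'rV[R]_N.+1 ~> 'rV[R]_N.+1)
    (T' : R -> R.-pker 'rV[R]_N ~> 'rV[R]_N)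
    (Lambda : R.-pker 'rV[R]_N.+1 ~> 'rV[R]_N)
    (alpha_gt : -1 < alpha)
    (p_density : laguerre_density alpha p)
    (q_density : laguerre_density (alpha + 1) q)
    (T_semigroup : laguerre_semigroup p T)
    (T'_semigroup : laguerre_semigroup q T')
    (Lambda_kernel : interlacing_kernel Lambda)
    (f : 'rV[R]_N -> R) (f_C_infty : C_infty (@weyl_ge R N) f)
    (t : R) (t_ge0 : 0 <= t) (x : 'rV[R]_N.+1) (x_weyl : weyl_ge x) :
  kernel_op (T t) (@weyl_ge R N.+1)
    (kernel_op Lambda (@weyl_ge R N) f) x =
  kernel_op Lambda (@weyl_ge R N) (kernel_op (T' t) (@weyl_ge R N) f) x.
Proof.
have [C C0 fC] := C_infty_bounded f_C_infty.
have [fc _] := f_C_infty.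
have Bf : bounded_measurable f C.
  by split; [exact: measurable_wcut_continuous|exact: wcut_norm].
have Fc := kernel_op_interlacing_continuous Lambda_kernel C0 fc fC.
have FC y : weyl_ge y -> `|kernel_op Lambda (@weyl_ge R N) f y| <= C.
  by move=> _; exact: kernel_op_norm.
have [_ FD' _] := T'_semigroup.
move: t_ge0; rewrite le_eqVlt => /predU1P[t0|t0].
  rewrite -t0 (laguerre_semigroup_id T_semigroup (lexx 0) erefl C0 Fc FC x_weyl).
  rewrite !kernel_opE; congr Rintegral; apply: eq_wcut => y wy.
  by rewrite (FD_id FD' f_C_infty wy).
have [Hc _] := FD_C_infty FD' (ltW t0) f_C_infty.
have HC y : weyl_ge y -> `|kernel_op (T' t) (@weyl_ge R N) f y| <= C.
  by move=> _; exact: kernel_op_norm.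
have Gc := kernel_op_interlacing_continuous Lambda_kernel C0 Hc HC.
have Tc := laguerre_semigroup_continuous T_semigroup (ltW t0) C0 Fc FC.
have si k : weyl_ge_interior (spread x k) by exact: spread_interior.
have sw k : weyl_ge (spread x k) by exact: interior_weyl_ge.
have c1 := within_cvg Tc sw x_weyl (@spread_cvg _ _ x).
have c2 := within_cvg Gc sw x_weyl (@spread_cvg _ _ x).
apply: (cvg_unique _ c1 _) => //.
rewrite (_ : (fun k => _) = (fun k => kernel_op Lambda (@weyl_ge R N)
  (kernel_op (T' t) (@weyl_ge R N) f) (spread x k))); first exact: c2.
apply: funext => k.
exact: (intertwining_interior alpha_gt p_density q_density T_semigroup
  T'_semigroup Lambda_kernel t0 (si k) C0 fc fC).
Qed.
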